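(* Let $G=(V,E)$ be a connected graph with bounded degree. Assume that there exist real numbers $d>4$ and $c>0$ such that $$p_n(x,x)\le \frac{c}{n^{d/2}}\qquad\text{for all } x\in V \text{ and all } n\ge 1.$$ Then there exists $p<1$ such that for every finite set $S\subset V$, $$\mathbf{P}_p[S\not\leftrightarrow\infty]\le \exp\big[-\tfrac12\,\mathrm{cap}(S)\big].$$ In particular, $p_c(G)<1$.
   Context: For a graph $G=(V,E)$, $d(x)$ denotes the number of $y\in V$ such that $xy\in E$; bounded degree means $\sup_{x\in V}d(x)<\infty$. Simple random walk $(X_n)_{n\ge0}$ is the discrete-time Markov chain on $V$ which at each step moves to a uniformly chosen neighbor of its current position; $\mathrm{P}$ denotes its law, and $p_n(x,y):=\mathrm{P}[X_n=y\mid X_0=x]$. For finite $S\subset V$, the capacity of $S$ is $\mathrm{cap}(S):=\sum_{x\in S}d(x)\,\mathrm{P}[X_k\notin S\ \forall k\ge1\mid X_0=x]$. For $p\in[0,1]$, $\mathbf{P}_p$ is Bernoulli bond percolation on $G$: the law of $\omega=(\omega_e)_{e\in E}\in\{0,1\}^E$ with independent coordinates, each equal to $1$ with probability $p$. An edge $e$ is open if $\omega_e=1$ and closed otherwise. $\{S\leftrightarrow\infty\}$ is the event that $S$ intersects an infinite connected component of the graph with vertex set $V$ and the open edges; $\{S\not\leftrightarrow\infty\}$ is its complement. The critical parameter is $p_c(G):=\inf\{p\in[0,1]:\mathbf{P}_p[x\leftrightarrow\infty]>0\}$, where $x\in V$ is arbitrary (the value does not depend on $x$). *)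

(* Defs.v *)
From HB Require Import structures.
From mathcomp Require Import all_boot all_order all_algebra finmap.
From mathcomp Require Import all_classical all_reals all_analysis.
From mathcomp Require Import ring.

Set Implicit Arguments.
Unset Strict Implicit.
Unset Printing Implicit Defensive.

Import Order.TTheory GRing.Theory Num.Theory.
Import numFieldNormedType.Exports.

Local Open Scope classical_set_scope.
Local Open Scope ring_scope.

Definition depends_on (I T U : Type) (D : set I) (f : (I -> T) -> U) :=
  forall w w' : I -> T, (forall i, D i -> w i = w' i) -> f w = f w'.

(* The sets of families determined by finitely many coordinates; they generate
   the product of the discrete sigma-algebras, which [product_space] carries. *)
Definition cylinder (I : choiceType) (T : Type) : set (set (I -> T)) :=
  [set A | exists J : {fset I}, depends_on [set` J] A].

Definition cylinder_algebra (I : choiceType) (T : Type) : Type := I -> T.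

Notation product_space I T := (g_sigma_algebraType (@cylinder I T)).

Lemma depends_onW (I T U : Type) (D D' : set I) (f : (I -> T) -> U) :
  D `<=` D' -> depends_on D f -> depends_on D' f.
Proof. by move=> DD' fD w w' ww'; apply: fD => i /DD'; exact: ww'. Qed.

Section algebra.
Variables (I : choiceType) (T : Type).

Lemma cylinder0 : @cylinder I T set0.
Proof. by exists fset0. Qed.

Lemma cylinderU : setU_closed (@cylinder I T).
Proof.
move=> A B [J AJ] [K BK]; exists (J `|` K)%fset => w w' ww'.
by rewrite /setU /mkset (AJ w w') ?(BK w w')// => i iJ; apply: ww';
  rewrite /= in_fsetU iJ ?orbT.
Qed.

Lemma cylinderC : setC_closed (@cylinder I T).
Proof. by move=> A [J AJ]; exists J => w w' ww'; rewrite /setC /mkset (AJ w w'). Qed.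

End algebra.

Section algebra_instance.
Variables (I : choiceType) (T : pointedType).

HB.instance Definition _ := Pointed.on (cylinder_algebra I T).
HB.instance Definition _ := @isAlgebraOfSets.Build default_measure_display
  (cylinder_algebra I T) (@cylinder I T) (@cylinder0 I T) (@cylinderU I T)
  (@cylinderC I T).

End algebra_instance.

(* Kolmogorov extension for finitely supported coordinates: a positive, additive,
   normalized functional on the functions of finitely many coordinates is the
   integral of a probability measure.  Positivity is only tested on the compact
   set of families whose [i]-th coordinate lies in the finite set [K i]. *)
Section extension.
Variables (R : realType) (I : choiceType) (T : pointedType).
Implicit Types (A : set (I -> T)) (f g : (I -> T) -> R).

Definition local_fun f := exists J : {fset I}, depends_on [set` J] f.

Lemma local_indic A : cylinder A -> local_fun \1_A.
Proof.
move=> [J AJ]; exists J => w w' ww'; rewrite !indicE.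
by congr (_%:R); congr nat_of_bool; apply/idP/idP; rewrite !inE (AJ w w').
Qed.

Lemma local_cst c : local_fun (cst c).
Proof. by exists fset0. Qed.

Lemma localD f g : local_fun f -> local_fun g -> local_fun (f \+ g).
Proof.
move=> [J fJ] [K gK]; exists (J `|` K)%fset => w w' ww'.
by rewrite /= (fJ w w') ?(gK w w')// => i iJ; apply: ww';
  rewrite /= in_fsetU iJ ?orbT.
Qed.

Variable K : I -> {fset T}.

Let inK (w : I -> T) := forall i, w i \in K i.

Lemma cylinder_open A : cylinder A ->
  open (A : set {ptws I -> discrete_topology T}).
Proof.
move=> [J AJ]; rewrite openE => w Aw; rewrite /interior.
have wJ : nbhs (w : {ptws I -> discrete_topology T})
    (\bigcap_(i in [set` J]) [set w' | w' i = w i]).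
  have wi i : nbhs (w : {ptws I -> discrete_topology T}) [set w' | w' i = w i].
    have := @proj_continuous I (fun=> discrete_topology T) i w [set w i].
    by apply; exact: discrete_set1.
  exact: (@filter_bigI _ _ _ _ _ (nbhs_filter _) (fun i _ => wi i)).
apply: (@filterS _ (nbhs (w : {ptws I -> discrete_topology T})) _ _ _ _ wJ).
by move=> w' ww'; rewrite (AJ w' w)// => i /ww'.
Qed.

Lemma cylinder_compact A (F : (set (I -> T))^nat) :
  cylinder A -> (forall n, cylinder (F n)) -> A `<=` \bigcup_n F n ->
  exists n, forall w, inK w -> A w -> exists2 k, (k < n)%N & F k w.
Proof.
move=> cA cF AF.
have Kc : compact ([set w | inK w] : set {ptws I -> discrete_topology T}).
  apply: (@tychonoff I (fun=> discrete_topology T) (fun i => [set` K i])) => i.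
  by apply: finite_compact; exact: finite_fset.
have Acl : closed (A : set {ptws I -> discrete_topology T}).
  by rewrite -[A]setCK; apply: open_closedC; apply: cylinder_open; exact: cylinderC.
pose G n : set {ptws I -> discrete_topology T} :=
  [set w | [/\ inK w, A w & forall k, (k < n)%N -> ~ F k w]].
have Gle m n : (m <= n)%N -> G n `<=` G m.
  by move=> mn w [Kw Aw wF]; split => // k km; apply: wF; exact: leq_trans mn.
apply: contrapT => /forallNP noF.
have GF : ProperFilter (filter_from setT G).
  apply: filter_from_proper; last first.
    move=> n _; have /existsNP[w /not_implyP[Kw /not_implyP[Aw wF]]] := noF n.
    by exists w; split => // k kn Fkw; apply: wF; exists k.
  apply: filter_from_filter; first by exists 0%N.
  move=> m n _ _; exists (maxn m n) => // w Gw.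
  by split; apply: Gle Gw; rewrite ?leq_maxl ?leq_maxr.
have [|w [[_ Aw] clw]] := compact_closedI Kc Acl GF.
  by exists 0%N => // w [].
have [n _ Fnw] := AF w Aw.
have [||w' [[_ _ /(_ n)]]] := clw (G n.+1) (F n).
- by exists n.+1.
- by apply: open_nbhs_nbhs; split => //; exact: cylinder_open.
- by move=> /(_ (ltnSn n)).
Qed.

Variable L : ((I -> T) -> R) -> R.
Hypothesis L1 : L (cst 1) = 1.
Hypothesis LD : forall f g, local_fun f -> local_fun g ->
  L (f \+ g) = L f + L g.
Hypothesis Lle : forall f g, local_fun f -> local_fun g ->
  (forall w, inK w -> f w <= g w) -> L f <= L g.

Let L0 : L (cst 0) = 0.
Proof.
have := LD (local_cst 0) (local_cst 0).
rewrite (_ : cst 0 \+ cst 0 = cst 0); last by apply/funext => w; exact: addr0.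
by rewrite -{1}[L _]addr0 => /addrI.
Qed.

Let localS (F : (set (I -> T))^nat) n : (forall n, cylinder (F n)) ->
  local_fun (fun w => \sum_(k < n) \1_(F k) w).
Proof.
move=> cF; elim: n => [|n ih].
  by exists fset0 => w w' _; rewrite !big_ord0.
rewrite (_ : (fun w => _) =
  (fun w => \sum_(k < n) \1_(F k) w) \+ (\1_(F n) : (I -> T) -> R)).
  by apply: localD => //; exact: local_indic.
by apply/funext => w; rewrite big_ord_recr.
Qed.

Let LS (F : (set (I -> T))^nat) n : (forall n, cylinder (F n)) ->
  L (fun w => \sum_(k < n) \1_(F k) w) = \sum_(k < n) L \1_(F k).
Proof.
move=> cF; elim: n => [|n ih].
  rewrite big_ord0 -[RHS]L0; congr L; apply/funext => w; exact: big_ord0.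
rewrite big_ord_recr/= -ih -LD//; [|exact: localS|exact: local_indic].
by congr L; apply/funext => w; rewrite big_ord_recr.
Qed.

Let m (A : set (cylinder_algebra I T)) : \bar R :=
  (if `[< cylinder A >] then L \1_A else 0)%:E.

Let mE A : cylinder A -> m A = (L \1_A)%:E.
Proof. by move=> /asboolP cA; rewrite /m cA. Qed.

Let m_ge0 A : (0 <= m A)%E.
Proof.
rewrite /m; case: asboolP => // cA; rewrite lee_fin -L0.
by apply: Lle => //; [exact: local_cst|exact: local_indic].
Qed.

Let m0 : m set0 = 0%E.
Proof.
rewrite mE; last exact: cylinder0.
congr EFin; rewrite -[RHS]L0; congr L.
by apply/funext => w; rewrite indic0.
Qed.

Let m_additive : measure_function.semi_additive m.
Proof.
apply/additive2P => // A B cA cB AB0.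
rewrite !mE// -?EFinD; last exact: cylinderU.
rewrite -LD; [|exact: local_indic|exact: local_indic].
congr (L _)%:E; apply/funext => w; rewrite /= !indicE in_setU.
have [wA|//] := boolP (w \in A).
  have [wB|] := boolP (w \in B); last by rewrite addr0.
  by have : (A `&` B) w; [split; exact: set_mem|rewrite AB0].
by rewrite add0r.
Qed.

HB.instance Definition _ := isContent.Build _ _ R m m_ge0 m_additive.

Let m_sigma_subadditive : measurable_subset_sigma_subadditive m.
Proof.
move=> A F cF cA AF.
have [n nP] := cylinder_compact cA cF AF.
apply: (@le_trans _ _ (\sum_(0 <= k < n) m (F k))%E).
  rewrite big_mkord (eq_bigr (fun k : 'I_n => (L \1_(F k))%:E)); last first.
    by move=> k _; exact: (mE (cF k)).
  rewrite sumEFin mE// lee_fin -LS//.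
  apply: Lle => [||w Kw].
  - exact: local_indic.
  - exact: localS.
  - rewrite indicE.
    case: (boolP (w \in A)) => [|_]; last by apply: sumr_ge0.
    rewrite inE => Aw; have [k kn Fk] := nP w Kw Aw.
    rewrite (bigD1 (Ordinal kn))//= indicE mem_set//= lerDl.
    by apply: sumr_ge0.
apply: nneseries_lim_ge => k _ _; exact: m_ge0.
Qed.

HB.instance Definition _ :=
  Content_SigmaSubAdditive_isMeasure.Build _ _ _ m m_sigma_subadditive.

Let M : set (product_space I T) -> \bar R := measure_extension m.

Let ME A : cylinder A -> M A = (L \1_A)%:E.
Proof. by move=> cA; rewrite -(mE cA); exact: measurable_mu_extE. Qed.

HB.instance Definition _ := isMeasure.Build _ (product_space I T) _ M
  (measure0 (measure_extension m)) (measure_ge0 (measure_extension m))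
  (@measure_semi_sigma_additive _ _ _ (measure_extension m)).

Let M1 : M setT = 1%E.
Proof.
rewrite ME; last by exists fset0.
congr EFin; rewrite -[RHS]L1; congr L.
by apply/funext => w; rewrite indicT.
Qed.

HB.instance Definition _ := Measure_isProbability.Build _ _ _ M M1.

Lemma cylinder_extension : exists mu : probability (product_space I T) R,
  forall A, cylinder A -> mu A = (L \1_A)%:E.
Proof. by exists M => A; exact: ME. Qed.

End extension.

Definition update (I : eqType) (T : Type) (w : I -> T) (i : I) (t : T) : I -> T :=
  fun j => if j == i then t else w j.

(* [E i f] integrates out the [i]-th coordinate. *)
Section independent_bits.
Variables (R : realType) (I : choiceType) (p : R).
Hypothesis p01 : 0 <= p <= 1.
Implicit Types (f g : (I -> bool) -> R) (s : seq I).

Let q := bernoulli_pmf p.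

Let E i f := fun w => q true * f (update w i true) + q false * f (update w i false).

Let Es s f := foldr E f s.

Let E_dep (D : set I) i f : depends_on D f ->
  depends_on [set j | D j /\ j != i] (E i f).
Proof.
move=> fD w w' ww'; rewrite /E.
by congr (_ * _ + _ * _); apply: fD => j Dj; rewrite /update;
  case: eqVneq => // ji; apply: ww'.
Qed.

Let E_id (D : set I) i f : depends_on D f -> ~ D i -> E i f = f.
Proof.
move=> fD Di; apply/funext => w; rewrite /E.
have fw b : f (update w i b) = f w.
  by apply: fD => j Dj; rewrite /update; case: eqP => // ji; rewrite ji in Dj.
by rewrite !fw -mulrDl /q /bernoulli_pmf subrKC mul1r.
Qed.

Let E_comm i j f : E i (E j f) = E j (E i f).
Proof.
have [->//|ij] := eqVneq i j.
have uC w b c : update (update w i b) j c = update (update w j c) i b.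
  apply/funext => k; rewrite /update.
  by case: eqVneq => [->|//]; rewrite eq_sym (negbTE ij).
by apply/funext => w; rewrite /E !uC; ring.
Qed.

Let Es_dep (D : set I) s f : depends_on D f ->
  depends_on [set j | D j /\ j \notin s] (Es s f).
Proof.
move=> fD; elim: s => [|i s ih] /=.
  by apply: depends_onW fD => j Dj.
apply: (depends_onW _ (E_dep ih)) => j [[Dj js] ji] /=.
by rewrite inE negb_or ji js.
Qed.

Let Es_id s f : depends_on set0 f -> Es s f = f.
Proof. by move=> f0; elim: s => //= i s ->; apply: E_id f0 _. Qed.

Let EsE i s f : Es s (E i f) = E i (Es s f).
Proof. by elim: s => //= j s ->; rewrite E_comm. Qed.

Let Es_comm s s' f : Es s (Es s' f) = Es s' (Es s f).
Proof. by elim: s' => //= i s' <-; rewrite EsE. Qed.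

Let Es_unique s s' f : depends_on [set` s] f -> depends_on [set` s'] f ->
  Es s f = Es s' f.
Proof.
move=> fs fs'.
have e0 (r : seq I) : depends_on [set` r] f -> depends_on set0 (Es r f).
  move=> fr; apply: (depends_onW _ (@Es_dep _ r _ fr)) => j [/= jr].
  by rewrite jr.
by rewrite -[RHS](Es_id s (e0 _ fs')) Es_comm [RHS]Es_id//; exact: e0.
Qed.

Let EsD s f g : Es s (f \+ g) = Es s f \+ Es s g.
Proof.
by elim: s => //= i s ->; apply/funext => w; rewrite /E /=; ring.
Qed.

Let EsZ s c f : Es s (fun w => c * f w) = fun w => c * Es s f w.
Proof. by elim: s => //= i s ->; apply/funext => w; rewrite /E; ring. Qed.

Let Es_le s f g : (forall w, f w <= g w) -> forall w, Es s f w <= Es s g w.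
Proof.
move=> fg; elim: s => //= i s ih w.
by apply: lerD; apply: ler_wpM2l => //; exact: bernoulli_pmf_ge0.
Qed.

Let supp f : {fset I} := xget fset0 [set J : {fset I} | depends_on [set` J] f].

Let L f := Es (supp f) f (fun=> false).

Let LE s f : depends_on [set` s] f -> L f = Es s f (fun=> false).
Proof.
move=> fs; rewrite /L (@Es_unique _ s)// /supp.
apply: (@xgetPex _ _ [set J : {fset I} | depends_on [set` J] f]).
exists [fset i in s]%fset; apply: depends_onW fs => i /=.
by rewrite !inE.
Qed.

Lemma independent_bits : exists mu : probability (product_space I bool) R,
  forall (J : {fset I}) (t : I -> bool),
    mu [set w | forall i, i \in J -> w i = t i] =
    (\prod_(i <- J) bernoulli_pmf p (t i))%:E.
Proof.
have [|||mu muL] := @cylinder_extension R I bool (fun=> [fset true; false]%fset) L.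
- by rewrite (@LE [::]).
- move=> f g [J fJ] [K gK].
  have fJK : depends_on [set` J ++ K] f.
    by apply: depends_onW fJ => i /= iJ; rewrite mem_cat iJ.
  have gJK : depends_on [set` J ++ K] g.
    by apply: depends_onW gK => i /= iK; rewrite mem_cat iK orbT.
  rewrite (LE fJK) (LE gJK) (@LE (J ++ K)) ?EsD//.
  by move=> w w' ww'; rewrite /= (fJK w w')// (gJK w w').
- move=> f g [J fJ] [K gK] fg.
  have fJK : depends_on [set` J ++ K] f.
    by apply: depends_onW fJ => i /= iJ; rewrite mem_cat iJ.
  have gJK : depends_on [set` J ++ K] g.
    by apply: depends_onW gK => i /= iK; rewrite mem_cat iK orbT.
  rewrite (LE fJK) (LE gJK); apply: Es_le => w; apply: fg => i.
  by rewrite !inE; case: (w i).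
exists mu => J t.
pose C (s : seq I) := [set w : I -> bool | forall i, i \in s -> w i = t i].
have Cs s : depends_on [set` s] (C s).
  move=> w w' ww'; apply/propext; rewrite /C /=.
  by split => h i si; [rewrite -ww'|rewrite ww']; rewrite ?h.
have iCs s : depends_on [set` s] (\1_(C s) : (I -> bool) -> R).
  move=> w w' /Cs ww'; rewrite !indicE; congr (_%:R); congr nat_of_bool.
  by apply/idP/idP; rewrite !inE ww'.
have -> : [set w | forall i, i \in J -> w i = t i] = C J by [].
rewrite muL; last by exists J; exact: Cs.
rewrite (LE (iCs _)); congr EFin.
elim: (enum_fset J) (fset_uniq J) => [_|i s ih /= /andP[si us]].
  by rewrite big_nil /= indicE mem_set.
rewrite big_cons -EsE -(ih us).
rewrite (_ : E i _ = fun w => bernoulli_pmf p (t i) * \1_(C s) w) ?EsZ//.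
apply/funext => w; rewrite /E.
have CE b : \1_(C (i :: s)) (update w i b) = (b == t i)%:R * \1_(C s) w :> R.
  rewrite !indicE -natrM mulnb; congr (_%:R); congr nat_of_bool.
  apply/idP/andP; rewrite !inE.
    move=> Cw; split; first by have := Cw i (mem_head _ _); rewrite /update eqxx => ->.
    move=> j js; have := Cw j; rewrite inE js orbT /update.
    by case: eqVneq => [ji|_ ->//]; rewrite ji (negbTE si) in js.
  move=> [/eqP bt Cw] j; rewrite inE /update.
  by case: eqVneq => [->//|_ /= /Cw].
by rewrite !CE /q; case: (t i) => /=; ring.
Qed.

End independent_bits.

(* [E n f w] is the conditional expectation of [f] given that the first [n] steps
   of the path are those of [w]. *)
Section markov_chain.
Variables (R : realType) (V : pointedType) (k : V -> V -> R) (N : V -> {fset V}).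
Hypothesis k_ge0 : forall x y, 0 <= k x y.
Hypothesis k_supp : forall x y, y \notin N x -> k x y = 0.
Hypothesis k_sum : forall x, \sum_(y <- N x) k x y = 1.
Variable x0 : V.
Implicit Types f g : (nat -> V) -> R.

Let E n f := fun w => \sum_(y <- N (w n)) k (w n) y * f (update w n.+1 y).

Let En := fix En n f := if n is m.+1 then En m (E m f) else f.

Let E_dep n f : depends_on `I_n.+2 f -> depends_on `I_n.+1 (E n f).
Proof.
move=> fn w w' ww'; rewrite /E ww'/=; last exact: ltnSn.
apply: eq_bigr => y _; congr (_ * _); apply: fn => j /= jn.
rewrite /update; case: eqVneq => // jn1; apply: ww'.
by rewrite /= ltn_neqAle jn1.
Qed.

Let E_id n f : depends_on `I_n.+1 f -> E n f = f.
Proof.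
move=> fn; apply/funext => w; rewrite /E.
rewrite (eq_bigr (fun y => k (w n) y * f w)); last first.
  move=> y _; congr (_ * _); apply: fn => j /= jn.
  by rewrite /update ltn_eqF.
by rewrite -mulr_suml k_sum mul1r.
Qed.

Let depW n m f : (n <= m)%N -> depends_on `I_n.+1 f -> depends_on `I_m.+1 f.
Proof. by move=> nm; apply: depends_onW => j /= /leq_trans; apply. Qed.

Let En_stable n d f : depends_on `I_n.+1 f -> En (n + d) f = En n f.
Proof.
move=> fn; elim: d => [|d ih]; first by rewrite addn0.
by rewrite addnS /= E_id//; apply: depW fn; exact: leq_addr.
Qed.

Let En_unique n m f : depends_on `I_n.+1 f -> depends_on `I_m.+1 f ->
  En n f = En m f.
Proof.
move=> fn fm; have [nm|/ltnW mn] := leqP n m.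
  by rewrite -(subnKC nm) En_stable.
by rewrite -(subnKC mn) En_stable.
Qed.

Let EnD n f g : En n (f \+ g) = En n f \+ En n g.
Proof.
elim: n f g => //= n ih f g; rewrite -ih; congr En; apply/funext => w.
by rewrite /E /= -big_split; apply: eq_bigr => y _; rewrite mulrDr.
Qed.

Let EnZ n c f : En n (fun w => c * f w) = fun w => c * En n f w.
Proof.
elim: n f => //= n ih f; rewrite -ih; congr En; apply/funext => w.
by rewrite /E mulr_sumr; apply: eq_bigr => y _; rewrite mulrCA.
Qed.

Let K := fix K n : {fset V} := if n is m.+1 then
  (K m `|` \bigcup_(y <- K m) N y)%fset else [fset x0]%fset.

Let En_le n f g : (forall w, (forall i, w i \in K i) -> f w <= g w) ->
  forall w, (forall i, w i \in K i) -> En n f w <= En n g w.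
Proof.
elim: n f g => //= n ih f g fg; apply: ih => w Kw; rewrite /E.
rewrite big_seq [leRHS]big_seq; apply: ler_sum => y yN.
apply: ler_wpM2l => //; apply: fg => i; rewrite /update.
case: eqVneq => // -> /=; rewrite in_fsetU; apply/orP; right.
by apply/bigfcupP; exists (w n); rewrite ?Kw.
Qed.

Let horizon f : nat := xget 0%N [set n | depends_on `I_n.+1 f].

Let L f := En (horizon f) f (fun=> x0).

Let LE n f : depends_on `I_n.+1 f -> L f = En n f (fun=> x0).
Proof.
move=> fn; rewrite /L (@En_unique _ n)// /horizon.
by apply: (@xgetPex _ _ [set n | depends_on `I_n.+1 f]); exists n.
Qed.

Let local_dep f : local_fun f -> exists n, depends_on `I_n.+1 f.
Proof.
move=> [J fJ]; exists (\max_(i <- J) i)%N; apply: depends_onW fJ => i /= iJ.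
by rewrite ltnS; apply: (@leq_bigmax_seq _ _ _ id).
Qed.

Lemma markov_chain : exists mu : probability (product_space nat V) R,
  forall (n : nat) (v : nat -> V),
    mu [set w | forall i, (i <= n)%N -> w i = v i] =
    ((x0 == v 0)%:R * \prod_(i < n) k (v i) (v i.+1))%:E.
Proof.
have K0 i : x0 \in K i.
  by elim: i => [|i ih] /=; rewrite !inE// ih.
have [|||mu muL] := @cylinder_extension R nat V K L.
- by rewrite (@LE 0).
- move=> f g /local_dep[n fn] /local_dep[m gm].
  have fnm := depW (leq_maxl n m) fn.
  have gnm := depW (leq_maxr n m) gm.
  rewrite (LE fnm) (LE gnm) (@LE (maxn n m)) ?EnD//.
  by move=> w w' ww'; rewrite /= (fnm w w')// (gnm w w').
- move=> f g /local_dep[n fn] /local_dep[m gm] fg.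
  have fnm := depW (leq_maxl n m) fn.
  have gnm := depW (leq_maxr n m) gm.
  by rewrite (LE fnm) (LE gnm); apply: En_le => // w Kw; apply: fg.
exists mu => n v.
pose C n := [set w : nat -> V | forall i, (i <= n)%N -> w i = v i].
have Cn m : depends_on `I_m.+1 (C m).
  move=> w w' ww'; apply/propext; rewrite /C /=.
  by split => h i im; [rewrite -ww'|rewrite ww']; rewrite ?h.
have iCn m : depends_on `I_m.+1 (\1_(C m) : (nat -> V) -> R).
  move=> w w' /Cn ww'; rewrite !indicE; congr (_%:R); congr nat_of_bool.
  by apply/idP/idP; rewrite !inE ww'.
have -> : [set w | forall i, (i <= n)%N -> w i = v i] = C n by [].
rewrite muL; last first.
  exists [fset i in iota 0 n.+1]%fset; apply: depends_onW (Cn n) => i /= im.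
  have : i \in iota 0 n.+1 by rewrite mem_iota.
  by rewrite in_fset.
rewrite (LE (iCn _)); congr EFin; elim: n => [|n ih].
  rewrite big_ord0 mulr1 /= indicE; congr (_%:R); congr nat_of_bool.
  apply/idP/eqP; rewrite inE.
    by move=> /(_ 0%N) -> .
  by move=> -> [|].
rewrite big_ord_recr/= mulrA mulrC -ih.
transitivity (En n (fun w => k (v n) (v n.+1) * \1_(C n) w) (fun=> x0)).
  2: by rewrite EnZ.
congr En; apply/funext => w; rewrite /E.
have CE y : \1_(C n.+1) (update w n.+1 y) = (y == v n.+1)%:R * \1_(C n) w :> R.
  rewrite !indicE -natrM mulnb; congr (_%:R); congr nat_of_bool.
  apply/idP/andP; rewrite !inE.
    move=> Cw; split; first by have := Cw n.+1 (leqnn _); rewrite /update eqxx => ->.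
    move=> j jn; have := Cw j; rewrite /update ltn_eqF ?ltnS// => -> //.
    exact: leqW.
  move=> [/eqP yv Cw] j; rewrite /update leq_eqVlt.
  by case: eqVneq => [->//|_ /= /Cw].
under eq_bigr do rewrite CE mulrA.
rewrite -mulr_suml.
have [wC|wC] := boolP (w \in C n); last first.
  by rewrite indicE (negbTE wC) !mulr0.
have -> : w n = v n by move: wC; rewrite inE => /(_ n (leqnn _)).
congr (_ * _).
have [vN|vN] := boolP (v n.+1 \in N (v n)).
  rewrite (big_fsetD1 _ vN)/= eqxx mulr1 big_seq big1 ?addr0// => y.
  by rewrite !inE => /andP[/negbTE -> _]; rewrite mulr0.
rewrite k_supp// big_seq big1// => y yN.
by case: eqVneq => [yv|]; rewrite ?mulr0//; rewrite -yv yN in vN.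
Qed.

End markov_chain.

Record graph (V : choiceType) := Graph {
  edges : set {fset V};
  edges_card2 : forall e, edges e -> (#|` e| = 2)%N
}.

Section graphs.
Variables (V : choiceType) (G : graph V).

Definition adj : rel V := [rel x y | [fset x; y]%fset \in edges G].

Definition neighbors (x : V) : set V := [set y | adj x y].

(* [fset_set] sends an infinite set to [fset0], so [deg] is meaningful only when
   [neighbors x] is finite, which [bounded_degree] requires. *)
Definition deg (x : V) : nat := #|` fset_set (neighbors x)|.

Definition bounded_degree : Prop :=
  exists D : nat, forall x, finite_set (neighbors x) /\ (deg x <= D)%N.

(* [linked r x y]: some finite [r]-path leads from [x] to [y]. *)
Definition linked (r : rel V) (x y : V) : Prop :=
  exists2 s : seq V, path r x s & last x s = y.

Definition connected_graph : Prop := forall x y, linked adj x y.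

Definition configuration := product_space (edges G) bool.

Definition open_adj (w : configuration) : rel V :=
  [rel x y | `[< exists e : edges G, val e = [fset x; y]%fset /\ w e >]].

Definition cluster_of (w : configuration) (x : V) : set V :=
  [set y | linked (open_adj w) x y].

(* The event that [S] intersects an infinite open cluster. *)
Definition to_infinity (S : {fset V}) : set configuration :=
  [set w | exists2 x, x \in S & infinite_set (cluster_of w x)].

End graphs.

Arguments to_infinity {V} G S.

Section percolation.
Variables (R : realType) (V : choiceType) (G : graph V).

Definition is_bernoulli_percolation (p : R)
    (mu : probability (configuration G) R) : Prop :=
  forall (J : {fset edges G}) (t : edges G -> bool),
    mu [set w | forall e, e \in J -> w e = t e] =
    (\prod_(e <- J) bernoulli_pmf p (t e))%:E.

Lemma bernoulli_percolation_exists (p : {i01 R}) :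
  exists mu, is_bernoulli_percolation p%:num mu.
Proof.
by apply: independent_bits; rewrite ge0 le1.
Qed.

(* The law of independent Bernoulli edges; the equation characterizing it,
   [percolationP], determines it on cylinders, hence on the sigma-algebra. *)
Definition percolation (p : {i01 R}) : probability (configuration G) R :=
  projT1 (cid (bernoulli_percolation_exists p)).

Lemma percolationP (p : {i01 R}) : is_bernoulli_percolation p%:num (percolation p).
Proof. exact: projT2 (cid (bernoulli_percolation_exists p)). Qed.

(* The infimum is taken in [\bar R], where the infimum of the empty set is [+oo]
   (the infimum of the empty set of reals would be [0]). *)
Definition critical_parameter (x : V) : \bar R :=
  ereal_inf [set (p%:num)%:E | p in
    [set p : {i01 R} | (0 < percolation p (to_infinity G [fset x]%fset))%E]].

End percolation.

Section random_walk.
Variables (R : realType) (V : pointedType) (G : graph V).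

(* An isolated vertex has no neighbor to move to: the walk stays there. *)
Definition step (x y : V) : R :=
  if deg G x == 0%N then (x == y)%:R else (adj G x y)%:R / (deg G x)%:R.

Definition is_simple_random_walk (x : V)
    (mu : probability (product_space nat V) R) : Prop :=
  forall (n : nat) (v : nat -> V),
    mu [set w | forall i, (i <= n)%N -> w i = v i] =
    ((x == v 0)%:R * \prod_(i < n) step (v i) (v i.+1))%:E.

Lemma simple_random_walk_exists (x : V) : exists mu, is_simple_random_walk x mu.
Proof.
pose N y := if deg G y == 0%N then [fset y]%fset else fset_set (neighbors G y).
have finN y : deg G y != 0%N -> finite_set (neighbors G y).
  move=> dy; apply: contrapT => infN; move: dy.
  by rewrite /deg /fset_set; case: pselect => //; rewrite cardfs0.
have adjN y z : deg G y != 0%N -> (z \in fset_set (neighbors G y)) = adj G y z.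
  by move=> /finN fN; rewrite in_fset_set//; apply/idP/idP; rewrite inE.
apply: (@markov_chain R V step N) => [y z|y z|y]; rewrite /step /N.
- by case: eqP => // _; rewrite divr_ge0.
- case: ifPn => [_|dy]; first by rewrite inE eq_sym => /negbTE ->.
  by rewrite adjN// => /negbTE ->; rewrite mul0r.
- case: ifPn => [_|dy]; first by rewrite big_seq_fset1 eqxx.
  rewrite -mulr_suml big_seq (eq_bigr (fun=> 1)).
    rewrite -big_seq big_const_seq count_predT iter_addr_0.
    by rewrite divff// pnatr_eq0.
  by move=> z; rewrite adjN// => ->.
Qed.

(* The law, on trajectories, of the simple random walk started at [x]. *)
Definition walk (x : V) : probability (product_space nat V) R :=
  projT1 (cid (simple_random_walk_exists x)).

Lemma walkP (x : V) : is_simple_random_walk x (walk x).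
Proof. exact: projT2 (cid (simple_random_walk_exists x)). Qed.

Definition transition (n : nat) (x y : V) : R :=
  fine (walk x [set w | w n = y]).

Definition capacity (S : {fset V}) : R :=
  \sum_(x <- S) (deg G x)%:R *
    fine (walk x [set w | forall k, (1 <= k)%N -> w k \notin S]).

End random_walk.

(* Main.v *)
(** Let [L] be a finite set of vertices containing [S], let [C] be the Green function
    of the walk killed outside [L], and let [x] be the Gaussian free field with
    covariance [C].  Given [x], open each edge [e = {y, z}] independently with
    probability [1 - exp (- 2 (x y + 1)^+ (x z + 1)^+)], the field being [1] outside.
    When [S] is not connected to the outside, the law of [x + 1] off the cluster of the
    outside is invariant under a change of sign; as [cosh >= 1], the weight of this
    event only increases if it is multiplied by [exp (- h . (x + 1))].  The vector
    [h := deg * escape] has total mass [cap S] and satisfies [C h <= 1], so that the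
    event has probability at most [exp (- cap S + (h . C h) / 2) <= exp (- cap S / 2)].

    It remains to dominate this percolation by a Bernoulli one with a parameter [p < 1]
    independent of [L].  With [P] the transition kernel and [D] the degrees,
    [C = sum_m (P ^ (2 m) + P ^ (2 m + 1)) D^-1] writes the field as a sum of independent
    nonnegative combinations of Gaussian variables with finite range.  Those with
    [2 ^ k <= m + 1 < 2 ^ (k + 1)] have variance [O ((2 ^ (1 - d / 2)) ^ k)] and range
    [O (2 ^ k)].  As [d > 4], there are summable thresholds [eps k] which they exceed
    with probability at most [exp (- B 2 ^ k)], with [B] as large as desired.  The
    edges at a vertex where this happens are declared open.  By the Harris inequality the event is negatively correlated with the gain,
    and opening a path through the ball costs only [exp (O (2 ^ k))]: the gain is
    therefore compensated by a sprinkling of the ball with intensity [A ^ (- 2 ^ k)], and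
    these intensities add up to a bounded amount at each edge. *)

From HB Require Import structures.
Require Import Defs.
From mathcomp Require Import all_boot all_order all_algebra finmap.
From mathcomp Require Import all_classical all_reals all_analysis.
From mathcomp Require Import measurable_realfun zify ring lra.

Set Implicit Arguments.
Unset Strict Implicit.
Unset Printing Implicit Defensive.

Import Order.TTheory GRing.Theory Num.Theory.
Import numFieldNormedType.Exports.

Local Open Scope classical_set_scope.
Local Open Scope ring_scope.

(** * Iterated Lebesgue integrals *)

(** The condition [d > 4] is where the scales balance. Scale [k] has variance of order [r ^ k] with
    [r = 2 ^ (1 - d / 2)], so a threshold exceeded with probability only [exp (- B 2 ^ k)] has a
    square of order [(2 r) ^ k], and such thresholds are summable exactly when [2 r < 1]. The bad
    events must be that rare because only the degree is controlled: balls of radius [2 ^ k] may grow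
    exponentially.

    Even and odd times are paired because [(P ^ (2 m) + P ^ (2 m + 1)) D^-1] is a sum of outer
    products of nonnegative vectors, one per edge. Nonnegativity makes the bad events increasing, as
    the Harris inequality requires.

    Only finitely many scales are split off. The residual field must keep a density, so a fraction
    of [C] is retained in it, and it must be small at every vertex; the number of scales needed for
    this depends on [L], but the parameter does not. Gaussian laws enter only through unnormalized
    densities with a given precision matrix, so that no normalizing constant is ever computed for
    the field. *)

Section affine_change.
Variable R : realType.
Local Notation leb := (@lebesgue_measure R).
Local Open Scope ereal_scope.

Lemma lebesgue_measureD (v : R) (A : set R) : measurable A ->
  pushforward leb ((fun t => t + v)%R : measurableTypeR R -> measurableTypeR R) A = leb A.
Proof.
move=> mA.
pose sh : measurableTypeR R -> measurableTypeR R := (fun t => t + v)%R.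
have mD : measurable_fun setT sh by exact: measurable_funD.
pose mD_mixin := isMeasurableFun.Build _ _ _ _ _ mD.
pose phi : {mfun measurableTypeR R >-> measurableTypeR R} := HB.pack sh mD_mixin.
apply/esym/(@lebesgue_measure_unique _ (pushforward leb phi)) => //= _ [[a b]] _ <-.
rewrite /pushforward.
have -> : (fun t : R => t + v)%R @^-1` `]a, b]%classic = `](a - v)%R, (b - v)%R]%classic.
  by apply/seteqP; split => x /=; rewrite !in_itv/= ltrBlDr lerBrDr.
rewrite !lebesgue_measure_itv/= !lte_fin ltrD2r; case: ifP => // _.
by rewrite -!EFinB; congr EFin; ring.
Qed.

Lemma integral_shift (v : R) (f : R -> \bar R) : measurable_fun setT f ->
  (forall t, 0 <= f t) -> \int[leb]_t f (t + v)%R = \int[leb]_t f t.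
Proof.
move=> mf f0.
transitivity (\int[pushforward leb
  ((fun t => t + v)%R : measurableTypeR R -> measurableTypeR R)]_t f t).
  rewrite ge0_integral_pushforward//= ?preimage_setT//.
  exact: measurable_funD.
apply: eq_measure_integral => [|mD A mA _]; first exact: measurable_funD.
exact: (lebesgue_measureD v mA).
Qed.

Lemma integral_opp (f : R -> \bar R) : measurable_fun setT f ->
  (forall t, 0 <= f t) -> \int[leb]_t f (- t)%R = \int[leb]_t f t.
Proof.
move=> mf f0.
transitivity (\int[pushforward leb
  (-%R : measurableTypeR R -> measurableTypeR R)]_t f t).
  by rewrite ge0_integral_pushforward//= ?preimage_setT.
by apply: eq_measure_integral => A mA _; exact: (lebesgue_measureN mA).
Qed.

(** Completing the square: the integrand is a multiple of the normal density with mean [b / a] and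
    variance [a^-1]. *)
Lemma integral_gaussian (a b : R) : (0 < a)%R ->
  \int[leb]_t (expR (- (a * t ^+ 2 / 2) + b * t))%:E =
  (Num.sqrt (2 * pi / a) * expR (b ^+ 2 / (2 * a)))%:E.
Proof.
move=> a0.
pose s := Num.sqrt a^-1.
have s0 : s != 0%R by rewrite gt_eqF// sqrtr_gt0 invr_gt0.
have s2 : (s ^+ 2 = a^-1)%R by rewrite sqr_sqrtr// invr_ge0 ltW.
have := integral_normal_pdf (b / a) s.
have pE t : (expR (- (a * t ^+ 2 / 2) + b * t))%:E =
  (Num.sqrt (2 * pi / a) * expR (b ^+ 2 / (2 * a)))%:E *
  (normal_pdf (b / a) s t)%:E.
  rewrite -EFinM; congr EFin; rewrite normal_pdfE// /normal_peak /normal_fun s2.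
  have -> : (a^-1 * pi *+ 2 = 2 * pi / a)%R by rewrite -mulr_natl; ring.
  rewrite mulrACA divff ?mul1r -?expRD; last first.
    by rewrite gt_eqF// sqrtr_gt0 divr_gt0// mulr_gt0// pi_gt0.
  by congr expR; rewrite -[(a^-1 *+ 2)%R]mulr_natl; field; rewrite gt_eqF.
move=> I1; under eq_integral do rewrite pE.
rewrite ge0_integralZl_EFin//= ?I1 ?mule1//.
- by move=> t _; rewrite lee_fin normal_pdf_ge0.
- by apply/measurable_EFinP; exact: measurable_normal_pdf.
Qed.

End affine_change.

Section coordinates.
Variables (R : realType) (I : eqType).
Local Notation leb := (@lebesgue_measure R).
Implicit Types (w : I -> R) (l : seq I).

(** Measurability is tested on families of points with measurable coordinates. No sigma-algebra on
    [I -> R] is needed, and the notion is stable under updating a coordinate and under Tonelli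
    integration. *)
Definition coord_measurable d' (U : measurableType d') (f : (I -> R) -> U) :=
  forall d (T : measurableType d) (g : T -> I -> R),
    (forall i, measurable_fun setT (g ^~ i)) -> measurable_fun setT (f \o g).

Lemma coord_measurable_proj i : coord_measurable (fun w => w i).
Proof. by move=> d T g mg; exact: mg. Qed.

Lemma coord_measurable_cst d' (U : measurableType d') (c : U) :
  coord_measurable (fun=> c).
Proof. by move=> d T g mg; exact: measurable_cst. Qed.

Lemma coord_measurable_comp d1 d2 (U1 : measurableType d1) (U2 : measurableType d2)
    (h : U1 -> U2) (f : (I -> R) -> U1) :
  measurable_fun setT h -> coord_measurable f -> coord_measurable (h \o f).
Proof. by move=> mh mf d T g mg; exact: (measurableT_comp mh (mf _ _ _ mg)). Qed.

Lemma coord_measurable_subst d' (U : measurableType d') (f : (I -> R) -> U)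
    (h : (I -> R) -> I -> R) :
  (forall i, coord_measurable (fun w => h w i)) -> coord_measurable f ->
  coord_measurable (f \o h).
Proof.
move=> mh mf d T g mg; apply: (mf _ _ (h \o g)) => i.
exact: (mh i _ _ _ mg).
Qed.

Lemma coord_measurableD (f g : (I -> R) -> R) :
  coord_measurable f -> coord_measurable g -> coord_measurable (fun w => f w + g w).
Proof.
by move=> mf mg d T h mh; apply: measurable_funD; [exact: mf|exact: mg].
Qed.

Lemma coord_measurableM (f g : (I -> R) -> R) :
  coord_measurable f -> coord_measurable g -> coord_measurable (fun w => f w * g w).
Proof.
by move=> mf mg d T h mh; apply: measurable_funM; [exact: mf|exact: mg].
Qed.

Lemma coord_measurableN (f : (I -> R) -> R) :
  coord_measurable f -> coord_measurable (fun w => - f w).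
Proof. by move=> mf d T h mh; apply: measurable_funN; exact: mf. Qed.

Lemma coord_measurable_sum (J : Type) (r : seq J) (f : J -> (I -> R) -> R) :
  (forall j, coord_measurable (f j)) ->
  coord_measurable (fun w => \sum_(j <- r) f j w).
Proof.
move=> mf; elim: r => [|j r ih].
  rewrite (_ : (fun w => _) = fun=> 0); first exact: coord_measurable_cst.
  by apply/funext => w; rewrite big_nil.
rewrite (_ : (fun w => _) = fun w => f j w + \sum_(j <- r) f j w).
  exact: coord_measurableD.
by apply/funext => w; rewrite big_cons.
Qed.

Lemma coord_measurable_prod (J : Type) (r : seq J) (f : J -> (I -> R) -> R) :
  (forall j, coord_measurable (f j)) ->
  coord_measurable (fun w => \prod_(j <- r) f j w).
Proof.
move=> mf; elim: r => [|j r ih].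
  rewrite (_ : (fun w => _) = fun=> 1); first exact: coord_measurable_cst.
  by apply/funext => w; rewrite big_nil.
rewrite (_ : (fun w => _) = fun w => f j w * \prod_(j <- r) f j w).
  exact: coord_measurableM.
by apply/funext => w; rewrite big_cons.
Qed.

Lemma coord_measurable_lt (f g : (I -> R) -> R) :
  coord_measurable f -> coord_measurable g -> coord_measurable (fun w => f w < g w).
Proof.
by move=> mf mg d T h mh; apply: measurable_fun_ltr; [exact: mf|exact: mg].
Qed.

Lemma coord_measurable_if d' (U : measurableType d') (b : (I -> R) -> bool)
    (f g : (I -> R) -> U) :
  coord_measurable b -> coord_measurable f -> coord_measurable g ->
  coord_measurable (fun w => if b w then f w else g w).
Proof.
by move=> mb mf mg d T h mh; apply: measurable_fun_ifT;
  [exact: mb|exact: mf|exact: mg].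
Qed.

Lemma coord_measurable_EFin (f : (I -> R) -> R) :
  coord_measurable f -> coord_measurable (fun w => (f w)%:E).
Proof. by move=> mf d T g mg; apply/measurable_EFinP; exact: mf. Qed.

Lemma measurable_update w i (f : (I -> R) -> \bar R) :
  coord_measurable f -> measurable_fun setT (fun t => f (update w i t)).
Proof.
move=> mf; apply: (mf _ _ (fun t : measurableTypeR R => update w i t)) => j.
by rewrite /update; case: eqVneq.
Qed.

Local Open Scope ereal_scope.

(** Coordinates outside [l] remain those of the argument. With [k = 1] this is Lebesgue integration,
    with [k] the Gaussian density an expectation over independent normal variables. *)
Definition iint (k : R -> R) l (f : (I -> R) -> \bar R) : (I -> R) -> \bar R :=
  foldr (fun i h w => \int[leb]_t ((k t)%:E * h (update w i t))) f l.

Section kernel.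
Variable k : R -> R.
Hypothesis k0 : forall t, (0 <= k t)%R.
Hypothesis mk : measurable_fun setT k.

Lemma iint_ge0 l f : (forall w, 0 <= f w) -> forall w, 0 <= iint k l f w.
Proof.
move=> f0; elim: l => //= i l ih w.
by apply: integral_ge0 => t _; rewrite mule_ge0// lee_fin.
Qed.

Lemma measurable_kernel w i (f : (I -> R) -> \bar R) :
  coord_measurable f -> measurable_fun setT (fun t => (k t)%:E * f (update w i t)).
Proof.
move=> mf; apply: emeasurable_funM; last exact: measurable_update.
exact/measurable_EFinP.
Qed.

Lemma coord_measurable_integral i (f : (I -> R) -> \bar R) :
  (forall w, 0 <= f w) -> coord_measurable f ->
  coord_measurable (fun w => \int[leb]_t ((k t)%:E * f (update w i t))).
Proof.
move=> f0 mf d T g mg.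
pose F (z : T * measurableTypeR R) := (k z.2)%:E * f (update (g z.1) i z.2).
have mF : measurable_fun setT F.
  apply: emeasurable_funM.
    by apply/measurable_EFinP; exact: (measurableT_comp mk).
  apply: (mf _ _ (fun z : T * measurableTypeR R => update (g z.1) i z.2)) => j.
  rewrite /update; case: eqVneq => _; first exact: measurable_snd.
  exact: (measurableT_comp (mg j) measurable_fst).
apply: (@measurable_fun_fubini_tonelli_F _ _ _ _ R leb F mF).
by move=> z; rewrite mule_ge0// lee_fin.
Qed.

Lemma coord_measurable_iint l f : (forall w, 0 <= f w) -> coord_measurable f ->
  coord_measurable (iint k l f).
Proof.
move=> f0 mf; elim: l => //= i l ih.
by apply: coord_measurable_integral ih; exact: iint_ge0.
Qed.

Lemma le_iint l f g : (forall w, 0 <= f w) -> coord_measurable f ->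
  coord_measurable g -> (forall w, f w <= g w) ->
  forall w, iint k l f w <= iint k l g w.
Proof.
move=> f0 mf mg fg; have g0 w : 0 <= g w by exact: le_trans (fg w).
elim: l => //= i l ih w; apply: ge0_le_integral => //=.
- by move=> t _; rewrite mule_ge0// ?lee_fin// iint_ge0.
- by apply: measurable_kernel; exact: coord_measurable_iint.
- by apply: measurable_kernel; exact: coord_measurable_iint.
- by move=> t _; apply: lee_wpmul2l; rewrite ?lee_fin.
Qed.

Lemma iintD l f g : (forall w, 0 <= f w) -> coord_measurable f ->
  (forall w, 0 <= g w) -> coord_measurable g ->
  forall w, iint k l (fun w => f w + g w) w = iint k l f w + iint k l g w.
Proof.
move=> f0 mf g0 mg; elim: l => //= i l ih w.
rewrite -ge0_integralD//=.
- by apply: eq_integral => t _; rewrite ih ge0_muleDr ?iint_ge0.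
- by move=> t _; rewrite mule_ge0// ?lee_fin// iint_ge0.
- by apply: measurable_kernel; exact: coord_measurable_iint.
- by move=> t _; rewrite mule_ge0// ?lee_fin// iint_ge0.
- by apply: measurable_kernel; exact: coord_measurable_iint.
Qed.

Lemma iint0 l w : iint k l (fun=> 0) w = 0.
Proof.
elim: l w => //= i l ih w; apply: integral0_eq => t _.
by rewrite ih mule0.
Qed.

Lemma iintZ l f (c : R) : (0 <= c)%R -> (forall w, 0 <= f w) ->
  coord_measurable f ->
  forall w, iint k l (fun w => c%:E * f w) w = c%:E * iint k l f w.
Proof.
move=> c0 f0 mf; elim: l => //= i l ih w.
rewrite -ge0_integralZl_EFin//=.
- by apply: eq_integral => t _; rewrite ih muleCA.
- by move=> t _; rewrite mule_ge0// ?lee_fin// iint_ge0.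
- by apply: measurable_kernel; exact: coord_measurable_iint.
Qed.

Lemma eq_iint l f g : (forall w, f w = g w) -> iint k l f = iint k l g.
Proof. by move=> /funext ->. Qed.

Lemma coord_measurable_esum (J : Type) (r : seq J) (f : J -> (I -> R) -> \bar R) :
  (forall j, coord_measurable (f j)) ->
  coord_measurable (fun w => \sum_(j <- r) f j w).
Proof.
move=> mf d T g mg.
rewrite (_ : _ \o g = fun t => \sum_(j <- r) f j (g t)); last exact/funext.
by apply: emeasurable_sum => j; exact: mf.
Qed.

Lemma iint_sum (J : Type) (r : seq J) l (f : J -> (I -> R) -> \bar R) :
  (forall j w, 0 <= f j w) -> (forall j, coord_measurable (f j)) ->
  forall w, iint k l (fun w => \sum_(j <- r) f j w) w =
    \sum_(j <- r) iint k l (f j) w.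
Proof.
move=> f0 mf w; elim: r => [|j r ih].
  by under eq_iint do rewrite big_nil; rewrite iint0 big_nil.
under eq_iint do rewrite big_cons.
rewrite iintD ?ih ?big_cons//.
- by move=> w'; apply: sume_ge0.
- exact: coord_measurable_esum.
Qed.

End kernel.

(* Lebesgue measure is invariant under the maps [t |-> s t + v] with [s = 1] or
   [s = -1]. *)
Lemma iint_affine l (f : (I -> R) -> \bar R) (s : I -> bool) (v : I -> R) :
  (forall w, 0 <= f w) -> coord_measurable f ->
  forall w, iint (fun=> 1%R) l (fun w => f (fun i => (-1) ^+ s i * w i + v i)%R) w =
    iint (fun=> 1%R) l f (fun i => (-1) ^+ s i * w i + v i)%R.
Proof.
move=> f0 mf; elim: l => //= i l ih w.
pose w' := fun j => ((-1) ^+ s j * w j + v j)%R.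
rewrite -/w'.
have m1 : measurable_fun setT ((fun=> 1%R) : R -> R) by exact: measurable_cst.
pose h t := iint (fun=> 1%R) l f (update w' i t).
have mh : measurable_fun setT h.
  by apply: measurable_update; exact: coord_measurable_iint.
have h0 t : 0 <= h t by apply: iint_ge0.
transitivity (\int[leb]_t h ((-1) ^+ s i * t + v i)%R).
  apply: eq_integral => t _; rewrite mul1e ih /h; congr (iint _ _ _ _).
  by apply/funext => j; rewrite /update; case: eqVneq => [->|].
under [RHS]eq_integral do rewrite mul1e.
rewrite -[RHS](integral_shift (v i) mh h0).
case: (s i); rewrite ?expr1 ?expr0.
  rewrite -[RHS]integral_opp//; last first.
    by apply: (measurableT_comp mh); exact: measurable_funD.
  by apply: eq_integral => t _; rewrite mulN1r.
by apply: eq_integral => t _; rewrite mul1r.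
Qed.

End coordinates.

Section coord_more.
Variables (R : realType) (I : eqType).

Lemma coord_measurable_expR (f : (I -> R) -> R) :
  coord_measurable f -> coord_measurable (fun w => expR (f w)).
Proof. exact: (coord_measurable_comp (@measurable_expR R)). Qed.

Lemma coord_measurable_max (f g : (I -> R) -> R) :
  coord_measurable f -> coord_measurable g ->
  coord_measurable (fun w => Num.max (f w) (g w)).
Proof.
by move=> mf mg d T h mh; apply: measurable_maxr; [exact: mf|exact: mg].
Qed.

Lemma coord_measurable_bool (b : (I -> R) -> bool) :
  coord_measurable b -> coord_measurable (fun w => (b w)%:R : R).
Proof.
move=> mb; rewrite (_ : (fun w => _) = fun w => if b w then 1 else 0 : R).
  by apply: coord_measurable_if => //; exact: coord_measurable_cst.
by apply/funext => w; case: (b w).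
Qed.

Lemma coord_measurable_or (J : Type) (r : seq J) (b : J -> (I -> R) -> bool) :
  (forall j, coord_measurable (b j)) ->
  coord_measurable (fun w => has (b^~ w) r).
Proof.
move=> mb; elim: r => [|j r ih]; first exact: coord_measurable_cst.
rewrite (_ : (fun w => _) = fun w => if b j w then true else has (b^~ w) r).
  by apply: coord_measurable_if => //; exact: coord_measurable_cst.
by apply/funext => w /=; case: (b j w).
Qed.

Local Open Scope ereal_scope.

(** Tonelli, one coordinate at a time. The measurability hypothesis tests [f] in the parameter and
    the coordinates together, since [s] is still free while the coordinates of [l] are integrated;
    [mI] carries it through the inner integrals. *)
Lemma iint_swap (k k' : R -> R) (l : seq I) (f : R -> (I -> R) -> \bar R) :
  (forall t, (0 <= k t)%R) -> measurable_fun setT k ->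
  (forall t, (0 <= k' t)%R) -> measurable_fun setT k' ->
  (forall t w, 0 <= f t w) ->
  (forall d (T : measurableType d) (h : T -> R) (g : T -> I -> R),
    measurable_fun setT h -> (forall i, measurable_fun setT (g ^~ i)) ->
    measurable_fun setT (fun t => f (h t) (g t))) ->
  forall w, \int[@lebesgue_measure R]_s ((k' s)%:E * iint k l (f s) w) =
    iint k l (fun w => \int[@lebesgue_measure R]_s ((k' s)%:E * f s w)) w.
Proof.
move=> k0 mk k'0 mk' f0 mf; elim: l => //= i l ih w.
have mI : forall l d (T : measurableType d) (h : T -> R) (g : T -> I -> R),
    measurable_fun setT h -> (forall i, measurable_fun setT (g ^~ i)) ->
    measurable_fun setT (fun t => iint k l (f (h t)) (g t)).
  elim => [|j l' ih'] d T h g mh mg /=; first exact: mf.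
  pose F (z : T * measurableTypeR R) :=
    (k z.2)%:E * iint k l' (f (h z.1)) (update (g z.1) j z.2).
  have mF : measurable_fun setT F.
    apply: emeasurable_funM.
      by apply/measurable_EFinP; exact: (measurableT_comp mk measurable_snd).
    apply: (ih' _ _ (h \o fst)) => [|j']; first exact: (measurableT_comp mh).
    rewrite /update; case: eqVneq => _; first exact: measurable_snd.
    exact: (measurableT_comp (mg j') measurable_fst).
  apply: (@measurable_fun_fubini_tonelli_F _ _ _ _ R (@lebesgue_measure R) F mF).
  by move=> z; rewrite mule_ge0// ?lee_fin// iint_ge0.
pose F (z : measurableTypeR R * measurableTypeR R) :=
  (k' z.1)%:E * ((k z.2)%:E * iint k l (f z.1) (update w i z.2)).
have mF : measurable_fun setT F.
  apply: emeasurable_funM.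
    by apply/measurable_EFinP; exact: (measurableT_comp mk' measurable_fst).
  apply: emeasurable_funM.
    by apply/measurable_EFinP; exact: (measurableT_comp mk measurable_snd).
  apply: (mI _ _ _ fst) => [|j]; first exact: measurable_fst.
  rewrite /update; case: eqVneq => _; first exact: measurable_snd.
  exact: measurable_cst.
have F0 z : 0 <= F z by rewrite !mule_ge0// ?lee_fin// iint_ge0.
transitivity (\int[@lebesgue_measure R]_s \int[@lebesgue_measure R]_t F (s, t)).
  apply: eq_integral => s _; rewrite /F /= ge0_integralZl_EFin//=.
    by move=> t _; rewrite mule_ge0// ?lee_fin// iint_ge0.
  apply: emeasurable_funM; first exact/measurable_EFinP.
  apply: (mI _ _ _ (fun=> s)) => [|j]; first exact: measurable_cst.
  by rewrite /update; case: eqVneq => _ //; exact: measurable_cst.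
rewrite (@fubini_tonelli _ _ _ _ R (@lebesgue_measure R) (@lebesgue_measure R) F mF F0).
apply: eq_integral => t _; rewrite -ih -ge0_integralZl_EFin//=.
- by apply: eq_integral => s _; rewrite muleCA.
- by move=> s _; rewrite mule_ge0// ?lee_fin// iint_ge0.
- apply: emeasurable_funM; first exact/measurable_EFinP.
  by apply: (mI _ _ _ id) => [|j]; [exact: measurable_id|exact: measurable_cst].
Qed.

Lemma iint_notin (k : R -> R) (l : seq I) (f : (I -> R) -> \bar R) i t w :
  i \notin l ->
  iint k l f (update w i t) = iint k l (fun w => f (update w i t)) w.
Proof.
elim: l w => //= j l ih w; rewrite inE negb_or => /andP[ij il].
apply: eq_integral => s _; congr (_ * _); rewrite -ih//; congr (iint _ _ _ _).
apply/funext => x; rewrite /update.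
by case: eqVneq => [->|//]; rewrite eq_sym (negbTE ij).
Qed.

Lemma eq_iint_dep (k : R -> R) (l : seq I) (f : (I -> R) -> \bar R) w w' :
  (forall w w', (forall i, i \in l -> w i = w' i) -> f w = f w') ->
  iint k l f w = iint k l f w'.
Proof.
move=> fl; have : forall i, i \notin l -> w i = w' i -> w i = w' i by [].
(* The induction runs over the integrated list [l'] while the dependence set [l] is fixed; agreement
   is then required only on [l] outside [l']. *)
suff H : forall l' w w', (forall w w', (forall i, i \in l -> w i = w' i) -> f w = f w') ->
  (forall i, i \in l -> i \notin l' -> w i = w' i) -> iint k l' f w = iint k l' f w'.
  by move=> _; apply: H => // i il; rewrite il.
move=> {w w'}; elim => [|j l' ih] w w' fd ww' /=.
  by apply: fd => i il; exact: ww'.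
apply: eq_integral => s _; congr (_ * _); apply: ih => // i il il'.
rewrite /update; case: eqVneq => // ij; apply: ww' => //.
by rewrite inE negb_or ij.
Qed.

Lemma iint_prod (k : R -> R) (l : seq I) (h : I -> R -> R) :
  (forall t, (0 <= k t)%R) -> measurable_fun setT k ->
  (forall i t, (0 <= h i t)%R) -> (forall i, measurable_fun setT (h i)) ->
  uniq l -> forall w,
  iint k l (fun w => (\prod_(i <- l) h i (w i))%:E) w =
  \prod_(i <- l) \int[@lebesgue_measure R]_t ((k t)%:E * (h i t)%:E).
Proof.
move=> k0 mk h0 mh; elim: l => [_ w|i l ih /andP[il ul] w].
  by rewrite /= !big_nil.
rewrite big_cons /= -(ih ul w) muleC -ge0_integralZl//=.
- apply: eq_integral => t _.
  rewrite iint_notin// -[X in _ = X]muleC -muleA; congr (_ * _).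
  rewrite -iintZ//.
  + congr (iint _ _ _ _); apply/funext => w'.
    rewrite big_cons {1}/update eqxx -EFinM; congr EFin; congr *%R.
    rewrite big_seq [RHS]big_seq; apply: eq_bigr => j jl; rewrite /update.
    by case: eqVneq => // ji; rewrite ji (negbTE il) in jl.
  + by move=> w'; rewrite lee_fin prodr_ge0.
  + apply: coord_measurable_EFin; apply: coord_measurable_prod => j.
    exact: (coord_measurable_comp (mh j) (@coord_measurable_proj R I j)).
- apply: emeasurable_funM; apply/measurable_EFinP; [exact: mk|exact: mh].
- by move=> t _; rewrite mule_ge0// lee_fin.
- by apply: iint_ge0 => // w'; rewrite lee_fin prodr_ge0.
Qed.

End coord_more.

(** * Gaussian densities on a finite index set *)

Section linear.
Variables (R : realType) (I : finType).
Implicit Types (x y z : I -> R) (Q C : I -> I -> R).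

Definition dot x y : R := \sum_i x i * y i.
Definition mv Q y : I -> R := fun i => \sum_j Q i j * y j.
Definition symmetric_kernel Q := forall i j, Q i j = Q j i.

Lemma dotC x y : dot x y = dot y x.
Proof. by apply: eq_bigr => i _; rewrite mulrC. Qed.

Lemma dotDl x y z : dot (fun i => x i + y i) z = dot x z + dot y z.
Proof. by rewrite /dot -big_split; apply: eq_bigr => i _; rewrite mulrDl. Qed.

Lemma dotDr x y z : dot z (fun i => x i + y i) = dot z x + dot z y.
Proof. by rewrite dotC dotDl dotC [dot y z]dotC. Qed.

Lemma dotZl (a : R) x y : dot (fun i => a * x i) y = a * dot x y.
Proof. by rewrite /dot mulr_sumr; apply: eq_bigr => i _; rewrite mulrA. Qed.

Lemma dotZr (a : R) x y : dot x (fun i => a * y i) = a * dot x y.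
Proof. by rewrite dotC dotZl dotC. Qed.

Lemma mvD Q x y : mv Q (fun i => x i + y i) = fun i => mv Q x i + mv Q y i.
Proof. by apply/funext => i; rewrite /mv -big_split; apply: eq_bigr => j _; rewrite mulrDr. Qed.

Lemma mvZ Q (a : R) x : mv Q (fun i => a * x i) = fun i => a * mv Q x i.
Proof. by apply/funext => i; rewrite /mv mulr_sumr; apply: eq_bigr => j _; rewrite mulrCA. Qed.

Lemma dot_mvC Q x y : symmetric_kernel Q -> dot x (mv Q y) = dot (mv Q x) y.
Proof.
move=> sQ; rewrite /dot /mv.
under eq_bigr do rewrite mulr_sumr.
rewrite exchange_big; apply: eq_bigr => j _; rewrite mulr_suml.
by apply: eq_bigr => i _; rewrite sQ; ring.
Qed.

Lemma dot_mv_sub Q x y (t : R) : symmetric_kernel Q ->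
  dot (fun i => x i + t * y i) (mv Q (fun i => x i + t * y i)) =
  dot x (mv Q x) + 2 * t * dot x (mv Q y) + t ^+ 2 * dot y (mv Q y).
Proof.
move=> sQ; rewrite mvD mvZ dotDr !dotDl dotZr !dotZl dotZr.
rewrite [dot y (mv Q x)]dot_mvC// [dot (mv Q y) x]dotC; ring.
Qed.

Definition unit_vector (i : I) : I -> R := fun j => (j == i)%:R.

Lemma dot_unit x i : dot x (unit_vector i) = x i.
Proof.
rewrite /dot (bigD1 i)//= /unit_vector eqxx mulr1 big1 ?addr0// => j /negbTE ->.
by rewrite mulr0.
Qed.

Lemma mv_unit Q i : mv Q (unit_vector i) = Q^~ i.
Proof.
apply/funext => k; rewrite /mv (bigD1 i)//= /unit_vector eqxx mulr1 big1 ?addr0//.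
by move=> j /negbTE ->; rewrite mulr0.
Qed.

Definition psd C := forall x, 0 <= dot x (mv C x).

(** A square matrix with trivial kernel is a unit; [enum_val] and [enum_rank] carry the kernel on
    [I] to a matrix and its inverse back. *)
Lemma mv_inverse Q : (forall x, mv Q x = (fun=> 0) -> x = (fun=> 0)) ->
  exists C, (forall x, mv Q (mv C x) = x) /\ (forall x, mv C (mv Q x) = x).
Proof.
move=> Q0.
pose M : 'M[R]_#|I| := \matrix_(i, j) Q (enum_val i) (enum_val j).
pose col x : 'cV[R]_#|I| := \col_i x (enum_val i).
have colE (A : 'M[R]_#|I|) x : A *m col x =
    col (mv (fun i j => A (enum_rank i) (enum_rank j)) x).
  apply/matrixP => i j; rewrite !mxE /mv (reindex (@enum_val I predT))/=; last first.
    by exists enum_rank => k _; rewrite ?enum_valK ?enum_rankK.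
  by apply: eq_bigr => k _; rewrite !mxE !enum_valK.
have col_inj x y : col x = col y -> x = y.
  move=> /matrixP xy; apply/funext => i.
  by have := xy (enum_rank i) 0; rewrite !mxE enum_rankK.
have ME : (fun i j => M (enum_rank i) (enum_rank j)) = Q.
  by apply/funext => i; apply/funext => j; rewrite mxE !enum_rankK.
have colK (z : 'cV[R]_#|I|) : z = col (fun i => z (enum_rank i) 0).
  by apply/matrixP => i j; rewrite mxE enum_valK ord1.
have uM : M \in unitmx.
  rewrite -unitmx_tr -row_free_unit; apply/row_freeP.
  have kM : kermx M^T = 0.
    apply/row_matrixP => i; rewrite row0.
    have : (row i (kermx M^T)) *m M^T = 0 by rewrite -row_mul mulmx_ker row0.
    move/(congr1 trmx); rewrite trmx_mul trmxK trmx0.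
    set z := (row _ _)^T => Mz.
    have := colE M (fun i => z (enum_rank i) 0); rewrite -colK Mz ME => Qz.
    have z0 : (fun i => z (enum_rank i) 0) = (fun=> 0).
      apply: Q0; apply: col_inj; rewrite -Qz.
      by apply/matrixP => a b; rewrite !mxE.
    rewrite -[LHS]trmxK -/z [z]colK z0.
    by apply/matrixP => a b; rewrite !mxE.
  by apply/row_freeP; rewrite -kermx_eq0 kM.
exists (fun i j => (invmx M) (enum_rank i) (enum_rank j)); split => x; apply: col_inj.
  by rewrite -{1}ME -!colE mulmxA mulmxV// mul1mx.
by rewrite -[in LHS]ME -!colE mulmxA mulVmx// mul1mx.
Qed.

End linear.

Section gaussian.
Variables (R : realType) (I : finType).
Implicit Types (w x y v : I -> R) (Q C : I -> I -> R).
Local Notation leb := (@lebesgue_measure R).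

(** The centred Gaussian density with precision matrix [Q], left unnormalized. *)
Definition rho Q w : R := expR (- (dot w (mv Q w) / 2)).

Definition lebint (f : (I -> R) -> \bar R) : \bar R :=
  iint (fun=> 1) (enum I) f (fun=> 0).

Definition gauss_density (t : R) : R := expR (- (t ^+ 2 / 2)) / Num.sqrt (2 * pi).

Lemma gauss_density_ge0 t : 0 <= gauss_density t.
Proof. by rewrite divr_ge0 ?expR_ge0 ?sqrtr_ge0. Qed.

Lemma measurable_gauss_density : measurable_fun setT gauss_density.
Proof.
apply: measurable_funM => //.
apply: measurableT_comp => //; apply: measurable_funN.
by apply: measurable_funM => //; exact: measurable_funX.
Qed.

Lemma integral_gauss_density (a b : R) : 0 <= a ->
  (\int[leb]_t ((gauss_density t)%:E * (expR (- (a * t ^+ 2 / 2) + b * t))%:E) =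
  ((Num.sqrt (1 + a))^-1 * expR (b ^+ 2 / (2 * (1 + a))))%:E)%E.
Proof.
move=> a0; have a1 : 0 < 1 + a by rewrite ltr_pwDl.
have p0 : (0 : R) < 2 * pi by rewrite mulr_gt0// pi_gt0.
have := @integral_gaussian R (1 + a) b a1 => I1.
transitivity (\int[leb]_t (((Num.sqrt (2 * pi))^-1)%:E *
    (expR (- ((1 + a) * t ^+ 2 / 2) + b * t))%:E))%E.
  apply: eq_integral => t _; rewrite -!EFinM; congr EFin.
  rewrite /gauss_density mulrAC mulrC -expRD; congr (_ * expR _); ring.
rewrite ge0_integralZl_EFin//=; last first.
  apply/measurable_EFinP; apply: measurableT_comp => //; apply: measurable_funD.
    apply: measurable_funN; apply: measurable_funM => //.
    by apply: measurable_funM => //; exact: measurable_funX.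
  exact: measurable_funM.
rewrite I1 -EFinM; congr EFin; rewrite mulrA; congr (_ * _).
rewrite (@sqrtrM _ (2 * pi)) ?ltW// sqrtrV ?ltW// mulrA mulVf ?mul1r//.
by rewrite gt_eqF// sqrtr_gt0.
Qed.

Lemma integral_gauss_density1 : (\int[leb]_t (gauss_density t)%:E = 1)%E.
Proof.
have := @integral_gauss_density 0 0 (lexx _).
rewrite addr0 sqrtr1 invr1 mul1r expr0n mul0r expR0 => <-.
by apply: eq_integral => t _; rewrite !mul0r oppr0 addr0 expR0 mule1.
Qed.

Let k1 : forall t : R, (0 : R) <= (fun=> 1) t. Proof. by []. Qed.
Let mk1 : measurable_fun setT ((fun=> 1) : R -> R).
Proof. exact: measurable_cst. Qed.

Lemma lebintE f w : lebint f = iint (fun=> 1) (enum I) f w.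
Proof.
apply: eq_iint_dep => x y xy; congr f; apply/funext => i.
by apply: xy; rewrite mem_enum.
Qed.

Lemma lebint_ge0 f : (forall w, 0 <= f w)%E -> (0 <= lebint f)%E.
Proof. by move=> f0; exact: iint_ge0. Qed.

Lemma le_lebint f g : (forall w, 0 <= f w)%E -> coord_measurable f ->
  coord_measurable g -> (forall w, f w <= g w)%E -> (lebint f <= lebint g)%E.
Proof. by move=> f0 mf mg fg; exact: le_iint. Qed.

Lemma lebintZ f (c : R) : 0 <= c -> (forall w, 0 <= f w)%E ->
  coord_measurable f -> lebint (fun w => c%:E * f w)%E = (c%:E * lebint f)%E.
Proof. by move=> c0 f0 mf; exact: iintZ. Qed.

Lemma lebintD f g : (forall w, 0 <= f w)%E -> coord_measurable f ->
  (forall w, 0 <= g w)%E -> coord_measurable g ->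
  lebint (fun w => f w + g w)%E = (lebint f + lebint g)%E.
Proof. by move=> f0 mf g0 mg; exact: iintD. Qed.

Lemma lebint_sum (J : Type) (r : seq J) (f : J -> (I -> R) -> \bar R) :
  (forall j w, 0 <= f j w)%E -> (forall j, coord_measurable (f j)) ->
  lebint (fun w => \sum_(j <- r) f j w)%E = (\sum_(j <- r) lebint (f j))%E.
Proof. by move=> f0 mf; exact: iint_sum. Qed.

Lemma lebint_affine f (s : I -> bool) v : (forall w, 0 <= f w)%E ->
  coord_measurable f ->
  lebint (fun w => f (fun i => (-1) ^+ s i * w i + v i)) = lebint f.
Proof. by move=> f0 mf; rewrite {1}/lebint iint_affine// -lebintE. Qed.

Lemma lebint_shift f v : (forall w, 0 <= f w)%E -> coord_measurable f ->
  lebint (fun w => f (fun i => w i + v i)) = lebint f.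
Proof.
move=> f0 mf; rewrite -[RHS](lebint_affine (fun=> false) v)//.
by congr lebint; apply/funext => w; congr f; apply/funext => i; rewrite mul1r.
Qed.

Lemma coord_measurable_dot x : coord_measurable (dot x).
Proof.
rewrite (_ : dot x = fun w => \sum_(i <- index_enum I) x i * w i)//.
apply: coord_measurable_sum => i; apply: coord_measurableM.
  exact: coord_measurable_cst.
exact: coord_measurable_proj.
Qed.

Lemma coord_measurable_rho Q : coord_measurable (rho Q).
Proof.
apply: coord_measurable_expR; apply: coord_measurableN; apply: coord_measurableM.
  rewrite (_ : (fun w => _) = fun w => \sum_(i <- index_enum I) w i * dot (Q i) w)//.
  apply: coord_measurable_sum => i; apply: coord_measurableM.
    exact: coord_measurable_proj.
  exact: coord_measurable_dot.
exact: coord_measurable_cst.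
Qed.

(** Completing the square in [t]: adding an independent Gaussian multiple of [v] lowers the
    precision along [mv Q v]. *)
Lemma integral_gauss_rho Q v w : symmetric_kernel Q -> 0 <= dot v (mv Q v) ->
  (\int[leb]_t ((gauss_density t)%:E * (rho Q (fun i => w i + (- t) * v i)%R)%:E) =
  ((Num.sqrt (1 + dot v (mv Q v)))^-1 * rho (fun i j => Q i j -
      mv Q v i * mv Q v j / (1 + dot v (mv Q v))) w)%:E)%E.
Proof.
move=> sQ s0; set a := dot v (mv Q v).
have a1 : 0 < 1 + a by rewrite ltr_pwDl.
transitivity (\int[leb]_t ((rho Q w)%:E * ((gauss_density t)%:E *
    (expR (- (a * t ^+ 2 / 2) + dot w (mv Q v) * t))%:E)))%E.
  apply: eq_integral => t _; rewrite muleCA; congr (_ * _)%E.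
  rewrite -EFinM /rho -expRD dot_mv_sub// sqrrN -/a; by congr (expR _)%:E; field.
rewrite ge0_integralZl_EFin ?expR_ge0//=; last 2 first.
- by move=> t _; rewrite mule_ge0// lee_fin ?gauss_density_ge0// expR_ge0.
- apply: emeasurable_funM; apply/measurable_EFinP.
    exact: measurable_gauss_density.
  apply: measurableT_comp => //; apply: measurable_funD.
    apply: measurable_funN; apply: measurable_funM => //.
    by apply: measurable_funM => //; exact: measurable_funX.
  exact: measurable_funM.
rewrite integral_gauss_density// -EFinM; congr EFin.
rewrite mulrCA; congr (_ * _); rewrite /rho -expRD; congr expR.
have -> : mv (fun i j => Q i j - mv Q v i * mv Q v j / (1 + a)) w =
    fun i => mv Q w i + (- (dot (mv Q v) w / (1 + a))) * mv Q v i.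
  apply/funext => i; rewrite {1}/mv.
  under eq_bigr do rewrite mulrBl.
  rewrite sumrB mulNr; congr (_ - _); rewrite /dot !mulr_suml.
  by apply: eq_bigr => j _; ring.
rewrite dotDr dotZr [dot (mv Q v) w]dotC; field.
by rewrite gt_eqF.
Qed.

(* Sherman-Morrison: if [C] is inverse to [Q], then [C + v v^T] is inverse to the
   kernel of the left-hand side. *)
Lemma lebint_rank_one Q v (f : (I -> R) -> \bar R) :
  symmetric_kernel Q -> 0 <= dot v (mv Q v) ->
  (forall w, 0 <= f w)%E -> coord_measurable f ->
  lebint (fun w => (rho (fun i j => Q i j -
      mv Q v i * mv Q v j / (1 + dot v (mv Q v))) w)%:E * f w)%E =
  ((Num.sqrt (1 + dot v (mv Q v)))%:E * lebint (fun w => (rho Q w)%:E *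
    \int[leb]_t ((gauss_density t)%:E * f (fun i => (w i + t * v i)%R))))%E.
Proof.
move=> sQ s0 f0 mf; set a := dot v (mv Q v).
have a1 : 0 < 1 + a by rewrite ltr_pwDl.
have mfs d (T : measurableType d) (h : T -> R) (g : T -> I -> R) :
    measurable_fun setT h -> (forall i, measurable_fun setT (g ^~ i)) ->
    measurable_fun setT (fun t => f (fun i => g t i + h t * v i)).
  move=> mh mg; apply: (mf _ _ (fun t i => g t i + h t * v i)) => i.
  by apply: measurable_funD => //; exact: measurable_funM.
have mfr d (T : measurableType d) (h : T -> R) (g : T -> I -> R) :
    measurable_fun setT h -> (forall i, measurable_fun setT (g ^~ i)) ->
    measurable_fun setT (fun t => (rho Q (fun i => g t i + h t * v i))%:E).
  move=> mh mg; apply/measurable_EFinP.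
  apply: (@coord_measurable_rho Q _ _ (fun t i => g t i + h t * v i)) => i.
  by apply: measurable_funD => //; exact: measurable_funM.
pose A t := lebint (fun w => (rho Q w)%:E * f (fun i => (w i + t * v i)%R))%E.
pose B t := lebint (fun w => (rho Q (fun i => w i + (- t) * v i)%R)%:E * f w)%E.
(* Translation invariance moves the shift by [t * v] from [f] to the density, where the integral
   over [t] can be computed. *)
have AB : A = B.
  apply/funext => t; rewrite /A /B.
  rewrite -[LHS](lebint_shift (fun i => - t * v i)).
  - congr lebint; apply/funext => w; congr (_ * f _)%E.
    by apply/funext => i; rewrite mulNr subrK.
  - by move=> w; rewrite mule_ge0// lee_fin expR_ge0.
  - move=> d T g mg; apply: emeasurable_funM.
      by apply/measurable_EFinP; exact: coord_measurable_rho.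
    by apply: (mfs _ _ (fun=> t)) => //; exact: measurable_cst.
transitivity ((Num.sqrt (1 + a))%:E * \int[leb]_t ((gauss_density t)%:E *
    A t))%E; last first.
  congr (_ * _)%E; rewrite /A /lebint iint_swap//.
  - congr (iint _ _ _ _); apply/funext => w; rewrite -ge0_integralZl_EFin//=.
    + by apply: eq_integral => t _; rewrite muleCA.
    + by move=> t _; rewrite mule_ge0// lee_fin gauss_density_ge0.
    + apply: emeasurable_funM.
        by apply/measurable_EFinP; exact: measurable_gauss_density.
      by apply: (mfs _ _ id (fun=> w)) => // i; exact: measurable_cst.
    + exact: expR_ge0.
  - exact: gauss_density_ge0.
  - exact: measurable_gauss_density.
  - by move=> t w; rewrite mule_ge0// lee_fin expR_ge0.
  - move=> d T h g mh mg; apply: emeasurable_funM; last exact: mfs.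
    by apply/measurable_EFinP; exact: coord_measurable_rho.
rewrite AB /B /lebint iint_swap//; last 4 first.
- exact: gauss_density_ge0.
- exact: measurable_gauss_density.
- by move=> t w; rewrite mule_ge0// lee_fin expR_ge0.
- move=> d T h g mh mg; apply: emeasurable_funM; last exact: mf.
  by apply: (mfr _ _ (fun t => - h t)) => //; exact: measurable_funN.
rewrite -/(lebint _) -lebintZ ?sqrtr_ge0//; last 2 first.
- move=> w; apply: integral_ge0 => t _.
  by rewrite !mule_ge0// lee_fin ?gauss_density_ge0// expR_ge0.
- move=> d T g mg.
  pose F (z : T * measurableTypeR R) := ((gauss_density z.2)%:E *
    ((rho Q (fun i => g z.1 i + (- z.2) * v i))%:E * f (g z.1)))%E.
  have mF : measurable_fun setT F.
    apply: emeasurable_funM.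
      apply/measurable_EFinP.
      exact: (measurableT_comp measurable_gauss_density measurable_snd).
    apply: emeasurable_funM; last first.
      by apply: (mf _ _ (g \o fst)) => i; exact: (measurableT_comp (mg i)).
    apply: (mfr _ _ (fun z : T * measurableTypeR R => - z.2) (g \o fst)) => [|i].
      by apply: measurable_funN; exact: measurable_snd.
    exact: (measurableT_comp (mg i)).
  apply: (@measurable_fun_fubini_tonelli_F _ _ _ _ R leb F mF).
  by move=> z; rewrite !mule_ge0// lee_fin ?gauss_density_ge0// expR_ge0.
congr lebint; apply/funext => w.
have mG : measurable_fun setT (fun t : measurableTypeR R =>
    ((gauss_density t)%:E * (rho Q (fun i => w i + (- t) * v i)%R)%:E)%E).
  apply: emeasurable_funM.
    by apply/measurable_EFinP; exact: measurable_gauss_density.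
  apply: (mfr _ _ (fun t : measurableTypeR R => - t) (fun=> w)) => [|i].
    exact: measurable_funN.
  exact: measurable_cst.
under eq_integral do rewrite muleA.
rewrite ge0_integralZr//=; last first.
  by move=> t _; rewrite mule_ge0// lee_fin ?gauss_density_ge0// expR_ge0.
rewrite integral_gauss_rho// -/a muleA -EFinM; congr (_%:E * _)%E.
by rewrite mulrA divff ?mul1r// gt_eqF// sqrtr_gt0.
Qed.

(** Up to the factor [expR (dot a c / 2)], the density tilted by [a = mv Q c] is the density
    recentred at [c]. *)
Lemma lebint_exp_dot Q (a c : I -> R) : symmetric_kernel Q -> mv Q c = a ->
  lebint (fun w => (rho Q w * expR (dot a w))%:E) =
  ((expR (dot a c / 2))%:E * lebint (fun w => (rho Q w)%:E))%E.
Proof.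
move=> sQ Qc; have mr : coord_measurable (fun w => (rho Q w)%:E).
  by apply: coord_measurable_EFin; exact: coord_measurable_rho.
rewrite -lebintZ ?expR_ge0//; last by move=> w; rewrite lee_fin expR_ge0.
rewrite -[RHS](lebint_shift (fun i => -1 * c i)); last 2 first.
- by move=> w; rewrite -EFinM lee_fin mulr_ge0// expR_ge0.
- move=> d T g mg; apply: emeasurable_funM; last exact: mr.
  exact: measurable_cst.
congr lebint; apply/funext => w; rewrite -EFinM; congr EFin.
rewrite /rho -!expRD dot_mv_sub// Qc [dot w a]dotC [dot c a]dotC; by congr expR; field.
Qed.

Lemma lebint_diag (a : R) : 0 < a ->
  lebint (fun w => (expR (- (a * dot w w / 2)))%:E) =
  (Num.sqrt (2 * pi / a) ^+ #|I|)%:E.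
Proof.
move=> a0; transitivity (lebint (fun w =>
    (\prod_(i <- enum I) expR (- (a * w i ^+ 2 / 2)))%:E)).
  congr lebint; apply/funext => w; congr EFin.
  rewrite -expR_sum big_enum/=; congr expR.
  rewrite /dot mulr_sumr mulr_suml -sumrN; apply: eq_bigr => i _; ring.
rewrite /lebint (@iint_prod _ _ (fun=> 1) _ (fun=> fun t => expR (- (a * t ^+ 2 / 2))))//.
- rewrite (eq_bigr (fun=> (Num.sqrt (2 * pi / a))%:E)); last first.
    move=> i _; have := integral_gaussian 0 a0.
    rewrite expr0n mul0r expR0 mulr1 => <-; apply: eq_integral => t _.
    by rewrite mul1e mul0r addr0.
  by rewrite prodEFin big_const_seq count_predT -cardE iter_mulr_1.
- move=> _; apply: measurableT_comp => //; apply: measurable_funN.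
  by apply: measurable_funM => //; apply: measurable_funM.
- exact: enum_uniq.
Qed.

Lemma lebint_rho_fin Q (a : R) : 0 < a ->
  (forall w, a * dot w w <= dot w (mv Q w)) ->
  (lebint (fun w => (rho Q w)%:E) < +oo)%E.
Proof.
move=> a0 aQ; apply: le_lt_trans (ltry (Num.sqrt (2 * pi / a) ^+ #|I|)).
rewrite -lebint_diag//; apply: le_lebint.
- by move=> w; rewrite lee_fin expR_ge0.
- by apply: coord_measurable_EFin; exact: coord_measurable_rho.
- apply: coord_measurable_EFin; apply: coord_measurable_expR.
  apply: coord_measurableN; apply: coord_measurableM; last exact: coord_measurable_cst.
  apply: coord_measurableM; first exact: coord_measurable_cst.
  rewrite (_ : (fun w => _) = fun w => \sum_(i <- index_enum I) w i * w i)//.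
  apply: coord_measurable_sum => i.
  by apply: coord_measurableM; exact: coord_measurable_proj.
- by move=> w; rewrite lee_fin ler_expR lerN2 ler_pM2r.
Qed.

Lemma lebint_rho_gt0 Q (a : R) : 0 < a ->
  (forall w, dot w (mv Q w) <= a * dot w w) ->
  (0 < lebint (fun w => (rho Q w)%:E))%E.
Proof.
move=> a0 aQ; apply: (@lt_le_trans _ _ (Num.sqrt (2 * pi / a) ^+ #|I|)%:E).
  by rewrite lte_fin exprn_gt0// sqrtr_gt0 divr_gt0// mulr_gt0// pi_gt0.
rewrite -lebint_diag//; apply: le_lebint.
- by move=> w; rewrite lee_fin expR_ge0.
- apply: coord_measurable_EFin; apply: coord_measurable_expR.
  apply: coord_measurableN; apply: coord_measurableM; last exact: coord_measurable_cst.
  apply: coord_measurableM; first exact: coord_measurable_cst.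
  rewrite (_ : (fun w => _) = fun w => \sum_(i <- index_enum I) w i * w i)//.
  apply: coord_measurable_sum => i.
  by apply: coord_measurableM; exact: coord_measurable_proj.
- by apply: coord_measurable_EFin; exact: coord_measurable_rho.
- by move=> w; rewrite lee_fin ler_expR lerN2 ler_pM2r.
Qed.

End gaussian.

(** * Percolation on a finite edge set *)

Section percolation_functional.
Variables (R : realType) (E : finType).
Implicit Types (p : E -> R) (f g : {set E} -> R) (e : E) (w : {set E}) (s : seq E).

Definition edge_mean p e f : {set E} -> R :=
  fun w => p e * f (e |: w) + (1 - p e) * f (w :\ e).

Definition edge_means p s f := foldr (edge_mean p) f s.

(* The expectation of [f] applied to the random set containing each [e]
   independently with probability [p e]. *)
Definition pmean p f : R := edge_means p (enum E) f finset.set0.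

Definition increasing f := forall w w', w \subset w' -> f w <= f w'.

Definition prob_param p := forall e, 0 <= p e <= 1.

Lemma edge_meanC p e e' f : edge_mean p e (edge_mean p e' f) =
  edge_mean p e' (edge_mean p e f).
Proof.
have [->//|ee'] := eqVneq e e'.
apply/funext => w; rewrite /edge_mean.
have -> : e' |: (e |: w) = e |: (e' |: w) by rewrite finset.setUCA.
have -> : (e' |: (w :\ e)) = (e' |: w) :\ e.
  by apply/finset.setP => x; rewrite !inE; case: eqVneq => // ->; rewrite ?andbF//= eq_sym ee' ?andbT.
have -> : (e |: (w :\ e')) = (e |: w) :\ e'.
  apply/finset.setP => x; rewrite !inE; case: eqVneq => //= ->.
  by rewrite ?orbF ?andbF//= ?(eq_sym e') ee'.
have -> : (w :\ e) :\ e' = (w :\ e') :\ e.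
  by apply/finset.setP => x; rewrite !inE andbCA.
ring.
Qed.

Lemma edge_meansC p s e f :
  edge_means p s (edge_mean p e f) = edge_mean p e (edge_means p s f).
Proof. by elim: s => //= e' s ->; rewrite edge_meanC. Qed.

Lemma edge_mean_idem p e f : edge_mean p e (edge_mean p e f) = edge_mean p e f.
Proof.
apply/funext => w; rewrite /edge_mean.
have -> : e |: (e |: w) = e |: w by rewrite finset.setUA finset.setUid.
have -> : (e |: w) :\ e = w :\ e.
  by apply/finset.setP => x; rewrite !inE; case: eqVneq.
have -> : e |: (w :\ e) = e |: w.
  by apply/finset.setP => x; rewrite !inE; case: eqVneq.
have -> : (w :\ e) :\ e = w :\ e.
  by apply/finset.setP => x; rewrite !inE; case: eqVneq.
ring.
Qed.

Lemma edge_means_mem p s e f : e \in s ->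
  edge_mean p e (edge_means p s f) = edge_means p s f.
Proof.
elim: s => //= e' s ih; rewrite inE => /predU1P[->|es].
  exact: edge_mean_idem.
by rewrite edge_meanC ih.
Qed.

Lemma edge_meansD p s f g : edge_means p s (fun w => f w + g w) =
  fun w => edge_means p s f w + edge_means p s g w.
Proof. by elim: s => //= e s ->; apply/funext => w; rewrite /edge_mean; ring. Qed.

Lemma edge_meansZ p s (a : R) f : edge_means p s (fun w => a * f w) =
  fun w => a * edge_means p s f w.
Proof. by elim: s => //= e s ->; apply/funext => w; rewrite /edge_mean; ring. Qed.

Lemma pmeanD p f g : pmean p (fun w => f w + g w) = pmean p f + pmean p g.
Proof. by rewrite /pmean edge_meansD. Qed.

Lemma pmeanZ p (a : R) f : pmean p (fun w => a * f w) = a * pmean p f.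
Proof. by rewrite /pmean edge_meansZ. Qed.

Lemma pmeanB p f g : pmean p (fun w => f w - g w) = pmean p f - pmean p g.
Proof.
rewrite -[X in _ = _ + X]mulN1r -pmeanZ -pmeanD; congr pmean.
by apply/funext => w; rewrite mulN1r.
Qed.

Lemma pmean_cst p (c : R) : pmean p (fun=> c) = c.
Proof.
rewrite /pmean; elim: (enum E) finset.set0 => //= e s ih w.
by rewrite /edge_mean !ih; ring.
Qed.

Lemma pmean_sum (J : Type) (r : seq J) p (f : J -> {set E} -> R) :
  pmean p (fun w => \sum_(j <- r) f j w) = \sum_(j <- r) pmean p (f j).
Proof.
elim: r => [|j r ih].
  rewrite big_nil -[RHS](pmean_cst p); congr pmean.
  by apply/funext => w; rewrite big_nil.
rewrite big_cons -ih -pmeanD; congr pmean.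
by apply/funext => w; rewrite big_cons.
Qed.

(** The averages over single edges commute and are idempotent, so averaging over [e] once more
    changes nothing. *)
Lemma pmean_expand p e f : pmean p f =
  p e * pmean p (fun w => f (e |: w)) + (1 - p e) * pmean p (fun w => f (w :\ e)).
Proof.
rewrite -!pmeanZ -pmeanD -[in RHS]/(edge_mean p e f) /pmean edge_meansC.
by rewrite edge_means_mem// mem_enum.
Qed.

Lemma le_edge_means p s f g : prob_param p -> (forall w, f w <= g w) ->
  forall w, edge_means p s f w <= edge_means p s g w.
Proof.
move=> p01 fg; elim: s => //= e s ih w; have /andP[p0 p1] := p01 e.
by apply: lerD; apply: ler_wpM2l; rewrite ?subr_ge0.
Qed.

Lemma le_pmean p f g : prob_param p -> (forall w, f w <= g w) ->
  pmean p f <= pmean p g.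
Proof. by move=> p01 fg; exact: le_edge_means. Qed.

Lemma increasing_edge_means p s f : prob_param p -> increasing f ->
  increasing (edge_means p s f).
Proof.
move=> p01 incf; elim: s => //= e s ih w w' ww'; have /andP[p0 p1] := p01 e.
apply: lerD; apply: ler_wpM2l; rewrite ?subr_ge0//; apply: ih.
  exact: finset.setUS.
exact: finset.setSD.
Qed.

(** The parameters are changed one edge at a time; each change contributes [p' e - p e] times the
    effect of opening [e], which is nonnegative for an increasing function. *)
Lemma pmean_le_param p p' f : prob_param p -> prob_param p' ->
  (forall e, p e <= p' e) -> increasing f -> pmean p f <= pmean p' f.
Proof.
move=> p01 p'01 pp' incf; rewrite /pmean.
elim: (enum E) finset.set0 => //= e s ih w.
have /andP[p0 p1] := p'01 e; rewrite /edge_mean.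
apply: (@le_trans _ _ (p' e * edge_means p s f (e |: w) +
    (1 - p' e) * edge_means p s f (w :\ e))).
  have : edge_means p s f (w :\ e) <= edge_means p s f (e |: w).
    apply: increasing_edge_means => //.
    by apply: (fintype.subset_trans (finset.subD1set _ _)); exact: finset.subsetU1.
  rewrite -subr_ge0 => h; rewrite -subr_ge0.
  rewrite (_ : _ - _ = (p' e - p e) *
    (edge_means p s f (e |: w) - edge_means p s f (w :\ e))); last by ring.
  by rewrite mulr_ge0// subr_ge0.
by apply: lerD; apply: ler_wpM2l; rewrite ?subr_ge0.
Qed.

Lemma pmean_bounds p f (a b : R) : prob_param p -> (forall w, a <= f w <= b) ->
  a <= pmean p f <= b.
Proof.
move=> p01 fab; apply/andP; split.
  by rewrite -{1}(pmean_cst p a); apply: le_pmean => // w; have /andP[] := fab w.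
by rewrite -[leRHS](pmean_cst p b); apply: le_pmean => // w; have /andP[] := fab w.
Qed.

Lemma increasing_addU f (U : {set E}) : increasing f ->
  increasing (fun w => f (w :|: U)).
Proof. by move=> incf w w' ww'; apply: incf; exact: finset.setSU. Qed.

(* The edges of [s] are likely to be open anyway, so opening them all costs at most
   a factor [2 ^ #|s|]; sprinkling then need only open the last missing one. *)
Lemma pmean_sprinkle p p' (delta : R) s f : prob_param p -> prob_param p' ->
  (forall e, p e <= p' e) -> 0 < delta <= 1 ->
  (forall e, e \in s -> 2^-1 <= p e /\ p e + delta * (1 - p e) <= p' e) ->
  increasing f ->
  pmean p (fun w => f (w :|: [set x in s])) - pmean p f <=
  2 ^+ size s / delta * (pmean p' f - pmean p f).
Proof.
move=> p01 p'01 pp' /andP[d0 d1].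
elim: s f => [|e s ih] f ps incf.
  rewrite (_ : (fun w => _) = f); last first.
    by apply/funext => w; congr f; apply/finset.setP => x; rewrite !inE orbF.
  rewrite subrr mulr_ge0 ?divr_ge0 ?exprn_ge0 ?(ltW d0)// subr_ge0.
  exact: pmean_le_param.
have [pe p'e] := ps e (mem_head _ _).
have inc1 : increasing (fun w => f (e |: w)).
  by move=> w w' ww'; apply: incf; exact: finset.setUS.
have inc0 : increasing (fun w => f (w :\ e)).
  by move=> w w' ww'; apply: incf; exact: finset.setSD.
have := ih (fun w => f (e |: w)) _ inc1.
have pss : forall x, x \in s -> 2^-1 <= p x /\ p x + delta * (1 - p x) <= p' x.
  by move=> x xs; apply: ps; rewrite inE xs orbT.
move=> /(_ pss).
rewrite (_ : (fun w => f (e |: (w :|: _))) =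
    fun w => f (w :|: [set x in e :: s])); last first.
  apply/funext => w; congr f; apply/finset.setP => x; rewrite !inE.
  by case: (x == e); case: (x \in w).
set A := pmean p (fun w => f (w :|: _)).
rewrite (pmean_expand p e f) (pmean_expand p' e f).
set a := pmean p (fun w => f (e |: w)); set a' := pmean p' (fun w => f (e |: w)).
set b := pmean p (fun w => f (w :\ e)); set b' := pmean p' (fun w => f (w :\ e)).
have aa' : a <= a' by exact: pmean_le_param.
have bb' : b <= b' by exact: pmean_le_param.
have b'a' : b' <= a'.
  apply: le_pmean => // w; apply: incf.
  by apply: (fintype.subset_trans (finset.subD1set _ _)); exact: finset.subsetU1.
have ba : b <= a.
  apply: le_pmean => // w; apply: incf.
  by apply: (fintype.subset_trans (finset.subD1set _ _)); exact: finset.subsetU1.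
set K := 2 ^+ size s => h.
have K1 : 1 <= K by rewrite exprn_ege1// ler1n.
have /andP[p0 p1] := p01 e; have /andP[p'0 p'1] := p'01 e.
rewrite /= exprS -/K.
have Kd : 1 <= K / delta by rewrite ler_pdivlMr// mul1r (le_trans d1).
set L := K / delta in h Kd *.
have Ld : K = L * delta by rewrite /L divfK// gt_eqF.
have -> : 2 * K / delta = 2 * L by rewrite /L mulrA.
move: (p e) (p' e) p0 p1 p'0 p'1 pe p'e (pp' e) => q q' q0 q1 q'0 q'1 qh q'q qq'.
have L0 : 0 <= L by lra.
(* The inequality is linear in the products below. [t1] uses that [e] is open with probability at
   least one half, [t3] that sprinkling opens a closed [e] with probability at least [delta]. The
   loss [(1 - q) * (a - b)] is split by [t10]: its part in [a' - b'] is paid by sprinkling [e],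
   since [K >= 1], and its part in [b' - b] through [t11], since [L >= 1]. *)
have t1 : 0 <= L * ((2 * q - 1) * (a' - a))
  by apply: mulr_ge0; [lra|apply: mulr_ge0; lra].
have t2 : 0 <= L * ((1 - q) * (b' - b))
  by apply: mulr_ge0; [lra|apply: mulr_ge0; lra].
have t3 : 0 <= L * ((q' - q - delta * (1 - q)) * (a' - b'))
  by apply: mulr_ge0; [lra|apply: mulr_ge0; lra].
have t4 : 0 <= (K - 1) * ((1 - q) * (a' - b'))
  by apply: mulr_ge0; [lra|apply: mulr_ge0; lra].
have t5 : 0 <= (L - 1) * ((1 - q) * (b' - b))
  by apply: mulr_ge0; [lra|apply: mulr_ge0; lra].
have t6 : 0 <= (1 - q) * (a' - a) by apply: mulr_ge0; lra.
have t7 : 0 <= K * ((1 - q) * (a' - b'))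
  by apply: mulr_ge0; [lra|apply: mulr_ge0; lra].
have t8 : 0 <= (1 - q) * (b' - b) by apply: mulr_ge0; lra.
have t9 : K * ((1 - q) * (a' - b')) = L * (delta * (1 - q) * (a' - b')).
  by rewrite {1}Ld; ring.
have -> : A - (q * a + (1 - q) * b) = (A - a) + (1 - q) * (a - b) by ring.
apply: (@le_trans _ _ (L * (a' - a) + (1 - q) * (a - b))); first by rewrite lerD2r.
rewrite -subr_ge0.
rewrite (_ : _ - _ = L * ((2 * q - 1) * (a' - a)) + 2 * (L * ((1 - q) * (b' - b)))
  + 2 * (L * ((q' - q - delta * (1 - q)) * (a' - b')))
  + 2 * (L * (delta * (1 - q) * (a' - b'))) - (1 - q) * (a - b)); last by ring.
rewrite -t9.
have t10 : (1 - q) * (a - b) = (1 - q) * (a' - b') + (1 - q) * (b' - b) - (1 - q) * (a' - a) by ring.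
have t11 : L * ((1 - q) * (b' - b)) = (L - 1) * ((1 - q) * (b' - b)) + (1 - q) * (b' - b) by ring.
have t12 : K * ((1 - q) * (a' - b')) = (K - 1) * ((1 - q) * (a' - b')) + (1 - q) * (a' - b') by ring.
rewrite t10 t11; lra.
Qed.

End percolation_functional.

(** * Finite networks: connection to the outside, balls and stars *)

Section network.
Variables (I E : finType) (src : E -> I) (tgt : E -> option I).
Implicit Types (w : {set E}) (x y u : I) (X B S : {set I}) (e : E).

(* A finite network: [tgt e = None] means that [e] leads outside. *)
Definition joins e : rel (option I) := fun a b =>
  ((a == Some (src e)) && (b == tgt e)) || ((b == Some (src e)) && (a == tgt e)).

Definition links w : rel (option I) := fun a b => [exists e in w, joins e a b].

Definition reaches S w : bool := [exists x in S, connect (links w) (Some x) None].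

Definition touches e x : bool := (src e == x) || (tgt e == Some x).

Definition star X : {set E} := [set e | [exists x in X, touches e x]]%SET.

Definition nadj : rel I := fun x y => [exists e, joins e (Some x) (Some y)].

Fixpoint nball (r : nat) x : {set I} :=
  (if r is q.+1 then nball q x :|: [set y | [exists z in nball q x, nadj z y]]
   else [set x])%SET.

Lemma joinsC e : symmetric (joins e).
Proof. by move=> a b; rewrite /joins orbC. Qed.

Lemma linksC w : symmetric (links w).
Proof. by move=> a b; apply: eq_existsb => e; rewrite joinsC. Qed.

Lemma connect_linksC w : connect_sym (links w).
Proof. exact: sym_connect_sym (linksC w). Qed.

Lemma links_sub w w' a b : w \subset w' -> links w a b -> links w' a b.
Proof.
move=> /fintype.subsetP ww' /'exists_andP[e [ew eab]].
by apply/'exists_andP; exists e; rewrite ww'.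
Qed.

Lemma connect_links_sub w w' a b : w \subset w' ->
  connect (links w) a b -> connect (links w') a b.
Proof.
move=> ww'; apply: connect_sub => x y xy.
by apply: connect1; exact: links_sub xy.
Qed.

Lemma reaches_sub S w w' : w \subset w' -> reaches S w -> reaches S w'.
Proof.
move=> ww' /'exists_andP[x [xS xN]]; apply/'exists_andP; exists x.
by rewrite xS; split=> //; exact: connect_links_sub xN.
Qed.

Lemma joins_touches e a b x : joins e a b -> touches e x ->
  a = Some x \/ b = Some x.
Proof.
move=> + /orP[/eqP sx|/eqP tx] => /orP[|] /andP[/eqP -> /eqP ->].
- by left; rewrite sx.
- by right; rewrite sx.
- by right; rewrite tx.
- by left; rewrite tx.
Qed.

Lemma nadjC : symmetric nadj.
Proof. by move=> x y; apply: eq_existsb => e; rewrite joinsC. Qed.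

Lemma nball_center r x : x \in nball r x.
Proof. by elim: r => [|r ih]; rewrite !inE// ih. Qed.

Lemma nball_leq q r x : (q <= r)%N -> nball q x \subset nball r x.
Proof.
move=> /subnKC <-; elim: (r - q)%N => [|k ih]; first by rewrite addn0.
rewrite addnS /=; apply: (fintype.subset_trans ih); exact: finset.subsetUl.
Qed.

Lemma nball_trans q r x y z : y \in nball q x -> z \in nball r y ->
  z \in nball (q + r) x.
Proof.
move=> yx; elim: r z => [|r ih] z; first by rewrite inE addn0 => /eqP ->.
rewrite !inE addnS => /orP[/ih zx|/'exists_andP[u [ur uz]]].
  by rewrite /= inE zx.
by rewrite /= !inE; apply/orP; right; apply/'exists_andP; exists u; rewrite ih.
Qed.

Lemma nadj_ball x y : nadj x y -> y \in nball 1 x.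
Proof.
move=> xy; rewrite /= !inE; apply/orP; right; apply/'exists_andP.
by exists x; rewrite inE.
Qed.

Lemma nball_sym r x y : y \in nball r x -> x \in nball r y.
Proof.
elim: r y => [|r ih] y; first by rewrite !inE eq_sym.
move=> h; case: (boolP (y \in nball r x)) => [/ih xy|yr].
  exact: (fintype.subsetP (nball_leq y (leqnSn r))).
have /'exists_andP[u [/ih xu uy]] : [exists z in nball r x, nadj z y].
  by move: h; rewrite /= !inE (negbTE yr).
by rewrite -add1n; apply: nball_trans xu; apply: nadj_ball; rewrite nadjC.
Qed.

Lemma touches_nadj e x y : touches e x -> touches e y -> (y == x) || nadj x y.
Proof.
move=> /orP[/eqP sx|/eqP tx] /orP[/eqP sy|/eqP ty].
- by rewrite -sx -sy eqxx.
- by apply/orP; right; apply/existsP; exists e; rewrite /joins sx ty !eqxx.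
- by apply/orP; right; apply/existsP; exists e; rewrite /joins sy tx !eqxx orbT.
- by move: ty; rewrite tx => -[->]; rewrite eqxx.
Qed.

Lemma touches_ball e x y : touches e x -> touches e y -> y \in nball 1 x.
Proof.
move=> ex ey; have /orP[/eqP ->|] := touches_nadj ex ey.
  exact: nball_center.
exact: nadj_ball.
Qed.

Lemma nball_path r x u : u \in nball r x -> exists g : seq E,
  [/\ (size g <= r)%N, {subset g <= star (nball r x)} &
    connect (links [set e in g]%SET) (Some u) (Some x)].
Proof.
elim: r u => [|r ih] u.
  by rewrite inE => /eqP ->; exists [::]; split.
rewrite [in X in X -> _]/= !inE => /orP[/ih[g [sg gs gc]]|].
  exists g; split => //; first exact: leqW.
  move=> e /gs; rewrite !inE => /'exists_andP[z [zr ez]].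
  by apply/'exists_andP; exists z; rewrite ez /= inE zr.
move=> /'exists_andP[z [zr /existsP[e ezu]]].
have [g [sg gs gc]] := ih z zr.
exists (e :: g); split => //.
- move=> e'; rewrite inE => /predU1P[->|/gs]; rewrite !inE.
    apply/'exists_andP; exists z; rewrite /= inE zr /touches; split => //.
    by move: ezu => /orP[|] /andP[/eqP + /eqP]; [move=> [->] _|move=> _ <-];
      rewrite eqxx ?orbT.
  move=> /'exists_andP[y [yr ey]].
  by apply/'exists_andP; exists y; rewrite ey /= inE yr.
- apply: (@connect_trans _ _ (Some z)).
    apply: connect1; apply/'exists_andP; exists e.
    by rewrite !inE eqxx joinsC.
  apply: connect_links_sub gc; apply/fintype.subsetP => e'.
  by rewrite !inE => ->; rewrite orbT.
Qed.

(** The path is chosen independently of the configuration, so that a union bound over the endpoints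
    covers all configurations. Where no such path exists, [[::]] is a placeholder. *)
Definition ball_path r x u : seq E :=
  if pselect (exists g : seq E, [/\ (size g <= r)%N,
    {subset g <= star (nball r x)} &
    connect (links [set e in g]%SET) (Some u) (Some x)]) is left h
  then projT1 (cid h) else [::].

Lemma ball_pathP r x u : u \in nball r x ->
  [/\ (size (ball_path r x u) <= r)%N,
    {subset ball_path r x u <= star (nball r x)} &
    connect (links [set e in ball_path r x u]%SET) (Some u) (Some x)].
Proof.
move=> /nball_path h; rewrite /ball_path; case: pselect => // h'.
exact: projT2 (cid h').
Qed.

(** Reading the path from its end [c], the first edge outside [w] lies in [star B], hence has an end
    [u] in [B], and what follows it lies in [w]. The edge [e] is kept because [u] may be its far
    end. *)
Lemma connect_star_cut w B a c : connect (links (w :|: star B)%SET) a c ->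
  connect (links w) a c \/ exists u e, [/\ u \in B, e \in star B &
    connect (links (e |: w)%SET) (Some u) c].
Proof.
move=> /connectP[p + ->]; elim: p a => [|b p ih] a /=; first by left.
move=> /andP[/'exists_andP[e [ew eab]] /ih[wbc|]]; last by right.
have [ew'|ew'] := boolP (e \in w).
  left; apply: connect_trans wbc; apply: connect1.
  by apply/'exists_andP; exists e.
right; move: ew; rewrite finset.in_setU (negbTE ew') /= => eB.
have := eB; rewrite inE => /'exists_andP[u [uB eu]].
exists u, e; split => //.
have wbc' : connect (links (e |: w)%SET) b (last b p).
  by apply: connect_links_sub wbc; exact: finset.subsetU1.
have [au|<-//] := joins_touches eab eu.
rewrite -au; apply: connect_trans wbc'; apply: connect1.
by apply/'exists_andP; exists e; rewrite !inE eqxx.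
Qed.

(** Opening a whole star is replaced by opening few of its edges: cutting the connection from both
    sides gives one edge on each, and two paths through the centre join them. At most [2 r + 2]
    edges are used, whereas the star may have exponentially many. *)
Lemma reaches_star_cut S w r x : reaches S (w :|: star (nball r x))%SET ->
  reaches S w \/ exists u1 e1 u2 e2,
   [/\ u1 \in nball r x, e1 \in star (nball r x), u2 \in nball r x,
       e2 \in star (nball r x) & reaches S (w :|: [set e in
         e1 :: e2 :: ball_path r x u1 ++ ball_path r x u2])%SET].
Proof.
move=> /'exists_andP[y [yS yN]].
have [wyN|[u2 [e2 [u2B e2B u2N]]]] := connect_star_cut yN.
  by left; apply/'exists_andP; exists y.
have Ny := yN; rewrite connect_linksC in Ny.
have [wNy|[u1 [e1 [u1B e1B u1y]]]] := connect_star_cut Ny.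
  by left; apply/'exists_andP; exists y; rewrite connect_linksC.
right; exists u1, e1, u2, e2; split => //; apply/'exists_andP; exists y; split => //.
have [_ _ c1] := ball_pathP u1B; have [_ _ c2] := ball_pathP u2B.
set W := (_ :|: _)%SET.
have sub (w' : {set E}) a b : {subset w' <= W} -> connect (links w') a b ->
    connect (links W) a b.
  by move=> w'W; apply: connect_links_sub; exact/fintype.subsetP.
apply: (@connect_trans _ _ (Some u1)).
  rewrite connect_linksC; apply: sub u1y => e; rewrite !inE.
  by move=> /orP[->|->]; rewrite ?orbT.
apply: (@connect_trans _ _ (Some x)).
  apply: sub c1 => e; rewrite !inE mem_cat => ->.
  by rewrite !orbT.
apply: (@connect_trans _ _ (Some u2)).
  rewrite connect_linksC; apply: sub c2 => e; rewrite !inE mem_cat => ->.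
  by rewrite !orbT.
by apply: sub u2N => e; rewrite !inE => /orP[->|->]; rewrite ?orbT.
Qed.

Section degree.
Variable D : nat.
Hypothesis degD : forall x, (#|[set e | touches e x]%SET| <= D)%N.

Lemma card_bigcup_le (T U : finType) (A : {set T}) (F : T -> {set U}) :
  (#|(\bigcup_(x in A) F x)%SET| <= \sum_(x in A) #|F x|)%N.
Proof.
apply: (big_ind2 (fun (B : {set U}) n => (#|B| <= n)%N)); rewrite ?cards0//.
by move=> B1 n1 B2 n2 h1 h2; apply: (leq_trans (leq_card_setU _ _)); exact: leq_add.
Qed.

Lemma card_star X : (#|star X| <= #|X| * D)%N.
Proof.
have -> : star X = (\bigcup_(x in X) [set e | touches e x])%SET.
  apply/finset.setP => e; rewrite inE; apply/'exists_andP/bigcupP => -[x].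
    by move=> [xX ex]; exists x; rewrite ?inE.
  by rewrite inE => xX ex; exists x.
apply: (leq_trans (card_bigcup_le _ _)).
by rewrite -sum_nat_const; apply: leq_sum.
Qed.

Lemma card_nadj x : (#|[set y | nadj x y]%SET| <= D)%N.
Proof.
pose o e : I := if src e == x then odflt x (tgt e) else src e.
apply: (leq_trans _ (degD x)); apply: (leq_trans _ (leq_imset_card o _)).
apply: subset_leq_card; apply/fintype.subsetP => y; rewrite inE => /existsP[e exy].
apply/imsetP; exists e; rewrite ?inE /touches /o.
  by move: exy => /orP[|] /andP[/eqP + /eqP]; [move=> [->] _|move=> _ <-];
    rewrite eqxx ?orbT.
move: exy => /orP[|] /andP[/eqP[<-] /eqP].
  by rewrite eqxx => <-.
by case: eqVneq => [->|//] <-.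
Qed.

Lemma card_nball r x : (#|nball r x| <= D.+1 ^ r)%N.
Proof.
elim: r => [|r ih]; first by rewrite cards1.
apply: (leq_trans (leq_card_setU _ _)); rewrite expnS mulSn leq_add//.
have -> : [set y | [exists z in nball r x, nadj z y]]%SET =
    (\bigcup_(z in nball r x) [set y | nadj z y])%SET.
  apply/finset.setP => y; rewrite inE; apply/'exists_andP/bigcupP => -[z].
    by move=> [zX ez]; exists z; rewrite ?inE.
  by rewrite inE => zX ez; exists z.
apply: (leq_trans (card_bigcup_le _ _)).
apply: (@leq_trans (\sum_(z in nball r x) D)); first by apply: leq_sum => z _; exact: card_nadj.
by rewrite sum_nat_const mulnC leq_mul.
Qed.

(** Balls are symmetric, so the centres lie in the two balls around the ends of [e]. This limits how
    many sprinklings affect one edge. *)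
Lemma card_star_ball_centers r e :
  (#|[set x | e \in star (nball r x)]%SET| <= 2 * D.+1 ^ r)%N.
Proof.
have sub : [set x | e \in star (nball r x)]%SET \subset
    (nball r (src e) :|: nball r (odflt (src e) (tgt e)))%SET.
  apply/fintype.subsetP => x; rewrite !inE => /'exists_andP[u [ux]].
  move=> /orP[/eqP ->|/eqP ->]; apply/orP; [left|right]; exact: nball_sym.
apply: (leq_trans (subset_leq_card sub)); apply: (leq_trans (leq_card_setU _ _)).
by rewrite mul2n -addnn leq_add// card_nball.
Qed.

End degree.

End network.

(** * The cost of opening all edges near a ball *)

Section open_star.
Variables (R : realType) (I E : finType) (src : E -> I) (tgt : E -> option I).
Variables (S : {set I}).
Local Notation nball := (nball src tgt).
Local Notation star := (star src tgt).

Definition reach_ind (w : {set E}) : R := (reaches src tgt S w)%:R.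

Definition open_near (p : E -> R) (X : {set I}) : R :=
  pmean p (fun w => reach_ind (w :|: star X)%SET).

Lemma increasing_reach_ind : increasing reach_ind.
Proof.
move=> w w' ww'; rewrite /reach_ind.
case: (boolP (reaches _ _ _ w)) => [|_]; last by rewrite ler0n.
by move=> /(reaches_sub ww') ->.
Qed.

Lemma reach_ind_01 w : 0 <= reach_ind w <= 1.
Proof. by rewrite /reach_ind; case: reaches; rewrite ?lexx ?ler01. Qed.

Lemma star_sub (X X' : {set I}) : X \subset X' -> star X \subset star X'.
Proof.
move=> /fintype.subsetP XX'; apply/fintype.subsetP => e; rewrite !inE.
by move=> /'exists_andP[x [/XX' xX ex]]; apply/'exists_andP; exists x.
Qed.

Lemma open_near_sub p (X X' : {set I}) : prob_param p -> X \subset X' ->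
  open_near p X <= open_near p X'.
Proof.
move=> p01 XX'; apply: le_pmean => // w; apply: increasing_reach_ind.
by apply: finset.setUS; exact: star_sub.
Qed.

Lemma open_near_le_param p p' X : prob_param p -> prob_param p' ->
  (forall e, p e <= p' e) -> open_near p X <= open_near p' X.
Proof.
move=> p01 p'01 pp'; apply: pmean_le_param => //.
by apply: increasing_addU; exact: increasing_reach_ind.
Qed.

Lemma open_near_01 p X : prob_param p -> 0 <= open_near p X <= 1.
Proof. by move=> p01; apply: pmean_bounds => // w; exact: reach_ind_01. Qed.

(** Union bound: by [reaches_star_cut], opening the star of the ball helps only if opening one of
    the lists [l v] does, and each of them costs the factor of [pmean_sprinkle] for [2 r + 2] edges.
    The first factor of the constant counts the indices [v], a vertex and an edge chosen twice. *)
Lemma open_near_ball (D : nat) p p' (delta : R) X r x :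
  (forall x, #|[set e | touches src tgt e x]%SET| <= D)%N ->
  prob_param p -> prob_param p' -> (forall e, 2^-1 <= p e <= p' e) ->
  0 < delta <= 1 ->
  (forall e, e \in star (nball r x) -> p e + delta * (1 - p e) <= p' e) ->
  open_near p (X :|: nball r x)%SET - open_near p X <=
  (D.+1 ^ r * (D.+1 ^ r * D) * (D.+1 ^ r * (D.+1 ^ r * D)))%N%:R *
    (2 ^+ (r.*2).+2 / delta) * (open_near p' X - open_near p X).
Proof.
move=> degD p01 p'01 pp' d01 p'B; have /andP[d0 d1] := d01.
pose B := nball r x; pose P := [set v : (I * E) * (I * E) |
  (v.1.1 \in B) && (v.1.2 \in star B) && ((v.2.1 \in B) && (v.2.2 \in star B))]%SET.
pose g w := reach_ind (w :|: star X)%SET.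
have incg : increasing g by apply: increasing_addU; exact: increasing_reach_ind.
pose l (v : (I * E) * (I * E)) : seq E :=
  v.1.2 :: v.2.2 :: ball_path src tgt r x v.1.1 ++ ball_path src tgt r x v.2.1.
have Pcard : (#|P| <= D.+1 ^ r * (D.+1 ^ r * D) * (D.+1 ^ r * (D.+1 ^ r * D)))%N.
  have -> : P = finset.setX (finset.setX B (star B)) (finset.setX B (star B)).
    by apply/finset.setP => -[[a b] [c d]]; rewrite !inE.
  have cB : (#|B| <= D.+1 ^ r)%N by exact: card_nball.
  have cS : (#|star B| <= D.+1 ^ r * D)%N.
    by apply: (leq_trans (card_star degD B)); rewrite leq_mul2r cB orbT.
  by rewrite !cardsX; do !apply: leq_mul.
have cut w : g (w :|: star B)%SET - g w <=
    \sum_(v in P) (g (w :|: [set e in l v])%SET - g w).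
  have ge0 v : 0 <= g (w :|: [set e in l v])%SET - g w.
    by rewrite subr_ge0; apply: incg; exact: finset.subsetUl.
  rewrite {1 2}/g /reach_ind; case: (boolP (reaches _ _ _ (_ :|: star X)%SET)); last first.
    move=> _; rewrite sub0r; apply: (@le_trans _ _ 0); first by rewrite oppr_le0.
    by apply: sumr_ge0.
  rewrite finset.setUAC => /reaches_star_cut[->|].
    by rewrite subrr; apply: sumr_ge0.
  move=> [u1 [e1 [u2 [e2 [u1B e1B u2B e2B h]]]]].
  rewrite (bigD1 ((u1, e1), (u2, e2)))/=; last by rewrite inE /= u1B e1B u2B e2B.
  apply: ler_wpDr; first by apply: sumr_ge0.
  by rewrite {1}/g /reach_ind finset.setUAC /l h.
have -> : open_near p (X :|: nball r x)%SET = pmean p (fun w => g (w :|: star B)%SET).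
  congr pmean; apply/funext => w; rewrite /g -/B; congr reach_ind.
  apply/finset.setP => e; rewrite !inE -orbA; congr (_ || _).
  apply/'exists_andP/orP => [[y []]|[|]].
  - by rewrite inE => /orP[yX|yB] ey; [right|left]; apply/'exists_andP; exists y.
  - by move=> /'exists_andP[y [yB ey]]; exists y; rewrite inE yB orbT.
  - by move=> /'exists_andP[y [yX ey]]; exists y; rewrite inE yX.
rewrite -[open_near p X]/(pmean p g) -[open_near p' X]/(pmean p' g).
rewrite -pmeanB; apply: (le_trans (le_pmean p01 cut)).
have -> : pmean p (fun w => \sum_(v in P) (g (w :|: [set e in l v])%SET - g w)) =
    \sum_(v <- enum P) (pmean p (fun w => g (w :|: [set e in l v])%SET) - pmean p g).
  under [in RHS]eq_bigr do rewrite -pmeanB.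
  by rewrite -pmean_sum; congr pmean; apply/funext => w; rewrite big_enum.
have mono0 : 0 <= pmean p' g - pmean p g.
  by rewrite subr_ge0; apply: pmean_le_param => // e; have /andP[] := pp' e.
apply: (@le_trans _ _ (\sum_(v <- enum P) (2 ^+ (r.*2).+2 / delta *
    (pmean p' g - pmean p g)))).
  rewrite big_seq [leRHS]big_seq; apply: ler_sum => v.
  rewrite mem_enum !inE => /andP[/andP[u1B e1B] /andP[u2B e2B]].
  have [s1 b1 _] := ball_pathP u1B; have [s2 b2 _] := ball_pathP u2B.
  apply: (@le_trans _ _ (2 ^+ size (l v) / delta * (pmean p' g - pmean p g))).
    apply: pmean_sprinkle => //; first by move=> e; have /andP[] := pp' e.
    move=> e; rewrite !inE mem_cat => eB; have /andP[pe _] := pp' e.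
    split => //; apply: p'B; move: eB.
    by move=> /orP[/eqP -> //|/orP[/eqP -> //|/orP[/b1|/b2]]]; rewrite ?inE.
  apply: ler_wpM2r => //; rewrite ler_pM2r ?invr_gt0//.
  apply: ler_weXn2l; first by rewrite ler1n.
  by rewrite /= size_cat !ltnS -addnn leq_add.
set a := 2 ^+ _ / delta; have a0 : 0 <= a by rewrite divr_ge0 ?exprn_ge0// ltW.
rewrite big_const_seq count_predT iter_addr_0 -cardE -[leLHS]mulr_natl -mulrA.
apply: ler_wpM2r; last by rewrite ler_nat.
by rewrite mulr_ge0.
Qed.

End open_star.

(** * Gaussian noise and the Harris inequality *)

Section gaussian_noise.
Variables (R : realType) (J : finType).
Implicit Types (w : J -> R) (D : pred J) (l : seq J).
Local Notation leb := (@lebesgue_measure R).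
Local Notation k := (@gauss_density R).
Local Open Scope ereal_scope.

Let k0 := @gauss_density_ge0 R.
Let mk := @measurable_gauss_density R.

Definition noise_mean (f : (J -> R) -> \bar R) := iint k (enum J) f (fun=> 0%R).

Lemma integral_gauss_cst (c : \bar R) : 0 <= c ->
  \int[leb]_t ((k t)%:E * c) = c.
Proof.
move=> c0; under eq_integral do rewrite muleC.
rewrite ge0_integralZl//= ?integral_gauss_density1 ?mule1//.
- exact/measurable_EFinP.
- by move=> t _; rewrite lee_fin.
Qed.

Lemma iint_gauss_cst l (c : \bar R) w : 0 <= c -> iint k l (fun=> c) w = c.
Proof.
move=> c0; elim: l w => //= i l ih w.
by under eq_integral do rewrite ih; exact: integral_gauss_cst.
Qed.

(** Opposite monotonicity gives [F s * G s + F t * G t <= F s * G t + G s * F t], which is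
    integrated in [t] and then in [s]. It is kept free of subtractions because the values are
    extended reals. *)
Lemma integral_chebyshev (F G : R -> \bar R) :
  measurable_fun setT F -> measurable_fun setT G ->
  (forall t, 0 <= F t <= 1) -> (forall t, 0 <= G t <= 1) ->
  (forall s t, (s <= t)%R -> F s <= F t) ->
  (forall s t, (s <= t)%R -> G t <= G s) ->
  \int[leb]_t ((k t)%:E * (F t * G t)) <=
  (\int[leb]_t ((k t)%:E * F t)) * (\int[leb]_t ((k t)%:E * G t)).
Proof.
move=> mF mG F01 G01 incF decG.
have F0 t : 0 <= F t by have /andP[] := F01 t.
have G0 t : 0 <= G t by have /andP[] := G01 t.
have mk' : measurable_fun setT (fun t => (k t)%:E) by exact/measurable_EFinP.
set A := \int[leb]_t ((k t)%:E * (F t * G t)).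
set a := \int[leb]_t ((k t)%:E * F t); set b := \int[leb]_t ((k t)%:E * G t).
have AE : A = \int[leb]_t ((k t)%:E * (F t * G t)) by [].
have aE : a = \int[leb]_t ((k t)%:E * F t) by [].
have bE : b = \int[leb]_t ((k t)%:E * G t) by [].
have A0 : 0 <= A by apply: integral_ge0 => t _; rewrite !mule_ge0// lee_fin.
have a0 : 0 <= a by apply: integral_ge0 => t _; rewrite mule_ge0// lee_fin.
have b0 : 0 <= b by apply: integral_ge0 => t _; rewrite mule_ge0// lee_fin.
clearbody A a b.
have mFG : measurable_fun setT (fun t => F t * G t) by exact: emeasurable_funM.
have mkFG : measurable_fun setT (fun t => (k t)%:E * (F t * G t)) by exact: emeasurable_funM.
have mkF : measurable_fun setT (fun t => (k t)%:E * F t) by exact: emeasurable_funM.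
have mkG : measurable_fun setT (fun t => (k t)%:E * G t) by exact: emeasurable_funM.
have Zl (c : \bar R) (H : R -> \bar R) : 0 <= c -> measurable_fun setT H ->
    (forall t, 0 <= H t) ->
    c * \int[leb]_t ((k t)%:E * H t) = \int[leb]_t ((k t)%:E * (c * H t)).
  move=> c0 mH H0; under [RHS]eq_integral do rewrite muleCA.
  rewrite ge0_integralZl//; first exact: emeasurable_funM.
  by move=> t _; rewrite mule_ge0// lee_fin.
have mZ (c : \bar R) (H : R -> \bar R) : measurable_fun setT H ->
    measurable_fun setT (fun t => (k t)%:E * (c * H t)).
  by move=> mH; apply: emeasurable_funM => //; apply: emeasurable_funM => //; try exact: measurable_cst.
have inner s : F s * G s + A <= F s * b + G s * a.
  have -> : F s * G s + A = \int[leb]_t ((k t)%:E * (F s * G s + F t * G t)).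
    rewrite -{1}(integral_gauss_cst (mule_ge0 (F0 s) (G0 s))) AE -ge0_integralD//=.
    - by apply: eq_integral => t _; rewrite ge0_muleDr ?mule_ge0//.
    - by move=> t _; rewrite !mule_ge0// lee_fin.
    - by apply: emeasurable_funM => //; exact: measurable_cst.
    - by move=> t _; rewrite !mule_ge0// lee_fin.
  have -> : F s * b + G s * a = \int[leb]_t ((k t)%:E * (F s * G t + G s * F t)).
    rewrite aE bE !Zl// -ge0_integralD//=.
    - by apply: eq_integral => t _; rewrite ge0_muleDr ?mule_ge0//.
    - by move=> t _; rewrite !mule_ge0// lee_fin.
    - exact: mZ.
    - by move=> t _; rewrite !mule_ge0// lee_fin.
    - exact: mZ.
  apply: ge0_le_integral => //=.
  - by move=> t _; rewrite mule_ge0 ?lee_fin// adde_ge0// mule_ge0.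
  - by apply: emeasurable_funM => //; apply: emeasurable_funD => //; try exact: measurable_cst.
  - apply: emeasurable_funM => //; apply: emeasurable_funD.
      by apply: emeasurable_funM => //; exact: measurable_cst.
    by apply: emeasurable_funM => //; exact: measurable_cst.
  - move=> t _; apply: lee_wpmul2l; first by rewrite lee_fin.
    have fin (c : \bar R) : 0 <= c <= 1 -> c = (fine c)%:E.
      move=> /andP[c0 c1]; rewrite fineK// ge0_fin_numE//.
      exact: le_lt_trans c1 (ltry 1).
    have := incF s t; have := incF t s; have := decG s t; have := decG t s.
    rewrite (fin _ (F01 s)) (fin _ (F01 t)) (fin _ (G01 s)) (fin _ (G01 t)).
    rewrite -!EFinM -!EFinD !lee_fin.
    move: (fine (F s)) (fine (F t)) (fine (G s)) (fine (G t)) => x y z u.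
    move=> d1 d2 i1 i2; rewrite -subr_ge0.
    have -> : (x * u + z * y - (x * z + y * u) = (y - x) * (z - u))%R by ring.
    have [st|/ltW ts] := leP s t.
      by rewrite mulr_ge0// subr_ge0; [exact: i2|exact: d2].
    by rewrite -mulrNN mulr_ge0// opprB subr_ge0; [exact: i1|exact: d1].
have : A + A <= a * b + a * b.
  have {1}-> : A + A = \int[leb]_s ((k s)%:E * (F s * G s + A)).
    rewrite -{2}(integral_gauss_cst A0) [X in X + _]AE -ge0_integralD//=.
    - apply: eq_integral => t _.
      by rewrite ge0_muleDr ?mule_ge0//.
    - by move=> t _; rewrite !mule_ge0// lee_fin.
    - by move=> t _; rewrite !mule_ge0// lee_fin.
    - by apply: emeasurable_funM => //; try exact: measurable_cst.
  have -> : a * b + a * b = \int[leb]_s ((k s)%:E * (F s * b + G s * a)).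
    rewrite {1}[a * b]muleC {1}aE [X in _ + a * X]bE !Zl// -ge0_integralD//=.
    - by apply: eq_integral => t _; rewrite ge0_muleDr ?mule_ge0// (muleC b) (muleC a).
    - by move=> t _; rewrite !mule_ge0// lee_fin.
    - exact: mZ.
    - by move=> t _; rewrite !mule_ge0// lee_fin.
    - exact: mZ.
  apply: ge0_le_integral => //=.
  - by move=> t _; rewrite mule_ge0 ?lee_fin// adde_ge0// mule_ge0.
  - by apply: emeasurable_funM => //; apply: emeasurable_funD => //; try exact: measurable_cst.
  - apply: emeasurable_funM => //; apply: emeasurable_funD.
      by apply: emeasurable_funM => //; exact: measurable_cst.
    by apply: emeasurable_funM => //; exact: measurable_cst.
  - by move=> t _; apply: lee_wpmul2l; rewrite ?lee_fin.
have tw (c : \bar R) : 0 <= c -> c + c = 2%:E * c.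
  by move=> c0; rewrite -[2%R]/(1 + 1)%R EFinD ge0_muleDl ?mul1e ?lee_fin.
by rewrite !tw ?mule_ge0// lee_pmul2l// lte_fin.
Qed.

Definition noise_dep D (f : (J -> R) -> \bar R) :=
  forall w w', (forall j, D j -> w j = w' j) -> f w = f w'.
Definition noise_incr (f : (J -> R) -> \bar R) :=
  forall w w', (forall j, (w j <= w' j)%R) -> f w <= f w'.
(** Monotone in the coordinates of [D] only, the others being held fixed. In the Harris inequality
    this is enough against an increasing function that depends on [D] alone. *)
Definition noise_decr D (f : (J -> R) -> \bar R) :=
  forall w w', (forall j, (w j <= w' j)%R) ->
    (forall j, ~~ D j -> w j = w' j) -> f w' <= f w.

Lemma iint_01 l f : coord_measurable f -> (forall w, 0 <= f w <= 1) ->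
  forall w, 0 <= iint k l f w <= 1.
Proof.
move=> mf f01 w; have f0 w' : 0 <= f w' by have /andP[] := f01 w'.
rewrite iint_ge0//= -[leRHS](@iint_gauss_cst l 1 w)//; apply: le_iint => //.
  exact: coord_measurable_cst.
by move=> w'; have /andP[] := f01 w'.
Qed.

Lemma iint_dep D l f : noise_dep D f -> noise_dep D (iint k l f).
Proof.
move=> fD; elim: l => //= i l ih w w' ww'; apply: eq_integral => t _.
congr (_ * _); apply: ih => j Dj; rewrite /update; case: eqVneq => // _.
exact: ww'.
Qed.

Lemma iint_incr l f : (forall w, 0 <= f w) -> coord_measurable f ->
  noise_incr f -> noise_incr (iint k l f).
Proof.
move=> f0 mf incf; elim: l => //= i l ih w w' ww'; apply: ge0_le_integral => //=.
- by move=> t _; rewrite mule_ge0// ?lee_fin// iint_ge0.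
- by apply: measurable_kernel => //; exact: coord_measurable_iint.
- by apply: measurable_kernel => //; exact: coord_measurable_iint.
- move=> t _; apply: lee_wpmul2l; rewrite ?lee_fin//; apply: ih => j.
  by rewrite /update; case: eqVneq.
Qed.

Lemma iint_decr D l f : (forall w, 0 <= f w) -> coord_measurable f ->
  noise_decr D f -> noise_decr D (iint k l f).
Proof.
move=> f0 mf decf; elim: l => //= i l ih w w' ww' Dw; apply: ge0_le_integral => //=.
- by move=> t _; rewrite mule_ge0// ?lee_fin// iint_ge0.
- by apply: measurable_kernel => //; exact: coord_measurable_iint.
- by apply: measurable_kernel => //; exact: coord_measurable_iint.
- move=> t _; apply: lee_wpmul2l; rewrite ?lee_fin//; apply: ih => j.
    by rewrite /update; case: eqVneq.
  by move=> Dj; rewrite /update; case: eqVneq => // _; exact: Dw.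
Qed.

Lemma coord_measurable_emul (f g : (J -> R) -> \bar R) :
  coord_measurable f -> coord_measurable g ->
  coord_measurable (fun w => f w * g w).
Proof.
by move=> mf mg d T h mh; apply: emeasurable_funM; [exact: mf|exact: mg].
Qed.

(** One coordinate at a time: in [D], Chebyshev's inequality applies to the partial integrals, which
    inherit monotonicity; outside [D], the first factor is constant and leaves the integral. *)
Lemma iint_harris D l f g : coord_measurable f -> coord_measurable g ->
  (forall w, 0 <= f w <= 1) -> (forall w, 0 <= g w <= 1) ->
  noise_dep D f -> noise_incr f -> noise_decr D g ->
  forall w, iint k l (fun w => f w * g w) w <= iint k l f w * iint k l g w.
Proof.
move=> mf mg f01 g01 fD incf decg.
have f0 w' : 0 <= f w' by have /andP[] := f01 w'.
have g0 w' : 0 <= g w' by have /andP[] := g01 w'.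
have mfg := coord_measurable_emul mf mg.
have mI h l' : (forall w, 0 <= h w) -> coord_measurable h -> forall w i,
    measurable_fun setT (fun t => iint k l' h (update w i t)).
  by move=> h0 mh w i; apply: measurable_update; exact: coord_measurable_iint.
elim: l => //= i l ih w.
apply: (@le_trans _ _ (\int[leb]_t ((k t)%:E *
    (iint k l f (update w i t) * iint k l g (update w i t))))).
  apply: ge0_le_integral => //=.
  - by move=> t _; rewrite mule_ge0// ?lee_fin// iint_ge0// => w'; rewrite mule_ge0.
  - apply: measurable_kernel => //; apply: coord_measurable_iint => // w'.
    by rewrite mule_ge0.
  - apply: emeasurable_funM; first exact/measurable_EFinP.
    by apply: emeasurable_funM; exact: mI.
  - by move=> t _; apply: lee_wpmul2l; rewrite ?lee_fin.
have [Di|Di] := boolP (D i).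
  apply: integral_chebyshev; try exact: mI; try by move=> t; exact: iint_01.
    move=> s t st; apply: iint_incr => // j.
    by rewrite /update; case: eqVneq.
  move=> s t st; apply: iint_decr decg _ _ _ _ => //.
    by move=> j; rewrite /update; case: eqVneq.
  by move=> j Dj; rewrite /update; case: eqVneq => // ji; rewrite ji Di in Dj.
have fw t : iint k l f (update w i t) = iint k l f w.
  apply: iint_dep fD _ _ _ => j Dj; rewrite /update.
  by case: eqVneq => // ji; rewrite -ji Dj in Di.
under eq_integral do rewrite fw muleCA.
under [X in _ <= X * _]eq_integral do rewrite fw.
rewrite integral_gauss_cst ?iint_ge0// ge0_integralZl//= ?iint_ge0//.
- by apply: emeasurable_funM; [exact/measurable_EFinP|exact: mI].
- by move=> t _; rewrite mule_ge0 ?lee_fin// iint_ge0.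
Qed.

(** Chernoff's bound; [lam = eps / sigma2] minimizes [lam ^+ 2 * sigma2 / 2 - lam * eps]. *)
Lemma noise_mean_tail (v : J -> R) (eps sigma2 : R) : (0 < eps)%R -> (0 < sigma2)%R ->
  (\sum_j v j ^+ 2 <= sigma2)%R ->
  noise_mean (fun w => (eps < \sum_j w j * v j)%R%:R%:E) <=
  (expR (- (eps ^+ 2 / (2 * sigma2))))%:E.
Proof.
move=> e0 s0 vs; pose lam := (eps / sigma2)%R.
have mS : coord_measurable (fun w => \sum_j w j * v j)%R.
  apply: coord_measurable_sum => j; apply: coord_measurableM.
    exact: coord_measurable_proj.
  exact: coord_measurable_cst.
have l0 : (0 < lam)%R by rewrite divr_gt0.
apply: (@le_trans _ _ (noise_mean (fun w =>
    (expR (- (lam * eps)))%:E * (\prod_(j <- enum J) expR (lam * v j * w j))%R%:E))).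
  apply: le_iint => //.
  - apply: coord_measurable_EFin; apply: coord_measurable_bool.
    by apply: coord_measurable_lt => //; exact: coord_measurable_cst.
  - apply: coord_measurable_emul; first exact: coord_measurable_cst.
    apply: coord_measurable_EFin; apply: coord_measurable_prod => j.
    apply: coord_measurable_expR; apply: coord_measurableM.
      exact: coord_measurable_cst.
    exact: coord_measurable_proj.
  - move=> w; rewrite -EFinM lee_fin -expR_sum -expRD big_enum/=.
    case: ltP => [lt|_] /=; last exact: expR_ge0.
    rewrite -[leLHS]expR0 ler_expR.
    under eq_bigr do rewrite -mulrA (mulrC (v _)).
    by rewrite -mulr_sumr addrC -mulrBr mulr_ge0 ?(ltW l0)// subr_ge0 ltW.
rewrite /noise_mean iintZ ?expR_ge0//; last 2 first.
- by move=> w; rewrite lee_fin prodr_ge0// => j _; exact: expR_ge0.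
- apply: coord_measurable_EFin; apply: coord_measurable_prod => j.
  apply: coord_measurable_expR; apply: coord_measurableM.
    exact: coord_measurable_cst.
  exact: coord_measurable_proj.
rewrite (@iint_prod _ _ k _ (fun j t => expR (lam * v j * t)))//; last 2 first.
- by move=> j; apply: measurableT_comp => //; exact: measurable_funM.
- exact: enum_uniq.
rewrite (eq_bigr (fun j => (expR ((lam * v j) ^+ 2 / 2))%:E)); last first.
  move=> j _; have := @integral_gauss_density R 0 (lam * v j) (lexx _).
  rewrite addr0 sqrtr1 invr1 mul1r mulr1 => <-; apply: eq_integral => t _.
  by rewrite !mul0r oppr0 add0r.
rewrite prodEFin -EFinM lee_fin -expR_sum -expRD big_enum/= ler_expR.
under eq_bigr do rewrite exprMn -mulrA.
rewrite -mulr_sumr -mulr_suml.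
apply: (@le_trans _ _ (- (lam * eps) + lam ^+ 2 * (sigma2 / 2)))%R.
  by rewrite lerD2l ler_wpM2l ?sqr_ge0// ler_pM2r.
by rewrite le_eqVlt; apply/orP; left; apply/eqP; rewrite /lam; field; rewrite gt_eqF.
Qed.

End gaussian_noise.

(** * Trading bad vertices for sprinkling *)

Section removal.
Variables (R : realType) (I E : finType) (src : E -> I) (tgt : E -> option I).
Variables (S : {set I}) (J K : finType).
Variables (ctr : K -> I) (rad : K -> nat) (v : K -> J -> R) (eps delta bnd : K -> R).
Local Notation nball := (nball src tgt).
Local Notation star := (star src tgt).
Local Notation open_near := (@open_near R I E src tgt S).
Implicit Types (w : J -> R) (l : seq K) (i : K).

Definition bad i w : bool := eps i < \sum_j w j * v i j.

Definition badset l w : {set I} := [set x | has (fun i => bad i w && (ctr i == x)) l]%SET.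

Definition sprinkled (p : E -> R) i : E -> R := fun e =>
  if e \in star (nball (rad i) (ctr i)) then p e + delta i * (1 - p e) else p e.

Lemma coord_measurable_bad i : coord_measurable (bad i).
Proof.
apply: coord_measurable_lt; first exact: coord_measurable_cst.
apply: coord_measurable_sum => j; apply: coord_measurableM.
  exact: coord_measurable_proj.
exact: coord_measurable_cst.
Qed.

(** A function of a random subset of a finite type is a finite combination of the indicators that
    the subset equals [X], and equality is tested element by element. *)
Lemma coord_measurable_finset (F : (J -> R) -> {set I}) (g : {set I} -> R) :
  (forall x, coord_measurable (fun w => x \in F w)) ->
  coord_measurable (fun w => g (F w)).
Proof.
move=> mF.
rewrite (_ : (fun w => _) = fun w => \sum_(X <- enum {set I})
    g X * (if has (fun x => (x \in F w) != (x \in X)) (enum I) then 0 else 1)).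
  apply: coord_measurable_sum => X; apply: coord_measurableM.
    exact: coord_measurable_cst.
  apply: coord_measurable_if; [|exact: coord_measurable_cst|exact: coord_measurable_cst].
  apply: coord_measurable_or => x.
  rewrite (_ : (fun w => _) = fun w => if x \in F w then x \notin X else x \in X).
    by apply: coord_measurable_if => //; exact: coord_measurable_cst.
  by apply/funext => w; case: (x \in F w); case: (x \in X).
apply/funext => w; rewrite big_enum/= (bigD1 (F w))//=.
rewrite big1 => [|X XF].
  by rewrite addr0; case: hasP => [[x _]|_]; rewrite ?eqxx// mulr1.
case: hasP => [_|nx]; first by rewrite mulr0.
exfalso; move/eqP: XF; apply; apply/finset.setP => x; apply/esym/eqP.
by apply: contrapT => /negP xX; apply: nx; exists x; rewrite ?mem_enum.
Qed.

Lemma coord_measurable_open_near p l (B : {set I}) :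
  coord_measurable (fun w => open_near p (badset l w :|: B)%SET).
Proof.
apply: (@coord_measurable_finset _ (open_near p)) => x.
rewrite (_ : (fun w => _) = fun w => if has (fun i => bad i w && (ctr i == x)) l
    then true else x \in B).
  apply: coord_measurable_if; [|exact: coord_measurable_cst|exact: coord_measurable_cst].
  apply: coord_measurable_or => i.
  rewrite (_ : (fun w => _) = fun w => if bad i w then ctr i == x else false).
    apply: coord_measurable_if; [|exact: coord_measurable_cst|exact: coord_measurable_cst].
    exact: coord_measurable_bad.
  by apply/funext => w; case: (bad i w).
by apply/funext => w; rewrite !inE; case: has.
Qed.

Hypothesis v_ge0 : forall i j, 0 <= v i j.
Hypothesis v_near : forall i i' j, v i j != 0 -> v i' j != 0 ->
  ctr i' \in nball (rad i) (ctr i).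
Hypothesis delta01 : forall i, 0 < delta i <= 1.
Hypothesis bad_rare : forall i,
  (noise_mean (fun w => (bad i w)%:R%:E) <= (bnd i)%:E)%E.
Variable D : nat.
Hypothesis degD : forall x, (#|[set e | touches src tgt e x]%SET| <= D)%N.
Hypothesis bnd_small : forall i, bnd i *
  ((D.+1 ^ rad i * (D.+1 ^ rad i * D) * (D.+1 ^ rad i * (D.+1 ^ rad i * D)))%N%:R *
    (2 ^+ ((rad i).*2).+2 / delta i)) <= 1.

Lemma bad_incr i w w' : (forall j, w j <= w' j) -> bad i w -> bad i w'.
Proof.
move=> ww' /lt_le_trans; apply; apply: ler_sum => j _; exact: ler_wpM2r.
Qed.

Lemma badset_incr l w w' : (forall j, w j <= w' j) -> badset l w \subset badset l w'.
Proof.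
move=> ww'; apply/fintype.subsetP => x; rewrite !inE.
by apply: sub_has => i /andP[/(bad_incr ww') -> ->].
Qed.

Lemma sprinkled_param p i : prob_param p -> (forall e, 2^-1 <= p e) ->
  prob_param (sprinkled p i) /\ (forall e, 2^-1 <= p e <= sprinkled p i e).
Proof.
move=> p01 ph; have /andP[d0 d1] := delta01 i.
have h e : p e <= sprinkled p i e <= 1.
  have /andP[p0 p1] := p01 e; rewrite /sprinkled; case: ifP => _; last by rewrite lexx.
  rewrite lerDl mulr_ge0 ?subr_ge0 ?(ltW d0)//=.
  rewrite -lerBrDl ler_piMl ?subr_ge0//.
split=> e; have /andP[h1 h2] := h e; rewrite ?ph//= h2 andbT.
by apply: le_trans h1; have /andP[] := p01 e.
Qed.

(** The indices are removed one by one. If [i] is bad, opening everything near its ball [B] gains at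
    most [h]. Harris separates the bad event from [h], [open_near_ball] bounds [h] by a constant
    times the gain [g] of sprinkling, and [bnd_small] makes the product at most [g]. The sprinkled
    parameter then serves as the base for the remaining indices. *)
Lemma remove_bad l p : prob_param p -> (forall e, 2^-1 <= p e) ->
  (noise_mean (fun w => (open_near p (badset l w))%:E) <=
   (open_near (foldl sprinkled p l) finset.set0)%:E)%E.
Proof.
elim: l p => [|i l ih] p p01 ph.
  rewrite /= (_ : (fun w => _) = fun=> (open_near p finset.set0)%:E).
    rewrite /noise_mean iint_gauss_cst// lee_fin.
    by have /andP[] := open_near_01 src tgt S finset.set0 p01.
  by apply/funext => w.
have [p'01 pp'] := sprinkled_param i p01 ph.
set p' := sprinkled p i in p'01 pp' *.
have p'h e : 2^-1 <= p' e by have /andP[h1] := pp' e; exact: le_trans.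
apply: le_trans (ih p' p'01 p'h).
pose B := nball (rad i) (ctr i).
have badU (q : E -> R) l' : (fun w => open_near q (badset l' w)) =
    fun w => open_near q (badset l' w :|: finset.set0)%SET.
  by apply/funext => w; rewrite finset.setU0.
have mo q l' : coord_measurable (fun w => (open_near q (badset l' w))%:E).
  apply: coord_measurable_EFin; rewrite badU; exact: coord_measurable_open_near.
have o0 q X : prob_param q -> 0 <= open_near q X.
  by move=> q01; have /andP[] := open_near_01 src tgt S X q01.
pose h w := open_near p (badset l w :|: B)%SET - open_near p (badset l w).
have h01 w : 0 <= h w <= 1.
  rewrite subr_ge0 open_near_sub ?finset.subsetUl//=.
  have /andP[_ h1] := open_near_01 src tgt S (badset l w :|: B)%SET p01.
  by apply: le_trans h1; rewrite gerBl o0.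
have mh : coord_measurable (fun w => (h w)%:E).
  apply: coord_measurable_EFin; apply: coord_measurableD.
    exact: coord_measurable_open_near.
  apply: coord_measurableN; rewrite badU; exact: coord_measurable_open_near.
pose f w : R := (bad i w)%:R.
have mf : coord_measurable (fun w => (f w)%:E).
  apply: coord_measurable_EFin; apply: coord_measurable_bool.
  exact: coord_measurable_bad.
have f01 w : 0 <= f w <= 1 by rewrite /f; case: bad; rewrite ?lexx ?ler01.
have step1 w : open_near p (badset (i :: l) w) <= open_near p (badset l w) + f w * h w.
  rewrite /f; case: (boolP (bad i w)) => bi.
    rewrite mul1r /h addrC subrK; apply: open_near_sub => //.
    apply/fintype.subsetP => x; rewrite !inE /= => /orP[|->//].
    by move=> /andP[_ /eqP <-]; rewrite nball_center orbT.
  rewrite mul0r addr0; apply: open_near_sub => //.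
  by apply/fintype.subsetP => x; rewrite !inE /= (negbTE bi).
pose g w := open_near p' (badset l w) - open_near p (badset l w).
have g0 w : 0 <= g w.
  rewrite subr_ge0; apply: open_near_le_param => // e.
  by have /andP[] := pp' e.
have mg : coord_measurable (fun w => (g w)%:E).
  apply: coord_measurable_EFin; apply: coord_measurableD.
    rewrite badU; exact: coord_measurable_open_near.
  apply: coord_measurableN; rewrite badU; exact: coord_measurable_open_near.
have k0 := @gauss_density_ge0 R.
have mk := @measurable_gauss_density R.
apply: (@le_trans _ _ (noise_mean (fun w => (open_near p (badset l w))%:E +
    (f w)%:E * (h w)%:E)%E)).
  apply: le_iint => //.
  - by move=> w; rewrite lee_fin o0.
  - move=> d T u mu; apply: emeasurable_funD; first exact: mo.
    by apply: emeasurable_funM; [exact: mf|exact: mh].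
rewrite /noise_mean iintD//; last 3 first.
- by move=> w; rewrite lee_fin o0.
- move=> w; have /andP[f0 _] := f01 w; have /andP[h0 _] := h01 w.
  by rewrite -EFinM lee_fin mulr_ge0.
- exact: coord_measurable_emul.
set Eo := iint _ _ (fun w => (open_near p (badset l w))%:E) _.
have -> : iint (@gauss_density R) (enum J) (fun w => (open_near p' (badset l w))%:E)
    (fun=> 0%R) = (Eo + iint (@gauss_density R) (enum J) (fun w => (g w)%:E) (fun=> 0%R))%E.
  rewrite -iintD//.
  - congr (iint _ _ _ _); apply/funext => w.
    by rewrite -EFinD /g addrC subrK.
  - by move=> w; rewrite lee_fin o0.
apply: leeD2l.
set Eg := iint _ _ (fun w => (g w)%:E) _.
have Eg0 : (0 <= Eg)%E by apply: iint_ge0 => // w; rewrite lee_fin.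
pose c : R := (D.+1 ^ rad i * (D.+1 ^ rad i * D) * (D.+1 ^ rad i * (D.+1 ^ rad i * D)))%N%:R *
    (2 ^+ ((rad i).*2).+2 / delta i).
have /andP[d0 d1] := delta01 i.
have c0 : 0 <= c by rewrite mulr_ge0// divr_ge0 ?exprn_ge0// ltW.
apply: (@le_trans _ _ (iint (@gauss_density R) (enum J) (fun w => (f w)%:E) (fun=> 0%R) *
    iint (@gauss_density R) (enum J) (fun w => (h w)%:E) (fun=> 0%R))%E).
  have f01e w : (0 <= (f w)%:E <= 1)%E by rewrite !lee_fin; exact: f01.
  have h01e w : (0 <= (h w)%:E <= 1)%E by rewrite !lee_fin; exact: h01.
  apply: (iint_harris (D := fun j => v i j != 0) (enum J) mf mh f01e h01e).
  - move=> w w' ww'; rewrite /f /bad.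
    congr ((nat_of_bool (eps i < _))%:R)%:E; apply: eq_bigr => j _.
    by have [->|vj] := eqVneq (v i j) 0; rewrite ?mulr0// ww'.
  - move=> w w' ww'; rewrite lee_fin /f.
    by case: (boolP (bad i w)) => [/(bad_incr ww') ->//|_]; rewrite ler0n.
  (* Raising the noises seen by [i] can make bad only vertices that share a noise with [i]. These
     lie in [B], so the first term of [h] does not increase, while the subtracted term does not
     decrease. *)
  - move=> w w' ww' Dw; rewrite lee_fin /h; apply: lerB; last first.
      by apply: open_near_sub => //; exact: badset_incr.
    apply: open_near_sub => //; apply/fintype.subsetP => x; rewrite !inE.
    move=> /orP[/hasP[i' i'l /andP[bi' /eqP xi']]|->]; last by rewrite orbT.
    have [xB|xB] := boolP (x \in B); first by rewrite orbT.
    rewrite orbF; apply/hasP; exists i' => //; rewrite -xi' eqxx andbT.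
    move: bi'; rewrite /bad; suff -> : \sum_j w' j * v i' j = \sum_j w j * v i' j by [].
    apply: eq_bigr => j _; have [->|vi'j] := eqVneq (v i' j) 0; first by rewrite !mulr0.
    have [vij|vij] := eqVneq (v i j) 0; first by rewrite Dw// vij eqxx.
    by move: xB; rewrite -xi' (v_near vij vi'j).
have Eh : (iint (@gauss_density R) (enum J) (fun w => (h w)%:E) (fun=> 0%R) <= c%:E * Eg)%E.
  rewrite /Eg -iintZ//; apply: le_iint => //.
  - by move=> w; rewrite lee_fin; have /andP[] := h01 w.
  - by apply: coord_measurable_emul => //; exact: coord_measurable_cst.
  - move=> w; rewrite -EFinM lee_fin /h /g /c /B.
    apply: open_near_ball => // e eB.
    by rewrite /p' /sprinkled eB.
have b0 : 0 <= bnd i.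
  rewrite -lee_fin; apply: le_trans (bad_rare i).
  by apply: iint_ge0 => // w; rewrite lee_fin ler0n.
apply: (@le_trans _ _ ((bnd i)%:E * (c%:E * Eg))%E).
  apply: lee_pmul => //.
  - by apply: iint_ge0 => // w; rewrite lee_fin ler0n.
  - by apply: iint_ge0 => // w; rewrite lee_fin; have /andP[] := h01 w.
  - exact: bad_rare.
rewrite muleA -EFinM -[leRHS]mul1e; apply: lee_wpmul2r => //.
by rewrite lee_fin.
Qed.

End removal.

(** * Splitting a Gaussian field into independent noises *)

Section noise_chain.
Variables (R : realType) (I J : finType).
Implicit Types (Q C : I -> I -> R) (x : I -> R) (l : seq J).
Local Notation leb := (@lebesgue_measure R).
Local Notation gk := (@gauss_density R).

Definition mutual_inverse Q C :=
  (forall x, mv Q (mv C x) = x) /\ (forall x, mv C (mv Q x) = x).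

Lemma inverse_symmetric Q C : mutual_inverse Q C -> symmetric_kernel C ->
  symmetric_kernel Q.
Proof.
move=> [QC CQ] sC i j.
have e (Q' : I -> I -> R) a b : Q' a b = dot (unit_vector R a) (mv Q' (unit_vector R b)).
  by rewrite dotC dot_unit mv_unit.
rewrite [LHS]e [RHS]e -{1}(CQ (unit_vector R i)) -dot_mvC// CQ.
exact: dotC.
Qed.

Lemma inverse_psd Q C x : mutual_inverse Q C -> symmetric_kernel C -> psd C ->
  0 <= dot x (mv Q x).
Proof. by move=> [QC CQ] sC pC; rewrite -{1}(CQ x) dotC. Qed.

(** The Sherman-Morrison formula, checked on vectors by expanding both compositions. *)
Lemma rank_one_inverse Q C (v : I -> R) : mutual_inverse Q C -> symmetric_kernel Q ->
  0 <= dot v (mv Q v) ->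
  mutual_inverse (fun i j => Q i j - mv Q v i * mv Q v j / (1 + dot v (mv Q v)))
    (fun i j => C i j + v i * v j).
Proof.
move=> [QC CQ] sQ v0; set s := 1 + _; have s1 : s != 0 by rewrite gt_eqF// ltr_pwDl.
have QE x : mv (fun i j => Q i j - mv Q v i * mv Q v j / s) x =
    fun i => mv Q x i + (- (dot (mv Q v) x / s)) * mv Q v i.
  apply/funext => i; rewrite {1}/mv.
  under eq_bigr do rewrite mulrBl.
  rewrite sumrB mulNr; congr (_ - _); rewrite /dot !mulr_suml.
  by apply: eq_bigr => j _; ring.
have CE x : mv (fun i j => C i j + v i * v j) x = fun i => mv C x i + dot v x * v i.
  apply/funext => i; rewrite {1}/mv.
  under eq_bigr do rewrite mulrDl.
  rewrite big_split /=; congr (_ + _); rewrite /dot mulr_suml.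
  by apply: eq_bigr => j _; ring.
split=> x.
- rewrite QE CE mvD mvZ QC; apply/funext => i.
  rewrite dotDr dotZr -dot_mvC// QC.
  have -> : dot (mv Q v) v = s - 1 by rewrite /s dotC addrC addKr.
  by field.
- rewrite CE QE mvD mvZ !CQ; apply/funext => i.
  rewrite dotDr dotZr [dot v (mv Q x)]dot_mvC//.
  have -> : dot v (mv Q v) = s - 1 by rewrite /s addrC addKr.
  by field.
Qed.

(** Each noise is absorbed by one rank-one update of the covariance. The constant [c] gathers the
    square roots from [lebint_rank_one]; it need not be evaluated, since the identity at [f = 1]
    determines it. *)
Lemma noise_chain (v : J -> I -> R) l QR CR : mutual_inverse QR CR ->
  symmetric_kernel CR -> psd CR -> uniq l ->
  exists Q, [/\ mutual_inverse Q (fun i i' => CR i i' + \sum_(j <- l) v j i * v j i'),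
    symmetric_kernel Q, (forall x, 0 <= dot x (mv Q x)) &
    exists2 c : R, 0 <= c & forall f : (I -> R) -> \bar R,
      (forall x, 0 <= f x)%E -> coord_measurable f ->
      lebint (fun x => (rho Q x)%:E * f x)%E =
      (c%:E * lebint (fun x => (rho QR x)%:E *
        iint gk l (fun w => f (fun i => (x i + \sum_(j <- l) w j * v j i)%R)) (fun=> 0%R)))%E].
Proof.
move=> QCR sCR pCR; elim: l => [_|j l ih /= /andP[jl ul]].
  exists QR; split => //.
  - rewrite (_ : (fun i i' => _) = CR)//.
    by apply/funext => i; apply/funext => i'; rewrite big_nil addr0.
  - exact: inverse_symmetric QCR sCR.
  - by move=> x; exact: inverse_psd QCR sCR pCR.
  - exists 1 => // f f0 mf; rewrite mul1e; congr lebint; apply/funext => x.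
    congr (_ * f _)%E; apply/funext => i; by rewrite big_nil addr0.
have [Q [QC sQ pQ [c c0 cE]]] := ih ul.
set s := 1 + dot (v j) (mv Q (v j)).
pose Q' i i' := Q i i' - mv Q (v j) i * mv Q (v j) i' / s.
have QC' := rank_one_inverse QC sQ (pQ (v j)).
pose C' i i' := CR i i' + \sum_(j <- j :: l) v j i * v j i'.
have C'E : C' = (fun i i' => CR i i' + \sum_(j <- l) v j i * v j i' + v j i * v j i').
  by apply/funext => i; apply/funext => i'; rewrite /C' big_cons [v j i * _ + _]addrC addrA.
have sC' : symmetric_kernel C'.
  move=> i i'; rewrite /C' sCR; congr (_ + _); apply: eq_bigr => a _; exact: mulrC.
have pC' : psd C'.
  move=> x; rewrite (_ : mv C' x = fun i => mv CR x i +
      \sum_(j <- j :: l) dot (v j) x * v j i).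
    rewrite dotDr addr_ge0// {1}/dot.
    under eq_bigr do rewrite mulr_sumr.
    rewrite exchange_big/=; apply: sumr_ge0 => a _.
    rewrite (_ : \sum_i _ = dot (v a) x ^+ 2) ?sqr_ge0//.
    rewrite expr2 [in X in X * _]/dot mulr_suml; apply: eq_bigr => i _; ring.
  apply/funext => i; rewrite {1}/mv /C'.
  under eq_bigr do rewrite mulrDl.
  rewrite big_split/=; congr (_ + _).
  under eq_bigr do rewrite mulr_suml.
  rewrite exchange_big/=; apply: eq_bigr => a _; rewrite /dot mulr_suml.
  by apply: eq_bigr => i' _; ring.
have QC'' : mutual_inverse Q' C' by rewrite C'E.
exists Q'; split => //.
- exact: inverse_symmetric QC'' sC'.
- by move=> x; exact: inverse_psd QC'' sC' pC'.
exists (Num.sqrt s * c); first by rewrite mulr_ge0// sqrtr_ge0.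
move=> f f0 mf; rewrite lebint_rank_one//.
pose f1 x := (\int[leb]_t ((gk t)%:E * f (fun i => (x i + t * v j i)%R)))%E.
have mfs (u : J -> I -> R) d (T : measurableType d) (g : T -> I -> R) (h : T -> R)
    (r : T -> J -> R) (l' : seq J) :
    measurable_fun setT h -> (forall i, measurable_fun setT (g ^~ i)) ->
    (forall i, measurable_fun setT (r ^~ i)) ->
    measurable_fun setT (fun t => f (fun i => (g t i + \sum_(j <- l') r t j * v j i) + h t * v j i)).
  move=> mh mg mr; apply: (mf _ _ (fun t i => (g t i + \sum_(j <- l') r t j * v j i) + h t * v j i)) => i.
  apply: measurable_funD; last exact: measurable_funM.
  apply: measurable_funD => //; apply: measurable_sum => a.
  exact: measurable_funM.
have f10 x : (0 <= f1 x)%E.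
  by apply: integral_ge0 => t _; rewrite mule_ge0// lee_fin gauss_density_ge0.
have mf1 : coord_measurable f1.
  move=> d T g mg.
  pose F (z : T * measurableTypeR R) :=
    ((gk z.2)%:E * f (fun i => (g z.1 i + z.2 * v j i)%R))%E.
  have mF : measurable_fun setT F.
    apply: emeasurable_funM.
      apply/measurable_EFinP.
      exact: (measurableT_comp (@measurable_gauss_density R) measurable_snd).
    apply: (mf _ _ (fun (z : T * measurableTypeR R) i => g z.1 i + z.2 * v j i)) => i.
    apply: measurable_funD; first exact: (measurableT_comp (mg i) measurable_fst).
    by apply: measurable_funM; [exact: measurable_snd|exact: measurable_cst].
  apply: (@measurable_fun_fubini_tonelli_F _ _ _ _ R leb F mF).
  by move=> z; rewrite mule_ge0// lee_fin gauss_density_ge0.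
rewrite -/s cE// muleA -EFinM; congr (_ * _)%E; congr lebint; apply/funext => x.
congr (_ * _)%E; rewrite /f1 /= -(@iint_swap _ _ gk gk l
  (fun t w => f (fun i => (x i + \sum_(j <- l) w j * v j i) + t * v j i)))//; last 5 first.
- exact: gauss_density_ge0.
- exact: measurable_gauss_density.
- exact: gauss_density_ge0.
- exact: measurable_gauss_density.
- by move=> d T h g mh mg; apply: (mfs v _ _ (fun=> x) h g l) => // i; exact: measurable_cst.
apply: eq_integral => t _.
apply: (congr1 (fun z => (gk t)%:E * z)%E).
rewrite iint_notin//; congr (iint _ _ _ _); apply/funext => w.
congr f; apply/funext => i.
rewrite big_cons {1}/update eqxx -addrA; congr (_ + _); rewrite addrC; congr (_ + _).
rewrite big_seq [RHS]big_seq; apply: eq_bigr => a al; rewrite /update.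
by case: eqVneq => // aj; rewrite -aj al in jl.
Qed.

(** Chernoff's bound: tilting by [lam = (CR x0 x0)^-1] times the coordinate at [x0] costs
    [expR (lam / 2)] and gains [expR (- lam)] on the event. *)
Lemma lebint_large QR CR (x0 : I) : mutual_inverse QR CR -> symmetric_kernel CR ->
  psd CR -> 0 < CR x0 x0 ->
  (lebint (fun x => (rho QR x)%:E * (1 < x x0)%R%:R%:E) <=
   (expR (- (2 * CR x0 x0)^-1))%:E * lebint (fun x => (rho QR x)%:E))%E.
Proof.
move=> QC sC pC c0; pose lam := (CR x0 x0)^-1.
have sQ := inverse_symmetric QC sC.
pose a i := lam * unit_vector R x0 i; pose c := mv CR a.
have ac : dot a c = lam.
  by rewrite /c /a mvZ dotZl dotZr dotC dot_unit mv_unit /lam mulVf ?mulr1// gt_eqF.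
have := lebint_exp_dot sQ (QC.1 a : mv QR c = a).
rewrite ac => E.
apply: (@le_trans _ _ ((expR (- lam))%:E *
    lebint (fun x => (rho QR x * expR (dot a x))%:E))%E); last first.
  rewrite E muleA -EFinM -expRD; apply: lee_wpmul2r.
    by apply: lebint_ge0 => x; rewrite lee_fin expR_ge0.
  rewrite lee_fin ler_expR /lam invfM.
  by rewrite (_ : - (CR x0 x0)^-1 + _ = - (2^-1 * (CR x0 x0)^-1))//; field; rewrite gt_eqF.
have mr : coord_measurable (fun x => (rho QR x)%:E).
  by apply: coord_measurable_EFin; exact: coord_measurable_rho.
have me : coord_measurable (fun x => (rho QR x * expR (dot a x))%:E).
  apply: coord_measurable_EFin; apply: coord_measurableM; first exact: coord_measurable_rho.
  apply: coord_measurable_expR; exact: coord_measurable_dot.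
rewrite -lebintZ ?expR_ge0//; last by move=> x; rewrite lee_fin mulr_ge0// expR_ge0.
apply: le_lebint.
- by move=> x; rewrite -EFinM lee_fin mulr_ge0 ?expR_ge0// ler0n.
- apply: coord_measurable_emul => //; apply: coord_measurable_EFin.
  apply: coord_measurable_bool; apply: coord_measurable_lt.
    exact: coord_measurable_cst.
  exact: coord_measurable_proj.
- by apply: coord_measurable_emul => //; exact: coord_measurable_cst.
- move=> x; rewrite -!EFinM lee_fin mulrCA ler_wpM2l ?expR_ge0// -expRD.
  rewrite /a dotZl dotC dot_unit; case: ltP => [x1|_]; last exact: expR_ge0.
  rewrite -[leLHS]expR0 ler_expR addrC -[X in _ - X]mulr1 -mulrBr mulr_ge0//.
    by rewrite invr_ge0 ltW.
  by rewrite subr_ge0 ltW.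
Qed.

End noise_chain.

(** * Green function and random walk of a finite network *)

Section network_kernels.
Variables (R : realType) (I E : finType) (src : E -> I) (tgt : E -> option I).
Implicit Types (i j : I) (e : E) (x : I -> R).

Definition atsrc e i : R := (src e == i)%:R.
Definition attgt e i : R := (tgt e == Some i)%:R.
Definition nabla e i : R := atsrc e i - attgt e i.
Definition asum e i : R := atsrc e i + attgt e i.

(** An edge leading outside contributes to the diagonal only: this is the Laplacian of the walk
    killed outside, and the precision matrix of the free field. *)
Definition laplacian i j : R := \sum_e nabla e i * nabla e j.
Definition adjk i j : R := \sum_e (atsrc e i * attgt e j + attgt e i * atsrc e j).
Definition degk i : R := \sum_e asum e i.
(** The signless Laplacian. Sums over the ends of an edge replace differences, so that its factors
    are nonnegative. *)
Definition lazyk i j : R := \sum_e asum e i * asum e j.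

Lemma atsrcM e i j : atsrc e i * atsrc e j = (i == j)%:R * atsrc e i.
Proof.
rewrite /atsrc; case: (eqVneq i j) => [->|ij].
  by rewrite mul1r; case: eqP; rewrite ?mulr1// mulr0.
rewrite mul0r; case: eqP => [->|]; rewrite ?mul0r// (negbTE ij) mulr0//.
Qed.

Lemma attgtM e i j : attgt e i * attgt e j = (i == j)%:R * attgt e i.
Proof.
rewrite /attgt; case: (eqVneq i j) => [->|ij].
  by rewrite mul1r; case: eqP; rewrite ?mulr1// mulr0.
rewrite mul0r; case: eqP => [->|]; rewrite ?mul0r// [Some i == _](_ : _ = false) ?mulr0//.
by apply: contraNF ij => /eqP[->].
Qed.

Lemma laplacianE i j : laplacian i j = (i == j)%:R * degk i - adjk i j.
Proof.
rewrite /laplacian /degk /adjk mulr_sumr -sumrB; apply: eq_bigr => e _.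
rewrite /nabla /asum [(i == j)%:R * (_ + _)]mulrDr -atsrcM -attgtM; ring.
Qed.

Lemma lazykE i j : lazyk i j = (i == j)%:R * degk i + adjk i j.
Proof.
rewrite /lazyk /degk /adjk mulr_sumr -big_split; apply: eq_bigr => e _.
rewrite /asum [(i == j)%:R * (_ + _)]mulrDr -atsrcM -attgtM /=; ring.
Qed.

Lemma adjkC i j : adjk i j = adjk j i.
Proof. by apply: eq_bigr => e _; ring. Qed.

Lemma adjk_ge0 i j : 0 <= adjk i j.
Proof. by apply: sumr_ge0 => e _; rewrite addr_ge0// mulr_ge0// ler0n. Qed.

Lemma asum_ge0 e i : 0 <= asum e i.
Proof. by rewrite addr_ge0// ler0n. Qed.

Lemma sum_adjk i : \sum_j adjk i j <= degk i.
Proof.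
have at1 (f : E -> option I) e : \sum_j (f e == Some j)%:R <= 1 :> R.
  case: (f e) => [k|]; last by rewrite big1// ler01.
  by rewrite (bigD1 k)//= eqxx big1 ?addr0// => j /negbTE jk; rewrite (inj_eq Some_inj) eq_sym jk.
rewrite exchange_big; apply: ler_sum => e _; rewrite big_split /= -!mulr_sumr.
rewrite [leRHS](_ : _ = atsrc e i * 1 + attgt e i * 1); last by rewrite /asum !mulr1.
apply: lerD; apply: ler_wpM2l; rewrite ?ler0n//; first exact: at1.
by have := at1 (Some \o src) e; under eq_bigr do rewrite /= (inj_eq Some_inj).
Qed.

Lemma laplacian_sym : symmetric_kernel laplacian.
Proof. by move=> i j; apply: eq_bigr => e _; rewrite mulrC. Qed.

Definition ext x : option I -> R := fun a => if a is Some i then x i else 0.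

Lemma dot_nabla e x : dot (nabla e) x = ext x (Some (src e)) - ext x (tgt e).
Proof.
rewrite /dot /nabla; under eq_bigr do rewrite mulrBl.
rewrite sumrB; congr (_ - _).
  rewrite (bigD1 (src e))//= /atsrc eqxx mul1r big1 ?addr0// => j /negbTE h.
  by rewrite eq_sym h mul0r.
rewrite /attgt /ext; case: (tgt e) => [k|]; last by rewrite big1// => j _; rewrite mul0r.
rewrite (bigD1 k)//= eqxx mul1r big1 ?addr0// => j /negbTE h.
by rewrite (inj_eq Some_inj) eq_sym h mul0r.
Qed.

Lemma mv_laplacian x i : mv laplacian x i = \sum_e nabla e i * dot (nabla e) x.
Proof.
rewrite /mv /laplacian; under eq_bigr do rewrite mulr_suml.
rewrite exchange_big; apply: eq_bigr => e _; rewrite /dot mulr_sumr.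
by apply: eq_bigr => j _; ring.
Qed.

Lemma dirichlet x y : dot y (mv laplacian x) = \sum_e dot (nabla e) y * dot (nabla e) x.
Proof.
rewrite {1}/dot; under eq_bigr do rewrite mv_laplacian mulr_sumr.
rewrite exchange_big; apply: eq_bigr => e _; rewrite [dot _ y]/dot mulr_suml.
by apply: eq_bigr => j _; ring.
Qed.

Lemma mv_laplacianE x i : mv laplacian x i = degk i * x i - \sum_j adjk i j * x j.
Proof.
rewrite /mv; under eq_bigr do rewrite laplacianE mulrBl.
rewrite sumrB; congr (_ - _); rewrite (bigD1 i)//= eqxx mul1r big1 ?addr0// => j.
by rewrite eq_sym => /negbTE ->; rewrite !mul0r.
Qed.

Hypothesis grounded : forall i, connect (links src tgt [set: E]%SET) (Some i) None.

(** Zero energy makes the function constant along every edge, its value outside is [0], and every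
    vertex is connected to the outside. *)
Lemma dirichlet_eq0 x : dot x (mv laplacian x) = 0 -> x = fun=> 0.
Proof.
rewrite dirichlet => /eqP; rewrite psumr_eq0 => [/allP x0|e _]; last exact: sqr_ge0.
have e0 e : ext x (Some (src e)) = ext x (tgt e).
  have := x0 e (mem_index_enum _); rewrite mulf_eq0 orbb dot_nabla subr_eq0.
  by move/eqP.
have c0 a : connect (links src tgt [set: E]%SET) a None -> ext x a = 0.
  move=> /connectP[p + pN]; elim: p a pN => [|b p ih] a /= pN; first by rewrite -pN.
  move=> /andP[/'exists_andP[e [_ ab]] /(ih _ pN) <-].
  by move: ab => /orP[|] /andP[/eqP -> /eqP ->]; rewrite e0.
by apply/funext => i; exact: (c0 (Some i)).
Qed.

Lemma degk_gt0 i : 0 < degk i.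
Proof.
have /connectP[[|b p]//= /andP[/'exists_andP[e [_ ab]] _] _] := grounded i.
rewrite /degk (bigD1 e)//= ltr_pwDl//; last by apply: sumr_ge0 => *; exact: asum_ge0.
have : touches src tgt e i.
  by move: ab => /orP[|] /andP[/eqP + /eqP]; [move=> [->] _|move=> _];
    rewrite /touches => *; apply/orP; [left|right; apply/eqP].
by rewrite /asum /atsrc /attgt -natrD ltr0n /touches; case: (src e == i) => //= ->.
Qed.

Lemma green_exists : exists C, mutual_inverse laplacian C.
Proof.
by apply: mv_inverse => x x0; apply: dirichlet_eq0; rewrite x0 /dot big1// => i _; rewrite mulr0.
Qed.

(** Minimum principle by energy: with [y] the negative part of [x], each edge satisfies [(y a - y b)
    * (x a - x b) <= - (y a - y b) ^+ 2]. The energy of [y] is thus at most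
    [- dot y (mv laplacian x)], hence zero. *)
Lemma laplacian_nonneg x : (forall i, 0 <= mv laplacian x i) -> forall i, 0 <= x i.
Proof.
move=> Qx; pose y i := Num.max 0 (- x i).
have y0 i : 0 <= y i by rewrite le_max lexx.
suff yy : y = fun=> 0.
  move=> i; have /eqP := congr1 (@^~ i) yy; rewrite /y.
  by case: (leP 0 (- x i)) => [_|]; [rewrite oppr_eq0 => /eqP ->|rewrite oppr_lt0 => /ltW].
apply: dirichlet_eq0; apply/eqP; rewrite eq_le; apply/andP; split; last first.
  by rewrite dirichlet; apply: sumr_ge0 => e _; exact: sqr_ge0.
have : 0 <= dot y (mv laplacian x) by apply: sumr_ge0 => i _; exact: mulr_ge0.
rewrite !dirichlet -subr_ge0 => h; rewrite -oppr_ge0.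
apply: (le_trans h); rewrite subr0 -sumrN; apply: ler_sum => e _.
rewrite !dot_nabla.
have pos (a : option I) : 0 <= ext y a by case: a => //= i; exact: y0.
have key a b : (ext y a - ext y b) * (ext x a - ext x b) <=
    - ((ext y a - ext y b) * (ext y a - ext y b)).
  have yE c : ext y c = Num.max 0 (- ext x c) by case: c => //=; rewrite oppr0 maxxx.
  rewrite -subr_ge0 !yE; move: (ext x a) (ext x b) => s t.
  rewrite (_ : _ - _ = - (Num.max 0 (- s) - Num.max 0 (- t)) *
    ((Num.max 0 (- s) + s) - (Num.max 0 (- t) + t))); last by ring.
  case: (leP 0 (- s)) => s0; case: (leP 0 (- t)) => t0.
  - by rewrite !addNr subrr mulr0.
  - rewrite (_ : _ * _ = (- s) * t); last by ring.
    by apply: mulr_ge0; lra.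
  - rewrite (_ : _ * _ = (- t) * s); last by ring.
    by apply: mulr_ge0; lra.
  - by rewrite subrr oppr0 mul0r.
exact: key.
Qed.

Definition transk i j : R := adjk i j / degk i.

Fixpoint powk (m : nat) i j : R :=
  if m is q.+1 then \sum_h transk i h * powk q h j else (i == j)%:R.

Definition heatk m i j : R := powk m i j / degk j.

Lemma transk_ge0 i j : 0 <= transk i j.
Proof. by rewrite divr_ge0 ?adjk_ge0// ltW// degk_gt0. Qed.

Lemma powk_ge0 m i j : 0 <= powk m i j.
Proof.
elim: m i => [|m ih] i /=; first exact: ler0n.
by apply: sumr_ge0 => h _; rewrite mulr_ge0// transk_ge0.
Qed.

Lemma heatk_ge0 m i j : 0 <= heatk m i j.
Proof. by rewrite divr_ge0 ?powk_ge0// ltW// degk_gt0. Qed.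

Lemma powk_add m m' i j : powk (m + m') i j = \sum_h powk m i h * powk m' h j.
Proof.
elim: m i => [|m ih] i.
  rewrite add0n (bigD1 i)//= eqxx mul1r big1 ?addr0// => h.
  by rewrite eq_sym => /negbTE ->; rewrite mul0r.
rewrite addSn /=; under eq_bigr do rewrite ih mulr_sumr.
rewrite exchange_big; apply: eq_bigr => h _; rewrite mulr_suml.
by apply: eq_bigr => h' _; rewrite mulrA.
Qed.

Lemma powkSr m i j : powk m.+1 i j = \sum_h powk m i h * transk h j.
Proof.
rewrite -addn1 powk_add; apply: eq_bigr => h _; congr (_ * _) => /=.
rewrite (bigD1 j)//= eqxx mulr1 big1 ?addr0// => h' /negbTE ->.
by rewrite mulr0.
Qed.

(** Reversibility: dividing by the degree of the endpoint symmetrizes the powers of the transition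
    kernel. *)
Lemma heatkC m i j : heatk m i j = heatk m j i.
Proof.
elim: m i j => [|m ih] i j.
  by rewrite /heatk /= eq_sym; case: eqVneq => [->//|]; rewrite !mul0r.
rewrite {2}/heatk powkSr /heatk /= !mulr_suml; apply: eq_bigr => h _.
have := ih h j; rewrite /heatk /transk [adjk h i]adjkC => hE.
have dh : degk h != 0 by rewrite gt_eqF// degk_gt0.
rewrite (_ : powk m j h = powk m h j / degk j * degk h); last by rewrite hE mulfVK.
by field; rewrite !gt_eqF ?degk_gt0.
Qed.

Lemma sum_powkS m i : \sum_j powk m.+1 i j <= \sum_j powk m i j.
Proof.
under eq_bigr do rewrite powkSr.
rewrite exchange_big /=; apply: ler_sum => h _; rewrite -mulr_sumr.
rewrite ler_piMr ?powk_ge0// /transk -mulr_suml ler_pdivrMr ?degk_gt0// mul1r.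
exact: sum_adjk.
Qed.

Lemma transk_near i j : transk i j != 0 -> nadj src tgt i j.
Proof.
move=> nz; apply: contraT; rewrite negb_exists => /forallP no.
move: nz; rewrite /transk /adjk big1 ?mul0r ?eqxx// => e _.
have := no e; rewrite negb_or !negb_and /atsrc /attgt => /andP[].
rewrite ![Some _ == Some _](inj_eq Some_inj) ![Some _ == tgt _]eq_sym ![_ == src e]eq_sym.
by move=> /orP[|] /negbTE -> /orP[|] /negbTE ->; rewrite ?mul0r ?mulr0 ?addr0.
Qed.

Lemma powk_near m i j : powk m i j != 0 -> j \in nball src tgt m i.
Proof.
elim: m i => [|m ih] i nz.
  by move: nz; rewrite /= !inE [j == i]eq_sym; case: (i == j); rewrite ?eqxx.
have [h] : exists h, transk i h * powk m h j != 0.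
  apply: contrapT => /forallNP no; move: nz; rewrite /= big1 ?eqxx// => h _.
  by apply/eqP; apply: contrapT => /negP; exact: no.
rewrite mulf_eq0 negb_or => /andP[ih0 hj].
rewrite -add1n; apply: nball_trans (ih _ hj); apply: nadj_ball.
exact: transk_near.
Qed.

Definition noisev (m : nat) e i : R := \sum_j heatk m i j * asum e j.

Lemma noisev_ge0 m e i : 0 <= noisev m e i.
Proof. by apply: sumr_ge0 => j _; rewrite mulr_ge0 ?heatk_ge0 ?asum_ge0. Qed.

Lemma noisev_near m e i : noisev m e i != 0 ->
  exists2 j, j \in nball src tgt m i & touches src tgt e j.
Proof.
move=> nz; apply: contrapT => no; move: nz; rewrite /noisev big1 ?eqxx// => j _.
apply/eqP; apply: contrapT => /negP; rewrite mulf_eq0 negb_or => /andP[h a].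
apply: no; exists j.
  apply: powk_near; apply: contraNneq h => h0.
  by rewrite /heatk h0 mul0r.
rewrite /touches; move: a; rewrite /asum /atsrc /attgt.
by case: (src e == j) => //; case: (tgt e == _) => //; rewrite addr0 eqxx.
Qed.

(** With [A] the adjacency kernel, the left-hand side is [P ^ m D^-1 (D + A) D^-1 (P ^ m)^T],
    because [lazyk = D + A] is the sum of the outer products of the vectors [asum e]. Reversibility
    brings both powers to the same side. *)
Lemma sum_noisev m i j :
  \sum_e noisev m e i * noisev m e j = heatk (m + m) i j + heatk (m + m).+1 i j.
Proof.
transitivity (\sum_a \sum_b heatk m i a * lazyk a b * heatk m j b).
  rewrite /noisev; under eq_bigr do rewrite mulr_suml.
  rewrite exchange_big; apply: eq_bigr => a _ /=.
  under eq_bigr do rewrite mulr_sumr.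
  rewrite exchange_big; apply: eq_bigr => b _ /=.
  rewrite /lazyk mulr_sumr mulr_suml; apply: eq_bigr => e _; ring.
under eq_bigr do under eq_bigr do rewrite lazykE mulrDr mulrDl.
under eq_bigr do rewrite big_split.
have hE k : heatk (m + k) i j = \sum_a heatk m i a * degk a * heatk k a j.
  rewrite /heatk powk_add mulr_suml; apply: eq_bigr => a _.
  by rewrite divfK ?mulrA// gt_eqF// degk_gt0.
rewrite big_split; congr (_ + _).
  rewrite hE; apply: eq_bigr => a _.
  rewrite (bigD1 a)//= eqxx mul1r big1 ?addr0 => [|b]; last first.
    by rewrite eq_sym => /negbTE ->; rewrite mul0r mulr0 mul0r.
  by rewrite (heatkC m j a).
rewrite -addnS hE; apply: eq_bigr => a _ /=.
rewrite [heatk m.+1 a j]/heatk /= mulr_suml mulr_sumr; apply: eq_bigr => b _.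
rewrite (heatkC m j b) /heatk /transk.
by field; rewrite !gt_eqF ?degk_gt0.
Qed.

Section green.
Variable C : I -> I -> R.
Hypothesis CQ : mutual_inverse laplacian C.

Lemma green_sym : symmetric_kernel C.
Proof.
apply: (@inverse_symmetric _ _ C laplacian); last exact: laplacian_sym.
by case: CQ.
Qed.

Lemma green_psd : psd C.
Proof.
move=> x; have [QC _] := CQ; rewrite -{1}(QC x) dotC dirichlet.
by apply: sumr_ge0 => e _; exact: sqr_ge0.
Qed.

Lemma green_eq0 x : dot x (mv C x) = 0 -> x = fun=> 0.
Proof.
have [QC _] := CQ; rewrite -{1}(QC x) dotC => /dirichlet_eq0 C0.
by rewrite -(QC x) C0; apply/funext => i; rewrite /mv big1// => j _; rewrite mulr0.
Qed.

Lemma mv_green_ge0 x : (forall i, 0 <= x i) -> forall i, 0 <= mv C x i.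
Proof. by move=> x0; apply: laplacian_nonneg; rewrite CQ.1. Qed.

Lemma green_ge0 i j : 0 <= C i j.
Proof.
have := @mv_green_ge0 (unit_vector R j) (fun k => ler0n _ _) i.
by rewrite mv_unit.
Qed.

(** The remainder of the Green series after [m] terms, see [green_series]. *)
Definition remk m i j : R := \sum_h powk m i h * C h j.

Lemma green_step i j : C i j = heatk 0 i j + \sum_h transk i h * C h j.
Proof.
have := congr1 (@^~ i) (CQ.1 (unit_vector R j)).
rewrite mv_unit mv_laplacianE /unit_vector /= => h.
have d0 : degk i != 0 by rewrite gt_eqF// degk_gt0.
rewrite /heatk /=.
have -> : \sum_h transk i h * C h j = (\sum_h adjk i h * C h j) / degk i.
  by rewrite mulr_suml; apply: eq_bigr => k _; rewrite /transk mulrAC.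
have -> : (i == j)%:R / degk j = (i == j)%:R / degk i.
  by case: eqVneq => [->|]; rewrite ?mul0r.
rewrite -mulrDl -h subrK; by field.
Qed.

Lemma remkS m i j : remk m i j = heatk m i j + remk m.+1 i j.
Proof.
rewrite /remk; under eq_bigr do rewrite green_step mulrDr.
rewrite big_split; congr (_ + _).
  rewrite (bigD1 j)//= /heatk /= eqxx mul1r big1 ?addr0// => h /negbTE ->.
  by rewrite !mul0r mulr0.
under eq_bigr do rewrite mulr_sumr.
rewrite exchange_big; apply: eq_bigr => h _; rewrite powkSr mulr_suml.
by apply: eq_bigr => k _; rewrite mulrA.
Qed.

Lemma green_series m i j : C i j = \sum_(q < m) heatk q i j + remk m i j.
Proof.
elim: m => [|m ih].
  rewrite big_ord0 add0r /remk (bigD1 i)//= eqxx mul1r big1 ?addr0// => h.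
  by rewrite eq_sym => /negbTE ->; rewrite mul0r.
by rewrite ih big_ord_recr /= remkS addrA.
Qed.

Lemma remk_ge0 m i j : 0 <= remk m i j.
Proof. by apply: sumr_ge0 => h _; rewrite mulr_ge0 ?powk_ge0 ?green_ge0. Qed.

Lemma remkC m i j : remk m i j = remk m j i.
Proof.
have := green_series m i j; have := green_series m j i.
rewrite (green_sym j i).
rewrite [X in _ = X + _](_ : _ = \sum_(q < m) heatk q i j); last first.
  by apply: eq_bigr => q _; exact: heatkC.
by move=> -> /addrI ->.
Qed.

(** At an even index the remainder is [P ^ m C (P ^ m)^T], because [P ^ m C] is symmetric. The
    truncation of the field therefore stops at an even time. *)
Lemma remk_psd m x : 0 <= dot x (mv (remk (m + m)) x).
Proof.
pose y h := \sum_i x i * powk m i h.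
suff -> : dot x (mv (remk (m + m)) x) = dot y (mv C y) by exact: green_psd.
have RE i j : remk (m + m) i j = \sum_h powk m i h * \sum_k powk m j k * C k h.
  rewrite /remk; under eq_bigr do rewrite powk_add mulr_suml.
  rewrite exchange_big; apply: eq_bigr => h _ /=.
  under eq_bigr do rewrite -mulrA.
  by rewrite -mulr_sumr -/(remk m h j) remkC.
rewrite /dot /mv.
under eq_bigr do rewrite mulr_sumr.
under [RHS]eq_bigr do rewrite mulr_sumr.
under [RHS]eq_bigr do under eq_bigr do rewrite /y mulr_suml.
rewrite [RHS](_ : _ = \sum_h \sum_k \sum_i \sum_j
    x i * powk m i h * (C h k * (x j * powk m j k))); last first.
  apply: eq_bigr => h _; apply: eq_bigr => k _; apply: eq_bigr => i _.
  by rewrite !mulr_sumr.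
transitivity (\sum_i \sum_j \sum_h \sum_k
    x i * powk m i h * (C h k * (x j * powk m j k))).
  apply: eq_bigr => i _; apply: eq_bigr => j _; rewrite RE mulr_suml mulr_sumr.
  apply: eq_bigr => h _; rewrite mulr_sumr mulr_suml mulr_sumr.
  by apply: eq_bigr => k _; rewrite (green_sym h k); ring.
under eq_bigr do rewrite exchange_big.
rewrite exchange_big; apply: eq_bigr => h _ /=.
under eq_bigr do rewrite exchange_big.
by rewrite exchange_big.
Qed.

(** The surviving mass [\sum_j powk m i j] does not increase with [m], and its sum over [m] is
    bounded by [T] through the Green series, so it is at most [T / m]. The bound depends on the
    network, but only governs where the decomposition of the field is truncated. *)
Lemma remk_small i (a : R) : 0 < a -> exists m, remk (m + m) i i <= a.
Proof.
move=> a0; pose T := \sum_j C i j * degk j; pose B := \sum_j C j i.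
have C0 := green_ge0.
have T0 : 0 <= T by apply: sumr_ge0 => j _; rewrite mulr_ge0// ltW// degk_gt0.
have B0 : 0 <= B by exact: sumr_ge0.
have surv m : m%:R * \sum_j powk m i j <= T.
  apply: (@le_trans _ _ (\sum_(q < m) \sum_j powk q i j)).
    rewrite -[m in m%:R]card_ord -sum1_card natr_sum mulr_suml.
    apply: ler_sum => q _; rewrite mul1r.
    have dec k : \sum_j powk (q + k) i j <= \sum_j powk q i j.
      elim: k => [|k ih]; first by rewrite addn0.
      by rewrite addnS; apply: le_trans ih; exact: sum_powkS.
    by have := dec (m - q)%N; rewrite subnKC// ltnW.
  rewrite exchange_big; apply: ler_sum => j _.
  rewrite (green_series m) mulrDl mulr_suml.
  rewrite (eq_bigr (fun q : 'I_m => heatk q i j * degk j)); last first.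
    by move=> q _; rewrite /heatk divfK// gt_eqF// degk_gt0.
  by rewrite lerDl mulr_ge0 ?remk_ge0// ltW// degk_gt0.
have rB m : remk m i i <= (\sum_j powk m i j) * B.
  rewrite /remk mulr_suml; apply: ler_sum => j _; apply: ler_wpM2l; first exact: powk_ge0.
  by rewrite /B (bigD1 j)//= lerDl sumr_ge0.
pose m := (Num.truncn (T * B / a)).+1.
exists m; apply: (le_trans (rB _)).
have m0 : 0 < (m + m)%:R :> R by rewrite ltr0n addn_gt0.
rewrite -(ler_pM2l m0) mulrA.
apply: (@le_trans _ _ (T * B)); first by apply: ler_wpM2r => //; exact: surv.
rewrite -ler_pdivrMr//; apply: ltW; apply: (lt_le_trans (truncnS_gt _)).
by rewrite ler_nat leq_addr.
Qed.

Lemma sum_heatk_pairs (K : nat) i j :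
  \sum_(q < K) (heatk (q + q) i j + heatk (q + q).+1 i j) = C i j - remk (K + K) i j.
Proof.
rewrite (green_series (K + K)) addrK.
elim: K => [|K ih]; first by rewrite !big_ord0.
by rewrite big_ord_recr/= ih addSn addnS !big_ord_recr/= -addrA.
Qed.

End green.

End network_kernels.

(** * Percolation driven by the Gaussian free field *)

Section pmean_sum_formula.
Variables (R : realType) (E : finType).
Implicit Types (p : E -> R) (f : {set E} -> R) (w u : {set E}).

Definition config_weight p w : R := \prod_e (if e \in w then p e else 1 - p e).

(** The form suited to induction on the averaged list: edges not averaged must already agree with
    [w]. *)
Lemma edge_means_ind p s w u : uniq s ->
  edge_means p s (fun u => (u == w)%:R) u =
  (\prod_(e <- s) (if e \in w then p e else 1 - p e)) *
    [forall e, (e \notin s) ==> ((e \in u) == (e \in w))]%:R.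
Proof.
elim: s u => [|e s ih] u /=.
  move=> _; rewrite big_nil mul1r; congr (nat_of_bool _)%:R.
  apply/eqP/forallP => [-> x|h]; first by rewrite eqxx.
  by apply/finset.setP => x; apply/eqP; have := h x.
move=> /andP[es us]; rewrite /edge_mean !ih// big_cons.
pose P (u' : {set E}) (s' : seq E) := [forall x, (x \notin s') ==> ((x \in u') == (x \in w))].
rewrite -!/(P _ _).
have PE (u' : {set E}) : (forall x, x != e -> (x \in u') = (x \in u)) ->
    P u' s = ((e \in u') == (e \in w)) && P u (e :: s).
  move=> uu; apply/forallP/andP => [h|[he /forallP h] x].
    split; first by have := h e; rewrite es.
    apply/forallP => x; rewrite inE negb_or; apply/implyP => /andP[xe xs].
    by have := h x; rewrite xs uu.
  have [->|xe] := eqVneq x e; first by rewrite es.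
  by have := h x; rewrite inE negb_or xe uu.
rewrite !PE; last 2 first.
- by move=> x xe; rewrite !inE xe.
- by move=> x xe; rewrite !inE (negbTE xe).
rewrite !inE eqxx /=.
by case: (e \in w) => /=; rewrite ?mulr0 ?addr0 ?add0r mulrA.
Qed.

Lemma pmean_ind p w : pmean p (fun u => (u == w)%:R) = config_weight p w.
Proof.
rewrite /pmean edge_means_ind ?enum_uniq// /config_weight big_enum/=.
rewrite (_ : [forall _, _] = true) ?mulr1//.
by apply/forallP => e; rewrite mem_enum.
Qed.

Lemma pmean_sumE p f : pmean p f = \sum_w f w * config_weight p w.
Proof.
under eq_bigr do rewrite -pmean_ind -pmeanZ.
rewrite -pmean_sum; congr pmean; apply/funext => u.
by rewrite (bigD1 u)//= eqxx mulr1 big1 ?addr0// => w; rewrite eq_sym => /negbTE ->; rewrite mulr0.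
Qed.

Lemma config_weight_ge0 p w : prob_param p -> 0 <= config_weight p w.
Proof.
move=> p01; apply: prodr_ge0 => e _; have /andP[p0 p1] := p01 e.
by case: ifP; rewrite ?subr_ge0.
Qed.

Lemma pmean_eq_off (U : {set E}) p q f :
  (forall w w', (forall e, e \notin U -> (e \in w) = (e \in w')) -> f w = f w') ->
  (forall e, e \notin U -> p e = q e) -> pmean p f = pmean q f.
Proof.
move=> fU pq; rewrite /pmean; move: (enum E) => s; congr (_ finset.set0).
suff [] : edge_means p s f = edge_means q s f /\
  (forall w w', (forall e, e \notin U -> (e \in w) = (e \in w')) ->
    edge_means q s f w = edge_means q s f w') by [].
elim: s => //= e s [-> inv]; split; last first.
  move=> w w' ww'; rewrite /edge_mean; congr (_ * _ + _ * _); apply: inv => x xU.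
    by rewrite !inE ww'.
  by rewrite !inE ww'.
apply/funext => w; rewrite /edge_mean; have [eU|eU] := boolP (e \in U); last by rewrite pq.
rewrite (inv (e |: w)%SET w) ?(inv (w :\ e)%SET w); first by ring.
  by move=> x xU; rewrite !inE; case: eqVneq => // xe; rewrite xe eU in xU.
by move=> x xU; rewrite !inE; case: eqVneq => // xe; rewrite xe eU in xU.
Qed.

Lemma coord_measurable_pmean (I : eqType) (p : (I -> R) -> E -> R) f :
  (forall e, coord_measurable (fun x => p x e)) ->
  coord_measurable (fun x => pmean (p x) f).
Proof.
move=> mp; rewrite (_ : (fun x => _) = fun x => \sum_(w <- enum {set E})
    f w * \prod_(e <- enum E) (if e \in w then p x e else 1 - p x e)).
  apply: coord_measurable_sum => w; apply: coord_measurableM.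
    exact: coord_measurable_cst.
  apply: coord_measurable_prod => e; case: (e \in w) => //.
  by apply: coord_measurableD; [exact: coord_measurable_cst|exact: coord_measurableN].
apply/funext => x; rewrite pmean_sumE big_enum/=; apply: eq_bigr => w _.
by rewrite /config_weight big_enum.
Qed.

End pmean_sum_formula.

Section flip.
Variables (R : realType) (I E : finType) (src : E -> I) (tgt : E -> option I).
Variable (S : {set I}).
Implicit Types (x : I -> R) (e : E) (w : {set E}).
Local Notation reach_ind := (@reach_ind R I E src tgt S).
Local Notation lap := (@laplacian R I E src tgt).

(* The field takes the value [1] outside the network. *)
Definition bval x : option I -> R := fun a => if a is Some i then x i else 1.

Definition field_prod x e : R := x (src e) * bval x (tgt e).

(* The open probabilities of the cable-graph percolation in the positive set, and
   in the set where the field has constant sign. *)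
Definition pos_param x e : R :=
  1 - expR (- (2 * (Num.max 0 (x (src e)) * Num.max 0 (bval x (tgt e))))).
Definition sign_param x e : R := 1 - expR (- (2 * Num.max 0 (field_prod x e))).

Lemma one_sub_expR_01 (a : R) : 0 <= a -> 0 <= 1 - expR (- (2 * a)) <= 1.
Proof.
move=> a0; rewrite subr_ge0 lerBlDr lerDl expR_ge0 andbT.
by rewrite -[leRHS]expR0 ler_expR oppr_le0 mulr_ge0.
Qed.

Lemma pos_param_01 x : prob_param (pos_param x).
Proof. by move=> e; apply: one_sub_expR_01; rewrite mulr_ge0// le_max lexx. Qed.

Lemma sign_param_01 x : prob_param (sign_param x).
Proof. by move=> e; apply: one_sub_expR_01; rewrite le_max lexx. Qed.

Lemma sign_param_gt0 x e : sign_param x e != 0 -> 0 < field_prod x e.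
Proof.
apply: contraNT; rewrite -leNgt => h.
by rewrite /sign_param (max_l h) mulr0 oppr0 expR0 subrr.
Qed.

(** Under [sign_param] an open edge joins values of the same strict sign, so a path to the outside,
    where the value is [1], is positive throughout. Removing the edges [U] that have a nonpositive
    end keeps the connection, and off [U] the two parameters coincide. *)
Lemma pmean_sign_le_pos x :
  pmean (sign_param x) reach_ind <= pmean (pos_param x) reach_ind.
Proof.
pose U : {set E} := [set e | ~~ ((0 < x (src e)) && (0 < bval x (tgt e)))]%SET.
pose g w := reach_ind (w :\: U)%SET.
have gU w w' : (forall e, e \notin U -> (e \in w) = (e \in w')) -> g w = g w'.
  move=> ww'; congr reach_ind; apply/finset.setP => e; rewrite !finset.in_setD.
  by case: (boolP (e \in U)) => //= eU; rewrite ww'.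
apply: (@le_trans _ _ (pmean (sign_param x) g)).
  rewrite !pmean_sumE; apply: ler_sum => w _.
  have [w0|] := boolP [exists e in w, sign_param x e == 0].
    move: w0 => /'exists_andP[e [ew /eqP e0]].
    by rewrite /config_weight (bigD1 e)//= ew e0 mul0r !mulr0.
  move=> /exists_inPn wpos.
  apply: ler_wpM2r; first by apply: config_weight_ge0; exact: sign_param_01.
  rewrite /g /reach_ind; case: (boolP (reaches src tgt S w)) => [|_]; last by rewrite ler0n.
  move=> /'exists_andP[y [yS yN]].
  suff -> : reaches src tgt S (w :\: U)%SET by [].
  apply/'exists_andP; exists y; split => //.
  have posj e a b : e \in w -> joins src tgt e a b -> 0 < bval x b ->
      0 < bval x a /\ e \in (w :\: U)%SET.
    move=> ew ab b0; have := sign_param_gt0 (wpos e ew); rewrite /field_prod => p0.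
    have se : 0 < x (src e) /\ 0 < bval x (tgt e).
      move: ab => /orP[|] /andP[/eqP h1 /eqP h2].
        by move: b0 p0; rewrite h2 => b0; rewrite pmulr_lgt0.
      by move: b0 p0; rewrite h1 /= => b0; rewrite pmulr_rgt0.
    rewrite finset.in_setD ew andbT inE negbK; have [-> ->] := se; split => //.
    by move: ab => /orP[|] /andP[/eqP h1 /eqP h2]; rewrite ?h1 ?h2; have [] := se.
  have conn a : connect (links src tgt w) a None ->
      0 < bval x a /\ connect (links src tgt (w :\: U)%SET) a None.
    move=> /connectP[p + pN]; elim: p a pN => [|b p ih] a /= pN; first by rewrite -pN.
    move=> /andP[/'exists_andP[e [ew ab]] /(ih _ pN)[b0 bN]].
    have [a0 eU] := posj e a b ew ab b0; split => //.
    by apply: connect_trans bN; apply: connect1; apply/'exists_andP; exists e.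
  by have [] := conn _ yN.
rewrite (@pmean_eq_off _ _ U _ (pos_param x))//.
  apply: le_pmean; first exact: pos_param_01.
  by move=> w; apply: increasing_reach_ind; exact: finset.subsetDl.
move=> e; rewrite inE negbK => /andP[s0 t0].
rewrite /sign_param /pos_param /field_prod !max_r//; [exact: ltW|exact: ltW|].
by rewrite mulr_ge0// ltW.
Qed.

(** The factor of [e] in the joint weight of field and configuration: Gaussian density times
    Bernoulli probability. *)
Definition edge_weight x w e : R :=
  expR (- ((bval x (Some (src e)) - bval x (tgt e)) ^+ 2 / 2)) *
  (if e \in w then sign_param x e else 1 - sign_param x e).

Lemma edge_weight_ge0 x w e : 0 <= edge_weight x w e.
Proof.
rewrite mulr_ge0 ?expR_ge0//; have /andP[p0 p1] := sign_param_01 x e.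
by case: (e \in w) => //; rewrite subr_ge0.
Qed.

Definition off_ghost w i : bool := ~~ connect (links src tgt w) (Some i) None.

(** The summand [0] gives the map the form required by [lebint_affine]. *)
Definition flipped w x : I -> R := fun i => (-1) ^+ off_ghost w i * x i + 0.

(** The ends of an open edge lie in the same cluster and flip together. The weight of a closed edge
    depends only on the absolute values at its ends: the factor [2] in [sign_param] turns the cross
    term [u * v] of the Gaussian exponent into minus its absolute value. *)
Lemma edge_weight_flip x w e : edge_weight (flipped w x) w e = edge_weight x w e.
Proof.
rewrite /edge_weight /sign_param /field_prod.
pose off (a : option I) := ~~ connect (links src tgt w) a None.
have bE a : bval (flipped w x) a = (-1) ^+ off a * bval x a.
  case: a => [i|] /=; first by rewrite /flipped addr0.
  by rewrite /off connect0 mul1r.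
rewrite -[flipped w x (src e)]/(bval (flipped w x) (Some (src e))) !bE.
rewrite -[x (src e)]/(bval x (Some (src e))).
move: (bval x (Some (src e))) (bval x (tgt e)) => s t.
have sq (b : bool) (z : R) : ((-1) ^+ b * z) ^+ 2 = z ^+ 2.
  by rewrite exprMn -exprM mulnC exprM sqrrN !expr1n mul1r.
have [ew|ew] := boolP (e \in w).
  have -> : off (Some (src e)) = off (tgt e).
    rewrite /off; congr (~~ _); apply: same_connect; first exact: connect_linksC.
    by apply: connect1; apply/'exists_andP; exists e; rewrite /joins !eqxx.
  rewrite mulrACA -mulrBr sq -expr2 -exprM mulnC exprM sqrrN !expr1n mul1r//.
have K (u v : R) : expR (- ((u - v) ^+ 2 / 2)) *
    (1 - (1 - expR (- (2 * Num.max 0 (u * v))))) =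
    expR (- (u ^+ 2 / 2) - v ^+ 2 / 2 - `|u * v|).
  rewrite subKr -expRD; congr expR.
  by case: (lerP 0 (u * v)) => h; [rewrite ger0_norm//|rewrite ltr0_norm//]; field.
rewrite !K !sq; congr expR; congr (_ - _).
by rewrite mulrACA -exprD normrM normrX normrN1 expr1n mul1r.
Qed.

(** Subtracting [1] turns the boundary value [1] into the value [0] that the Laplacian assumes
    outside. *)
Lemma rho_laplacian x : rho lap (fun i => x i - 1) =
  \prod_e expR (- ((bval x (Some (src e)) - bval x (tgt e)) ^+ 2 / 2)).
Proof.
rewrite -expR_sum /rho dirichlet; congr expR; rewrite mulr_suml -sumrN.
apply: eq_bigr => e _; rewrite -expr2 dot_nabla; congr (- (_ ^+ 2 / 2)).
by case: (tgt e) => [i|] /=; ring.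
Qed.

Lemma coord_measurable_bval a : coord_measurable (fun x => bval x a).
Proof.
by case: a => [i|]; [exact: coord_measurable_proj|exact: coord_measurable_cst].
Qed.

Lemma coord_measurable_sign_param e : coord_measurable (fun x => sign_param x e).
Proof.
apply: coord_measurableD; first exact: coord_measurable_cst.
apply: coord_measurableN; apply: coord_measurable_expR; apply: coord_measurableN.
apply: coord_measurableM; first exact: coord_measurable_cst.
apply: coord_measurable_max; first exact: coord_measurable_cst.
by apply: coord_measurableM; [exact: coord_measurable_proj|exact: coord_measurable_bval].
Qed.

Lemma coord_measurable_pos_param e : coord_measurable (fun x => pos_param x e).
Proof.
apply: coord_measurableD; first exact: coord_measurable_cst.
apply: coord_measurableN; apply: coord_measurable_expR; apply: coord_measurableN.
apply: coord_measurableM; first exact: coord_measurable_cst.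
apply: coord_measurableM; apply: coord_measurable_max; try exact: coord_measurable_cst.
  exact: coord_measurable_proj.
exact: coord_measurable_bval.
Qed.

Lemma coord_measurable_edge_weight w e : coord_measurable (fun x => edge_weight x w e).
Proof.
have mb := coord_measurable_bval.
apply: coord_measurableM.
  apply: coord_measurable_expR; apply: coord_measurableN; apply: coord_measurableM.
    rewrite (_ : (fun x => _) = fun x => (bval x (Some (src e)) - bval x (tgt e)) *
        (bval x (Some (src e)) - bval x (tgt e))); last by apply/funext => x; rewrite expr2.
    by apply: coord_measurableM; apply: coord_measurableD => //; apply: coord_measurableN.
  exact: coord_measurable_cst.
case: (e \in w); first exact: coord_measurable_sign_param.
apply: coord_measurableD; first exact: coord_measurable_cst.
apply: coord_measurableN; exact: coord_measurable_sign_param.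
Qed.

(* Off the cluster of the outside the field is symmetric under a global change of
   sign, which maps [dot h] to its opposite: this is where [cosh >= 1] enters. *)
Lemma lebint_flip (h : I -> R) w : (forall i, i \notin S -> h i = 0) ->
  ~~ reaches src tgt S w ->
  (lebint (fun x => (\prod_e edge_weight x w e)%:E) <=
   lebint (fun x => (\prod_e edge_weight x w e * expR (- dot h x))%:E))%E.
Proof.
move=> hS nr; pose T x : R := \prod_e edge_weight x w e.
have T0 x : 0 <= T x by apply: prodr_ge0 => e _; exact: edge_weight_ge0.
have mT : coord_measurable T.
  rewrite (_ : T = fun x => \prod_(e <- index_enum E) edge_weight x w e)//.
  by apply: coord_measurable_prod => e; exact: coord_measurable_edge_weight.
have mL (s : R) : coord_measurable (fun x => (T x * expR (s * dot h x))%:E).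
  apply: coord_measurable_EFin; apply: coord_measurableM => //.
  apply: coord_measurable_expR; apply: coord_measurableM; first exact: coord_measurable_cst.
  exact: coord_measurable_dot.
have L0 (s : R) x : (0 <= (T x * expR (s * dot h x))%:E)%E.
  by rewrite lee_fin mulr_ge0// expR_ge0.
have Tf x : T (flipped w x) = T x.
  by apply: eq_bigr => e _; exact: edge_weight_flip.
have hf x : dot h (flipped w x) = - dot h x.
  rewrite /dot -sumrN; apply: eq_bigr => i _; rewrite /flipped addr0.
  have [iS|iS] := boolP (i \in S); last by rewrite hS// !mul0r oppr0.
  rewrite /off_ghost (_ : connect _ _ _ = false) ?mulN1r ?mulrN//.
  apply/negbTE; apply: contra nr => c; by apply/'exists_andP; exists i.
have sym : lebint (fun x => (T x * expR (1 * dot h x))%:E) =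
    lebint (fun x => (T x * expR (-1 * dot h x))%:E).
  rewrite -[LHS](lebint_affine (off_ghost w) (fun=> 0))//.
  congr lebint; apply/funext => x; rewrite -[fun i => _]/(flipped w x) Tf hf.
  by rewrite mul1r mulN1r.
have le2 : (lebint (fun x => 2%:E * (T x)%:E)%E <=
    lebint (fun x => (T x * expR (1 * dot h x))%:E + (T x * expR (-1 * dot h x))%:E)%E)%E.
  apply: le_lebint.
  - by move=> x; rewrite -EFinM lee_fin mulr_ge0.
  - apply: coord_measurable_emul; first exact: coord_measurable_cst.
    exact: coord_measurable_EFin.
  - by move=> d U g mg; apply: emeasurable_funD; apply: mL.
  - move=> x; rewrite -EFinM -EFinD lee_fin -mulrDr mulrC ler_wpM2l//.
    rewrite mul1r mulN1r expRN; have := expR_gt0 (dot h x).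
    move: (expR _) => y y0; rewrite -subr_ge0.
    rewrite (_ : _ - _ = (y - 1) ^+ 2 / y); last by field; rewrite gt_eqF.
    by rewrite divr_ge0 ?sqr_ge0// ltW.
move: le2; rewrite lebintD// sym lebintZ//; last first.
  exact: coord_measurable_EFin.
have -> : (fun x => (T x * expR (- dot h x))%:E) = fun x => (T x * expR (-1 * dot h x))%:E.
  by apply/funext => x; rewrite mulN1r.
set b := lebint (fun x => (T x * _)%:E); have b0 : (0 <= b)%E by exact: lebint_ge0.
have -> : (b + b = 2%:E * b)%E.
  by rewrite -[2]/(1 + 1)%R EFinD ge0_muleDl ?mul1e ?lee_fin.
by rewrite lee_pmul2l// lte_fin.
Qed.

(** Passing from [pos_param] to [sign_param] only increases the probability of disconnection, and
    makes the weight symmetric; [lebint_flip] then applies to each disconnecting configuration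
    separately. *)
Lemma lebint_disconnected (h : I -> R) C : mutual_inverse lap C ->
  (forall i, i \notin S -> h i = 0) -> dot h (mv C h) <= \sum_i h i ->
  (lebint (fun x => (rho lap x)%:E *
     (1 - pmean (pos_param (fun i => x i + 1)%R) reach_ind)%:E) <=
   (expR (- ((\sum_i h i) / 2)))%:E * lebint (fun x => (rho lap x)%:E))%E.
Proof.
move=> QC hS hC; pose H := \sum_i h i.
have mr : coord_measurable (fun x => (rho lap x)%:E).
  by apply: coord_measurable_EFin; exact: coord_measurable_rho.
pose nr := [seq w <- enum {set E} | ~~ reaches src tgt S w].
pose W x : R := rho lap (fun i => x i - 1).
have mW : coord_measurable (fun x => (W x)%:E).
  apply: (@coord_measurable_subst _ _ _ _ _ (fun x i => x i - 1) _ mr) => i.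
  by apply: coord_measurableD; [exact: coord_measurable_proj|exact: coord_measurable_cst].
have eqW x : W x * (1 - pmean (sign_param x) reach_ind) =
    \sum_(w <- nr) \prod_e edge_weight x w e.
  rewrite -{1}(pmean_cst (sign_param x) 1) -pmeanB pmean_sumE mulr_sumr big_filter.
  rewrite big_enum_cond /= [RHS]big_mkcond; apply: eq_bigr => w _.
  rewrite /reach_ind; case: reaches; first by rewrite subrr mul0r mulr0.
  by rewrite subr0 mul1r /W rho_laplacian /config_weight -big_split.
have mE w : coord_measurable (fun x => (\prod_e edge_weight x w e)%:E).
  apply: coord_measurable_EFin.
  rewrite (_ : (fun x => _) = fun x => \prod_(e <- index_enum E) edge_weight x w e)//.
  by apply: coord_measurable_prod => e; exact: coord_measurable_edge_weight.
have E0 w x : 0 <= \prod_e edge_weight x w e.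
  by apply: prodr_ge0 => e _; exact: edge_weight_ge0.
have mexp : coord_measurable (fun x => (expR (- dot h x))%:E).
  apply: coord_measurable_EFin; apply: coord_measurable_expR.
  by apply: coord_measurableN; exact: coord_measurable_dot.
have mpos : coord_measurable (fun x =>
    (1 - pmean (pos_param (fun i => x i + 1)) reach_ind)%:E).
  apply: coord_measurable_EFin; apply: coord_measurableD; first exact: coord_measurable_cst.
  apply: coord_measurableN; apply: coord_measurable_pmean => e.
  apply: (@coord_measurable_subst _ _ _ _ _ (fun (x : I -> R) i => x i + 1) _
    (@coord_measurable_pos_param e)) => i.
  by apply: coord_measurableD; [exact: coord_measurable_proj|exact: coord_measurable_cst].
have pos01 x : 0 <= pmean (pos_param x) reach_ind <= 1.
  by apply: pmean_bounds; [exact: pos_param_01|exact: reach_ind_01].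
have sign01 x : 0 <= pmean (sign_param x) reach_ind <= 1.
  by apply: pmean_bounds; [exact: sign_param_01|exact: reach_ind_01].
rewrite -[leLHS](lebint_shift (fun=> -1)); last 2 first.
- move=> x; rewrite -EFinM lee_fin mulr_ge0 ?expR_ge0// subr_ge0.
  by have /andP[] := pos01 (fun i => x i + 1).
- exact: coord_measurable_emul.
apply: (@le_trans _ _ (lebint (fun x => (W x * (1 - pmean (sign_param x) reach_ind))%:E))).
  apply: le_lebint.
  - move=> x; rewrite -EFinM lee_fin mulr_ge0 ?expR_ge0// subr_ge0.
    by have /andP[] := pos01 (fun i => x i - 1 + 1).
  - apply: (@coord_measurable_subst _ _ _ _ _ (fun (x : I -> R) i => x i - 1) _
      (coord_measurable_emul mr mpos)) => i.
    by apply: coord_measurableD; [exact: coord_measurable_proj|exact: coord_measurable_cst].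
  - apply: coord_measurable_EFin.
    rewrite (_ : (fun x => _) = fun x => \sum_(w <- nr) \prod_e edge_weight x w e).
      apply: coord_measurable_sum => w.
      rewrite (_ : (fun x => _) = fun x => \prod_(e <- index_enum E) edge_weight x w e)//.
      by apply: coord_measurable_prod => e; exact: coord_measurable_edge_weight.
    by apply/funext => x; exact: eqW.
  - move=> x; rewrite -EFinM lee_fin ler_wpM2l ?expR_ge0//.
    rewrite (_ : (fun i => x i - 1 + 1) = x); last by apply/funext => i; rewrite subrK.
    by rewrite lerD2l lerN2 pmean_sign_le_pos.
apply: (@le_trans _ _ (lebint (fun x => (W x * expR (- dot h x))%:E))).
  apply: (@le_trans _ _ (\sum_(w <- nr)
      lebint (fun x => (\prod_e edge_weight x w e * expR (- dot h x))%:E))%E).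
    rewrite (_ : (fun x => _) = fun x => (\sum_(w <- nr) (\prod_e edge_weight x w e)%:E)%E).
      rewrite lebint_sum//.
      rewrite big_seq [leRHS]big_seq; apply: lee_sum => w.
      by rewrite mem_filter => /andP[nw _]; exact: lebint_flip.
    by apply/funext => x; rewrite eqW sumEFin.
  rewrite -lebint_sum; last 2 first.
  - by move=> w x; rewrite lee_fin mulr_ge0// expR_ge0.
  - move=> w; under eq_fun do rewrite EFinM.
    exact: coord_measurable_emul.
  (* The restriction to disconnecting configurations is given up here; only an exponential moment of
     the whole field remains. *)
  apply: le_lebint.
  - by move=> x; apply: sume_ge0 => w _; rewrite lee_fin mulr_ge0// expR_ge0.
  - apply: coord_measurable_esum => w; under eq_fun do rewrite EFinM.
    exact: coord_measurable_emul.
  - under eq_fun do rewrite EFinM.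
    exact: coord_measurable_emul.
  - move=> x; rewrite sumEFin lee_fin -mulr_suml ler_wpM2r ?expR_ge0// -eqW.
    rewrite ler_piMr ?expR_ge0// gerBl.
    by have /andP[] := sign01 x.
rewrite -[leLHS](lebint_shift (fun=> 1)); last 2 first.
- by move=> x; rewrite lee_fin mulr_ge0// expR_ge0.
- under eq_fun do rewrite EFinM.
  exact: coord_measurable_emul.
pose a i := -1 * h i.
have -> : lebint (fun x => (W (fun i => x i + 1)%R *
      expR (- dot h (fun i => x i + 1)%R))%:E) =
    ((expR (- H))%:E * lebint (fun x => (rho lap x * expR (dot a x))%:E))%E.
  rewrite -lebintZ ?expR_ge0//; last 2 first.
  - by move=> x; rewrite lee_fin mulr_ge0// expR_ge0.
  - under eq_fun do rewrite EFinM.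
    apply: coord_measurable_emul => //; apply: coord_measurable_EFin.
    by apply: coord_measurable_expR; exact: coord_measurable_dot.
  congr lebint; apply/funext => x; rewrite -EFinM; congr EFin.
  rewrite mulrCA /W; congr (rho _ _ * _).
    by apply/funext => i; rewrite addrK.
  rewrite -expRD; congr expR; rewrite dotDr /a dotZl mulN1r opprD addrC.
  by congr (- _ + _); apply: eq_bigr => i _; rewrite mulr1.
rewrite (@lebint_exp_dot _ _ lap a (mv C a)); [|exact: laplacian_sym|exact: QC.1].
rewrite muleA -EFinM -expRD; apply: lee_wpmul2r.
  by apply: lebint_ge0 => x; rewrite lee_fin expR_ge0.
rewrite lee_fin ler_expR /a mvZ dotZl dotZr mulN1r mulN1r opprK -/H.
have : dot h (mv C h) / 2 <= H / 2 by rewrite ler_pM2r.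
by move=> ?; lra.
Qed.

End flip.

(** * Bernoulli percolation on a finite network *)

Section joint_measurability.
Variables (R : realType) (I J : finType).

Definition jointly_measurable (F : (I -> R) -> (J -> R) -> \bar R) :=
  forall d (T : measurableType d) (g : T -> I -> R) (h : T -> J -> R),
    (forall i, measurable_fun setT (g ^~ i)) ->
    (forall j, measurable_fun setT (h ^~ j)) ->
    measurable_fun setT (fun t => F (g t) (h t)).

Lemma jointly_measurable_shift (f : (I -> R) -> \bar R) (v : J -> I -> R) (l : seq J) :
  coord_measurable f ->
  jointly_measurable (fun x w => f (fun i => x i + \sum_(j <- l) w j * v j i)).
Proof.
move=> mf d T g h mg mh.
apply: (mf _ _ (fun t i => g t i + \sum_(j <- l) h t j * v j i)) => i.
apply: measurable_funD => //; apply: measurable_sum => j.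
by apply: measurable_funM => //; exact: mh.
Qed.

Lemma coord_measurable_slice F x : jointly_measurable F -> coord_measurable (F x).
Proof. by move=> mF d T h mh; apply: (mF _ _ (fun=> x) h) => // i; exact: measurable_cst. Qed.

Lemma coord_measurable_iint_slice (k : R -> R) (l : seq J) F w :
  (forall t, 0 <= k t) -> measurable_fun setT k ->
  (forall x w, (0 <= F x w)%E) -> jointly_measurable F ->
  coord_measurable (fun x => iint k l (F x) w).
Proof.
move=> k0 mk F0 mF.
suff h : jointly_measurable (fun x w => iint k l (F x) w).
  by move=> d T g mg; apply: (h _ _ g (fun=> w)) => // j; exact: measurable_cst.
elim: l => //= i l ih d T g h mg mh.
pose H (z : T * measurableTypeR R) : \bar R :=
  ((k z.2)%:E * iint k l (F (g z.1)) (update (h z.1) i z.2))%E.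
have mH : measurable_fun setT H.
  apply: emeasurable_funM.
    by apply/measurable_EFinP; exact: (measurableT_comp mk).
  apply: (ih _ _ (fun z : T * measurableTypeR R => g z.1)
    (fun z : T * measurableTypeR R => update (h z.1) i z.2)) => j.
    exact: (measurableT_comp (mg j) measurable_fst).
  rewrite /update; case: eqVneq => _; first exact: measurable_snd.
  exact: (measurableT_comp (mh j) measurable_fst).
apply: (@measurable_fun_fubini_tonelli_F _ _ _ _ R (@lebesgue_measure R) H mH).
by move=> z; rewrite mule_ge0 ?lee_fin// iint_ge0.
Qed.

End joint_measurability.

Section domination.
Variables (R : realType) (I E : finType) (src : E -> I) (tgt : E -> option I).
Variable (S : {set I}).
Local Notation reach_ind := (@reach_ind R I E src tgt S).
Local Notation open_near := (@open_near R I E src tgt S).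
Local Notation star := (star src tgt).
Local Notation pos_param := (@pos_param R I E src tgt).

(** Off the star of [X] both ends of an edge have value at most [F], the outside included since
    [1 <= F]; the edges of the star are simply opened. *)
Lemma pos_param_le_open_near (x : I -> R) (X : {set I}) (F : R) : 1 <= F ->
  (forall i, i \notin X -> x i <= F) ->
  pmean (pos_param x) reach_ind <= open_near (fun=> 1 - expR (- (2 * (F * F)))) X.
Proof.
move=> F1 xF; have F0 : 0 <= F by exact: le_trans F1.
pose p0 : E -> R := fun=> 1 - expR (- (2 * (F * F))).
have p001 : prob_param p0 by move=> e; apply: one_sub_expR_01; rewrite mulr_ge0.
pose q e := if e \in star X then 1 else p0 e.
have q01 : prob_param q by move=> e; rewrite /q; case: ifP; rewrite ?lexx ?ler01.
have pq e : pos_param x e <= q e.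
  have /andP[h0 h1] := pos_param_01 src tgt x e.
  rewrite /q; case: (boolP (e \in star X)) => // eX.
  rewrite /pos_param /p0 lerD2l lerN2 ler_expR lerN2 ler_pM2l//.
  have off i : touches src tgt e i -> Num.max 0 (x i) <= F.
    move=> ei; rewrite ge_max F0 xF//; apply: contraNN eX => iX.
    by rewrite inE; apply/'exists_andP; exists i.
  apply: ler_pM; rewrite ?le_max ?lexx//; first by apply: off; rewrite /touches eqxx.
  case tE: (tgt e) => [i|] /=; first by apply: off; rewrite /touches tE eqxx orbT.
  by rewrite max_r ?ler01.
apply: (@le_trans _ _ (pmean q reach_ind)).
  apply: pmean_le_param => //; first exact: pos_param_01.
  exact: increasing_reach_ind.
apply: (@le_trans _ _ (pmean q (fun w => reach_ind (w :|: star X)%SET))).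
  by apply: le_pmean => // w; apply: increasing_reach_ind; exact: finset.subsetUl.
rewrite (@pmean_eq_off _ _ (star X) q p0)//.
- move=> w w' ww'; congr reach_ind; apply/finset.setP => e; rewrite !finset.in_setU.
  by case: (boolP (e \in star X)) => [|/ww' ->//]; rewrite !orbT.
- by move=> e /negbTE eX; rewrite /q eX.
Qed.

End domination.

Section sprinkling_total.
Variables (R : realType) (I E : finType) (src : E -> I) (tgt : E -> option I).
Variables (K : finType) (ctr : K -> I) (rad : K -> nat) (delta : K -> R).
Hypothesis delta01 : forall i, 0 < delta i <= 1.
Local Notation sprinkled := (sprinkled src tgt ctr rad delta).

(** Each sprinkling near [e] multiplies its probability of being closed by [1 - delta i], and a
    product of such factors is at least one minus the sum of the [delta i]. *)
Lemma sprinkled_total (l : seq K) (p : E -> R) e : prob_param p ->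
  (1 - p e) * (1 - \sum_(i <- l)
    (if e \in star src tgt (nball src tgt (rad i) (ctr i)) then delta i else 0)) <=
  1 - foldl sprinkled p l e.
Proof.
elim: l p => [|i l ih] p p01 /=; first by rewrite big_nil subr0 mulr1.
have p'01 : prob_param (sprinkled p i).
  move=> e'; have /andP[p0 p1] := p01 e'; have /andP[d0 d1] := delta01 i.
  rewrite /sprinkled; case: ifP => _; last by rewrite p0.
  apply/andP; split; first by rewrite addr_ge0// mulr_ge0 ?subr_ge0// ltW.
  by rewrite -lerBrDl ler_piMl ?subr_ge0.
apply: le_trans (ih _ p'01); rewrite big_cons.
set s := \sum_(i <- l) _; have s0 : 0 <= s.
  by apply: sumr_ge0 => j _; case: ifP => // _; have /andP[/ltW] := delta01 j.
have /andP[p0 p1] := p01 e; have /andP[d0 d1] := delta01 i.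
rewrite /sprinkled; case: ifP => _; last by rewrite add0r.
rewrite -subr_ge0 (_ : _ - _ = (1 - p e) * (delta i * s)); last by ring.
by rewrite !mulr_ge0// ?subr_ge0// ltW.
Qed.

End sprinkling_total.

(** Here [n = 2 ^ k] and the radius is [4 * n]. The count in [open_near_ball] has exponent at most
    [16 n + 2] in [D + 1], and its lists have length at most [8 n + 2]; the constants are absorbed
    as [n >= 1]. *)
Lemma scale_exponents n : (0 < n)%N ->
  ((4 * n + (4 * n).+1) * 2 <= 18 * n)%N /\ ((4 * n).*2.+2 <= 10 * n)%N.
Proof. lia. Qed.

(** * Choice of the constants and truncation of the field *)

Section finite_network.
Variables (R : realType) (D : nat) (C2 r : R).
Hypothesis C2_gt0 : 0 < C2.
Hypothesis r_gt0 : 0 < r.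
Hypothesis r_lt : r < 2^-1.

Let d1 : R := D.+1%:R.
Let A : R := 8 * d1 ^+ 4.
Let B : R := d1 ^+ 18 * 2 ^+ 10 * A.
(** [M] and [rhoc] are chosen so that [eps k ^+ 2 / (2 * (C2 * r ^+ k)) = B * 2 ^+ k], and
    [rhoc < 1] because [r < 2^-1]. In [F], the [2] is one for the boundary value and one for the
    residual field; the fraction bounds the sum of the thresholds. *)
Let M : R := Num.sqrt (2 * C2 * B).
Let rhoc : R := Num.sqrt (2 * r).
Let F : R := 2 + M / (1 - rhoc).
Let p0 : R := 1 - expR (- (2 * (F * F))).

(* [F] bounds the field away from the bad vertices, so that [p0] dominates there; the
   total sprinkling at most halves [1 - p0]. *)
Definition sup_param : R := 1 - expR (- (2 * (F * F))) / 2.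

Let d1_ge1 : 1 <= d1. Proof. by rewrite /d1 ler1n. Qed.
Let A_ge8 : 8 <= A.
Proof. by rewrite /A ler_peMr// exprn_ege1. Qed.
Let B_ge1 : 1 <= B.
Proof.
rewrite /B mulr_ege1//; last by apply: le_trans A_ge8; rewrite ler1n.
by rewrite mulr_ege1// exprn_ege1// ler1n.
Qed.
Let rho01 : 0 < rhoc < 1.
Proof.
rewrite sqrtr_gt0 mulr_gt0//= -[ltRHS]sqrtr1 ltr_sqrt//.
by rewrite -ltr_pdivlMl// mulr1.
Qed.
Let M_gt0 : 0 < M.
Proof. by rewrite sqrtr_gt0 !mulr_gt0// (lt_le_trans ltr01). Qed.
Let F_ge2 : 2 <= F.
Proof.
by have /andP[_ h] := rho01; rewrite lerDl divr_ge0 ?(ltW M_gt0)// subr_ge0 ltW.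
Qed.

(* At a vertex, the noise of scale [k] exceeds [eps k] with probability at most
   [bnd k]; it is influenced only by vertices within distance [rad k].  Sprinkling
   the nearby edges with intensity [delta k] makes up for such an event.  The
   exponents of [d1] and [2] in [A] and [B] are those making [sum_delta] and
   [bnd_small] work. *)
Let eps (k : nat) : R := M * rhoc ^+ k.
Let delta (k : nat) : R := A^-1 ^+ (2 ^ k).
Let bnd (k : nat) : R := expR (- (eps k ^+ 2 / (2 * (C2 * r ^+ k)))).
Let rad (k : nat) : nat := (4 * 2 ^ k)%N.

Lemma sup_param_lt1 : 0 <= sup_param < 1.
Proof.
rewrite /sup_param ltrBlDr ltrDl divr_gt0 ?expR_gt0//= andbT subr_ge0.
rewrite ler_pdivrMr// mul1r (@le_trans _ _ 1)//; last by rewrite ler1n.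
by rewrite -[leRHS]expR0 ler_expR oppr_le0 mulr_ge0// mulr_ge0; have := F_ge2; lra.
Qed.

Let p0_half : 2^-1 <= p0.
Proof.
have := expR_ge1Dx (2 * (F * F)); have := F_ge2 => F2 h.
have h2 : 2 <= expR (2 * (F * F)).
  apply: le_trans h; have : 2 * 2 <= F * F by apply: ler_pM.
  by lra.
rewrite /p0 expRN lerBrDl -lerBrDr.
apply: (@le_trans _ _ 2^-1); last by lra.
by rewrite lef_pV2// posrE ?expR_gt0.
Qed.

Let p0_01 (T : Type) : forall e : T, 0 <= p0 <= 1.
Proof. by move=> _; apply: one_sub_expR_01; rewrite mulr_ge0//; have := F_ge2; lra. Qed.

Let delta01 k : 0 < delta k <= 1.
Proof.
have A0 : 0 < A by exact: lt_le_trans A_ge8.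
rewrite /delta exprn_gt0 ?invr_gt0//= exprn_ile1 ?invr_ge0 ?ltW//.
by rewrite invf_lt1// (lt_le_trans _ A_ge8)// ltr1n.
Qed.

Let bndE k : bnd k = expR (- B) ^+ (2 ^ k).
Proof.
have rk : r ^+ k != 0 by rewrite expf_neq0// gt_eqF.
rewrite /bnd -expRM_natl; congr expR; rewrite /eps exprMn sqr_sqrtr; last first.
  by rewrite !mulr_ge0// ?ltW// (lt_le_trans ltr01).
rewrite -exprM mulnC exprM sqr_sqrtr ?mulr_ge0 ?ltW// exprMn natrX.
by field; rewrite rk gt_eqF.
Qed.

(** Here [bnd k] is [expR (- B)] to the power [2 ^ k], and the cost is at most [B] to the same
    power, so [B <= expR B] suffices. *)
Let bnd_small k : bnd k * ((D.+1 ^ rad k * (D.+1 ^ rad k * D) *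
    (D.+1 ^ rad k * (D.+1 ^ rad k * D)))%N%:R * (2 ^+ ((rad k).*2).+2 / delta k)) <= 1.
Proof.
pose n := (2 ^ k)%N; have n0 : (0 < n)%N by rewrite expn_gt0.
have B0 : 0 < B by exact: lt_le_trans B_ge1.
have A0 : 0 < A by exact: lt_le_trans A_ge8.
apply: (@le_trans _ _ (bnd k * B ^+ n)); last first.
  rewrite bndE -/n -exprMn exprn_ile1//; first by rewrite mulr_ge0 ?expR_ge0 ?ltW.
  rewrite expRN mulrC ler_pdivrMr ?expR_gt0// mul1r.
  by apply: le_trans (expR_ge1Dx B); rewrite lerDr.
apply: ler_wpM2l; first exact: expR_ge0.
rewrite /B exprMn [(d1 ^+ 18 * _) ^+ n]exprMn -mulrA; apply: ler_pM => //.
- by rewrite mulr_ge0 ?exprn_ge0// invr_ge0 ltW//; have /andP[] := delta01 k.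
- apply: (@le_trans _ _ ((d1 ^+ rad k * (d1 ^+ rad k * d1)) ^+ 2)).
    have -> : d1 ^+ rad k = (D.+1 ^ rad k)%N%:R by rewrite natrX.
    by rewrite expr2 -!natrM ler_nat; do 3 !apply: leq_mul => //.
  rewrite -exprSr -exprD -!exprM; apply: ler_weXn2l => //.
  exact: (scale_exponents n0).1.
- have /andP[d0 _] := delta01 k; apply: ler_pM; rewrite ?exprn_ge0// ?invr_ge0 ?(ltW d0)//.
    by rewrite -exprM ler_eXn2l ?ltr1n//; exact: (scale_exponents n0).2.
  by rewrite /delta exprVn invrK lexx.
Qed.

Let sum_eps (n : nat) : \sum_(k < n) eps k <= M / (1 - rhoc).
Proof.
have /andP[h0 h1] := rho01.
rewrite -mulr_sumr; apply: ler_wpM2l; first exact: ltW.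
rewrite -[leRHS]mul1r ler_pdivlMr ?subr_gt0//.
have -> : (\sum_(k < n) rhoc ^+ k) * (1 - rhoc) = 1 - rhoc ^+ n.
  elim: n => [|n ih]; first by rewrite big_ord0 expr0 subrr mul0r.
  by rewrite big_ord_recr/= mulrDl ih exprSr; ring.
by rewrite gerBl exprn_ge0// ltW.
Qed.

(** The factor [d1 ^+ 4] of [A] cancels the growth of balls of radius [4 * 2 ^ k]. What is left is
    [8^-1] to the power [2 ^ k], at most [8^-1 ^+ k.+1], and the total is at most [2 / 7]. *)
Let sum_delta (n : nat) : \sum_(k < n) (2 * D.+1 ^ rad k)%N%:R * delta k <= 2^-1.
Proof.
apply: (@le_trans _ _ (\sum_(k < n) 2 * 8^-1 ^+ k.+1)).
  apply: ler_sum => k _; rewrite natrM natrX -/d1 -mulrA; apply: ler_wpM2l => //.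
  rewrite /delta /rad exprM -exprMn /A invfM mulrCA divff ?mulr1; last first.
    by rewrite expf_neq0// gt_eqF// (lt_le_trans ltr01).
  by apply: ler_wiXn2l; rewrite ?invr_ge0 ?invf_le1 ?ler1n// ltn_expl.
rewrite -mulr_sumr.
have -> : \sum_(k < n) 8^-1 ^+ k.+1 = (1 - 8^-1 ^+ n) / 7 :> R.
  elim: n => [|n ih]; first by rewrite big_ord0 expr0 subrr mul0r.
  by rewrite big_ord_recr/= ih exprSr; field.
have : 0 <= 8^-1 ^+ n :> R by rewrite exprn_ge0 ?invr_ge0.
by lra.
Qed.

Section network.
Variables (I E : finType) (src : E -> I) (tgt : E -> option I).
Hypothesis grounded :
  forall i, connect (links src tgt [set: E]%SET) (Some i) None.
Hypothesis degD : forall x, (#|[set e | touches src tgt e x]%SET| <= D)%N.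
Local Notation heatk := (@heatk R I E src tgt).
Local Notation noisev := (@noisev R I E src tgt).
Local Notation lap := (@laplacian R I E src tgt).
Hypothesis heat_bound : forall (k N : nat) x,
  \sum_(m < N | (2 ^ k <= m.+1 < 2 ^ k.+1)%N)
   (heatk (m + m) x x + heatk (m + m).+1 x x) <= C2 * r ^+ k.
Variables (S : {set I}) (C : I -> I -> R).
Hypothesis QC : mutual_inverse lap C.
Local Notation reach_ind := (@reach_ind R I E src tgt S).

Section truncation.
Variables (th : R) (n : nat).
Hypothesis th01 : 0 <= th < 1.

(** [m < K] means [m.+1 < 2 ^ n], so the steps kept fill exactly the scales below [n]. *)
Let K : nat := (2 ^ n).-1.
Let J : finType := ('I_K * E)%type.
Let vn (j : J) (i : I) : R := Num.sqrt th * noisev j.1 j.2 i.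
(** The covariance left over by the noises [vn], which carry the factor [Num.sqrt th]. The part
    [(1 - th) * C] keeps it definite, so that the residual field has a density. *)
Let CR (i i' : I) : R := (1 - th) * C i i' + th * remk src tgt C (K + K) i i'.
Let scale (k m : nat) : bool := (2 ^ k <= m.+1 < 2 ^ k.+1)%N.
Let Kx : finType := ('I_n * I)%type.
Let vK (i : Kx) (j : J) : R := if scale i.1 j.1 then vn j i.2 else 0.

Let scale_inj k k' m : scale k m -> scale k' m -> k = k'.
Proof.
move=> /andP[a b] /andP[a' b']; apply/eqP; rewrite eqn_leq.
by rewrite -ltnS -(ltn_exp2l _ _ (isT : 1 < 2)%N) (leq_ltn_trans a b')/=
  -ltnS -(ltn_exp2l _ _ (isT : 1 < 2)%N) (leq_ltn_trans a' b).
Qed.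

Let scale_sum (m : 'I_K) : \sum_(k < n) (scale k m)%:R = 1 :> R.
Proof.
have mK : (m.+1 < 2 ^ n)%N.
  by rewrite -ltn_predRL.
pose k := trunc_log 2 m.+1.
have sk : scale k m by rewrite /scale trunc_log_ltn// trunc_logP.
have kn : (k < n)%N.
  by rewrite -(ltn_exp2l _ _ (isT : 1 < 2)%N); apply: leq_ltn_trans mK; exact: trunc_logP.
rewrite (bigD1 (Ordinal kn))//= sk big1 ?addr0// => k' kk'.
case: (boolP (scale k' m)) => // sk'; move/eqP: kk'; case.
by apply/val_inj => /=; exact: scale_inj sk' sk.
Qed.

Let th0 : 0 <= th. Proof. by have /andP[] := th01. Qed.

Let vnM j i i' : vn j i * vn j i' = th * (noisev j.1 j.2 i * noisev j.1 j.2 i').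
Proof. by rewrite /vn mulrACA -expr2 sqr_sqrtr. Qed.

Let CR_total i i' : CR i i' + \sum_(j <- enum J) vn j i * vn j i' = C i i'.
Proof.
rewrite big_enum/= (eq_bigr (fun j : J => th * (noisev j.1 j.2 i * noisev j.1 j.2 i'))).
  rewrite -mulr_sumr -(pair_bigA _ (fun (m : 'I_K) e => noisev m e i * noisev m e i'))/=.
  under eq_bigr do rewrite sum_noisev//.
  by rewrite (sum_heatk_pairs grounded QC) /CR; ring.
by move=> j _; exact: vnM.
Qed.

Let CR_sym : symmetric_kernel CR.
Proof. by move=> i i'; rewrite /CR (green_sym QC i i') (remkC grounded QC). Qed.

Let dot_CR x : dot x (mv CR x) =
  (1 - th) * dot x (mv C x) + th * dot x (mv (remk src tgt C (K + K)) x).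
Proof.
rewrite -!dotZr -dotDr; congr dot; apply/funext => i; rewrite /mv !mulr_sumr -big_split.
by apply: eq_bigr => j _ /=; rewrite /CR; ring.
Qed.

Let CR_psd : psd CR.
Proof.
have /andP[_ th1] := th01; move=> x; rewrite dot_CR addr_ge0// mulr_ge0//.
- by rewrite subr_ge0 ltW.
- exact: green_psd QC x.
- exact: (remk_psd grounded QC).
Qed.

Let CR_eq0 x : dot x (mv CR x) = 0 -> x = fun=> 0.
Proof.
have /andP[_ th1] := th01; rewrite dot_CR => h; apply: (green_eq0 grounded QC).
have := green_psd QC x; have := remk_psd grounded QC K x.
set a := dot _ (mv C x) in h *; set b := dot _ _ in h * => b0 a0.
have : 0 <= th * b by exact: mulr_ge0.
have : 0 <= (1 - th) * a by rewrite mulr_ge0// subr_ge0 ltW.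
move=> h1 h2; have /eqP : (1 - th) * a = 0 by lra.
by rewrite mulf_eq0 subr_eq0 gt_eqF//= => /eqP.
Qed.

Let CR_gt0 i : 0 < CR i i.
Proof.
have e : CR i i = dot (unit_vector R i) (mv CR (unit_vector R i)).
  by rewrite dotC dot_unit mv_unit.
rewrite e lt_neqAle CR_psd andbT eq_sym; apply/eqP => /CR_eq0 /(congr1 (@^~ i)).
by rewrite /unit_vector eqxx => /eqP; rewrite oner_eq0.
Qed.

(** Both vertices are within [m] steps of ends of the same edge, hence within [2 m + 1] of each
    other, and [m.+1 < 2 ^ k.+1] makes this less than [4 * 2 ^ k]. *)
Let vK_near i i' j : vK i j != 0 -> vK i' j != 0 ->
  i'.2 \in nball src tgt (rad i.1) i.2.
Proof.
rewrite /vK; case: ifP => [s1|]; last by rewrite eqxx.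
case: ifP => [s2|]; last by rewrite eqxx.
rewrite !mulf_eq0 !negb_or => /andP[_ h1] /andP[_ h2].
have [a ax ae] := noisev_near h1; have [b bx be] := noisev_near h2.
have := nball_trans (nball_trans ax (touches_ball ae be)) (nball_sym bx).
apply: (fintype.subsetP (nball_leq _ _ _ _)); rewrite /rad.
move: s1 => /andP[_]; rewrite expnS; move: (2 ^ _)%N => q; move: (j.1 : nat) => m.
clear; lia.
Qed.

Let vK_var i : \sum_j vK i j ^+ 2 <= C2 * r ^+ i.1.
Proof.
have /andP[_ th1] := th01.
apply: le_trans (heat_bound i.1 K i.2).
rewrite -(pair_bigA _ (fun (m : 'I_K) e => vK i (m, e) ^+ 2))/= [leRHS]big_mkcond/=.
apply: ler_sum => m _; rewrite /vK /=.
rewrite -/(scale i.1 m); case: (scale i.1 m); last first.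
  by rewrite big1 ?lexx// => e _; rewrite expr0n.
under eq_bigr do rewrite expr2 vnM.
rewrite -mulr_sumr sum_noisev// ler_piMl ?addr_ge0 ?heatk_ge0//.
exact: ltW.
Qed.

Let bad_rare i : (noise_mean (fun w => (bad vK (fun i => eps i.1) i w)%:R%:E) <=
  (bnd i.1)%:E)%E.
Proof.
have /andP[h0 h1] := rho01.
apply: noise_mean_tail; last exact: vK_var.
  by rewrite mulr_gt0// exprn_gt0.
by rewrite mulr_gt0// exprn_gt0.
Qed.

Local Notation badset := (@badset R I J Kx snd vK (fun i => eps i.1) (enum Kx)).

Let field_bound x w : (forall i, x i <= 1) -> forall i, i \notin badset w ->
  x i + \sum_(j <- enum J) w j * vn j i + 1 <= F.
Proof.
move=> x1 i; rewrite inE => /hasPn nb.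
suff h : \sum_(j <- enum J) w j * vn j i <= M / (1 - rhoc).
  by rewrite /F; have := x1 i; move: h; set a := \sum_(_ <- _) _; set b := M / _; lra.
apply: le_trans (sum_eps n).
have -> : \sum_(j <- enum J) w j * vn j i = \sum_(k < n) \sum_j w j * vK (k, i) j.
  rewrite big_enum/= exchange_big; apply: eq_bigr => j _ /=.
  rewrite -mulr_sumr; congr (_ * _).
  rewrite (eq_bigr (fun k : 'I_n => (scale k j.1)%:R * vn j i)).
    by rewrite -mulr_suml scale_sum mul1r.
  by move=> k _; rewrite /vK /=; case: scale; rewrite ?mul1r ?mul0r.
apply: ler_sum => k _.
by have := nb (k, i); rewrite mem_enum /= eqxx andbT /bad -leNgt; exact.
Qed.


Local Notation final_param := (foldl (sprinkled src tgt snd (fun i : Kx => rad i.1)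
  (fun i => delta i.1)) (fun=> p0) (enum Kx)).

Let all_bad_param e : final_param e <= sup_param.
Proof.
pose a (i : Kx) : R := if e \in star src tgt (nball src tgt (rad i.1) i.2) then delta i.1 else 0.
have h := @sprinkled_total R I E src tgt Kx snd (fun i => rad i.1) (fun i => delta i.1)
  (fun i => delta01 i.1) (enum Kx) (fun=> p0) e (@p0_01 E).
have suma : \sum_(i <- enum Kx) a i <= 2^-1.
  apply: le_trans (sum_delta n); rewrite big_enum/=.
  rewrite -(pair_bigA _ (fun (k : 'I_n) x => a (k, x)))/=; apply: ler_sum => k _.
  rewrite /a /= -big_mkcond/= sumr_const -[leLHS]mulr_natl; apply: ler_wpM2r.
    by have /andP[/ltW] := delta01 k.
  rewrite ler_nat; apply: leq_trans (card_star_ball_centers degD (rad k) e).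
  by rewrite cardsE.
have e0 := expR_gt0 (- (2 * (F * F))).
move: h suma; rewrite /sup_param -/(\sum_(i <- enum Kx) a i) /p0.
set s := \sum_(i <- _) _; set q := foldl _ _ _ _; set u := expR _ in e0 *.
move=> h s2; have : u * 2^-1 <= u * (1 - s) by rewrite ler_pM2l//; lra.
by move: h; rewrite opprB addrC subrK; lra.
Qed.

Let final_param_01 : prob_param final_param.
Proof.
suff : forall l p, prob_param p -> (forall e, 2^-1 <= p e) ->
    prob_param (foldl (sprinkled src tgt snd (fun i : Kx => rad i.1)
      (fun i => delta i.1)) p l) by apply => //; exact: (@p0_01 E).
elim=> //= i l ih p p01 ph.
have [h1 h2] := @sprinkled_param R I E src tgt Kx snd (fun i : Kx => rad i.1)
  (fun i => delta i.1) (fun i => delta01 i.1) p i p01 ph.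
by apply: ih => // e; have /andP[a b] := h2 e; exact: le_trans b.
Qed.

Local Notation field_ind x :=
  (pmean (@pos_param R I E src tgt (fun i => x i + 1)) reach_ind).
Local Notation crit := (pmean (fun=> sup_param) reach_ind).

Let crit_01 : 0 <= crit <= 1.
Proof.
apply: pmean_bounds; last by move=> w; exact: reach_ind_01.
by move=> e; have /andP[-> /ltW] := sup_param_lt1.
Qed.

Let field_01 x : 0 <= field_ind x <= 1.
Proof.
by apply: pmean_bounds => w; [exact: pos_param_01|exact: reach_ind_01].
Qed.

Let field_meas : coord_measurable (fun x => (field_ind x)%:E).
Proof.
apply: coord_measurable_EFin; apply: coord_measurable_pmean => e.
move=> d T g mg; apply: (@coord_measurable_pos_param R I E src tgt e _ _ (fun t i => g t i + 1)).
by move=> i; apply: measurable_funD => //; exact: mg.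
Qed.

Let vK_ge0 i j : 0 <= vK i j.
Proof.
by rewrite /vK /vn; case: ifP => // _; rewrite mulr_ge0 ?sqrtr_ge0// noisev_ge0.
Qed.

Let field_small x : (forall i, x i <= 1) ->
  (noise_mean (fun w => (field_ind (fun i => x i + \sum_(j <- enum J) w j * vn j i))%:E)
    <= crit%:E)%E.
Proof.
move=> x1; have p01 : prob_param (fun=> p0 : R) := @p0_01 E.
apply: (@le_trans _ _ (noise_mean (fun w =>
    (@open_near R I E src tgt S (fun=> p0) (badset w))%:E))).
  apply: le_iint.
  - exact: gauss_density_ge0.
  - exact: measurable_gauss_density.
  - by move=> w; rewrite lee_fin; have /andP[] :=
      field_01 (fun i => x i + \sum_(j <- enum J) w j * vn j i).
  - exact: (coord_measurable_slice x (jointly_measurable_shift vn (enum J) field_meas)).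
  - apply: coord_measurable_EFin.
    have := @coord_measurable_open_near R I E src tgt S J Kx snd vK
      (fun i => eps i.1) (fun=> p0) (enum Kx) finset.set0.
    by under eq_fun do rewrite finset.setU0.
  - move=> w; rewrite lee_fin; apply: pos_param_le_open_near.
      by apply: le_trans F_ge2; rewrite ler1n.
    by move=> i; exact: field_bound.
apply: le_trans (remove_bad S vK_ge0 vK_near (fun i => delta01 i.1) bad_rare degD
  (fun i => bnd_small i.1) (enum Kx) p01 (fun=> p0_half)) _.
rewrite lee_fin; apply: (@le_trans _ _ (@open_near R I E src tgt S (fun=> sup_param) finset.set0)).
  apply: open_near_le_param; [exact: final_param_01| |exact: all_bad_param].
  by move=> e; have /andP[-> /ltW] := sup_param_lt1.
rewrite /open_near le_eqVlt; apply/orP; left; apply/eqP; congr pmean; apply/funext => w.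
congr reach_ind; rewrite (_ : star _ _ _ = finset.set0) ?finset.setU0//.
by apply/finset.setP => e; rewrite !inE; apply/existsP => -[i]; rewrite inE.
Qed.


Local Notation gk := (@gauss_density R).

(** If the residual field exceeds [1] somewhere, the trivial bound [1] is covered by the sum;
    otherwise [field_small] applies. *)
Let field_mean x : (iint gk (enum J)
    (fun w => (field_ind (fun i => x i + \sum_(j <- enum J) w j * vn j i))%:E) (fun=> 0%R) <=
  \sum_(i <- enum I) (1 < x i)%R%:R%:E + crit%:E)%E.
Proof.
have /andP[cr0 cr1] := crit_01.
have s0 : (0 <= \sum_(i <- enum I) (1 < x i)%R%:R%:E :> \bar R)%E.
  by apply: sume_ge0 => i _; rewrite lee_fin.
have [x1|/existsNP[i]] := pselect (forall i, x i <= 1).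
  by apply: le_trans (field_small x1) _; rewrite leeDr.
move=> /negP; rewrite -ltNge => xi.
apply: (@le_trans _ _ 1%E).
  rewrite -[leRHS](@iint_gauss_cst R J (enum J) 1%E (fun=> 0%R))//.
  apply: le_iint => [||w||//|w].
  - exact: gauss_density_ge0.
  - exact: measurable_gauss_density.
  - by rewrite lee_fin; have /andP[] :=
      field_01 (fun i => x i + \sum_(j <- enum J) w j * vn j i).
  - exact: (coord_measurable_slice x (jointly_measurable_shift vn (enum J) field_meas)).
  - exact: coord_measurable_cst.
  - by rewrite lee_fin; have /andP[] :=
      field_01 (fun i => x i + \sum_(j <- enum J) w j * vn j i).
apply: (@le_trans _ _ (\sum_(i <- enum I) (1 < x i)%R%:R%:E)%E); last by rewrite leeDl.
rewrite (bigD1_seq i) ?mem_enum ?enum_uniq//= xi leeDl//.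
by apply: sume_ge0 => *; rewrite lee_fin.
Qed.

Lemma lebint_field_ind :
  (lebint (fun x => (rho lap x)%:E * (field_ind x)%:E) <=
   ((\sum_(i <- enum I) expR (- (2 * CR i i)^-1)) + crit)%:E *
     lebint (fun x => (rho lap x)%:E))%E.
Proof.
have /andP[cr0 cr1] := crit_01.
have [QR [CQ1 CQ2]] : exists Q, (forall x, mv CR (mv Q x) = x) /\ (forall x, mv Q (mv CR x) = x).
  by apply: mv_inverse => x x0; apply: CR_eq0; rewrite x0 /dot big1// => i _; rewrite mulr0.
have QCR : mutual_inverse QR CR by [].
have [Q [[QC1 QC2] sQ pQ [c c0 cE]]] :=
  @noise_chain R I J vn (enum J) QR CR QCR CR_sym CR_psd (enum_uniq J).
(* [Q] and the Laplacian invert the same kernel [C], so [rho Q] is the density of the free field. *)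
have QE : mv Q = mv lap.
  apply/funext => x; rewrite -{1}(QC.2 x).
  rewrite (_ : mv C (mv lap x) =
    mv (fun i i' => CR i i' + \sum_(j <- enum J) vn j i * vn j i') (mv lap x)) ?QC1//.
  by congr mv; apply/funext => i; apply/funext => i'; rewrite CR_total.
have rhoE : rho Q = rho lap by apply/funext => x; rewrite /rho QE.
rewrite rhoE in cE.
have mr : coord_measurable (fun x => (rho QR x)%:E).
  by apply: coord_measurable_EFin; exact: coord_measurable_rho.
(* The identity at [f = 1] relates the two total masses through [c]. *)
have L1 : lebint (fun x => (rho lap x)%:E) = (c%:E * lebint (fun x => (rho QR x)%:E))%E.
  have := cE (fun=> 1%E) (fun=> lee01) (coord_measurable_cst _).
  under eq_fun do rewrite mule1.
  under [X in _ = (_ * lebint X)%E -> _]eq_fun do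
    rewrite (@iint_gauss_cst R J (enum J) 1%E (fun=> 0%R) lee01) mule1.
  by [].
rewrite L1 muleCA cE; last 2 first.
- by move=> x; rewrite lee_fin; have /andP[] := field_01 x.
- exact: field_meas.
apply: lee_wpmul2l; first by rewrite lee_fin.
have mlarge i : coord_measurable (fun x : I -> R => (1 < x i)%R%:R%:E : \bar R).
  apply: coord_measurable_EFin; apply: coord_measurable_bool; apply: coord_measurable_lt.
    exact: coord_measurable_cst.
  exact: coord_measurable_proj.
have r0 x : (0 <= (rho QR x)%:E)%E by rewrite lee_fin expR_ge0.
have t0 i x : (0 <= (rho QR x)%:E * (1 < x i)%R%:R%:E)%E.
  by rewrite mule_ge0// lee_fin.
have mt i : coord_measurable (fun x => (rho QR x)%:E * (1 < x i)%R%:R%:E)%E.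
  by apply: coord_measurable_emul; [exact: mr|exact: mlarge].
apply: (@le_trans _ _ (lebint (fun x =>
    \sum_(i <- enum I) ((rho QR x)%:E * (1 < x i)%R%:R%:E) + crit%:E * (rho QR x)%:E)%E)).
  apply: le_lebint.
  - move=> x; rewrite mule_ge0//; apply: iint_ge0; first exact: gauss_density_ge0.
    by move=> w; rewrite lee_fin; have /andP[] :=
      field_01 (fun i => x i + \sum_(j <- enum J) w j * vn j i).
  - apply: coord_measurable_emul; first exact: mr.
    apply: (@coord_measurable_iint_slice R I J gk (enum J)
      (fun x w => (field_ind (fun i => x i + \sum_(j <- enum J) w j * vn j i))%:E)).
    + exact: gauss_density_ge0.
    + exact: measurable_gauss_density.
    + by move=> x w; rewrite lee_fin; have /andP[] :=
        field_01 (fun i => x i + \sum_(j <- enum J) w j * vn j i).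
    + exact: (jointly_measurable_shift vn (enum J) field_meas).
  - move=> d T u mu; apply: emeasurable_funD; first exact: (coord_measurable_esum (enum I) mt mu).
    by apply: emeasurable_funM; [exact: measurable_cst|exact: mr].
  - move=> x; rewrite -ge0_sume_distrr//.
    rewrite [(crit%:E * _)%E]muleC -ge0_muleDr ?lee_fin//.
      by apply: lee_wpmul2l => //; exact: field_mean.
    by apply: sume_ge0 => i _; rewrite lee_fin.
rewrite lebintD; last 4 first.
- by move=> x; exact: sume_ge0.
- exact: coord_measurable_esum.
- by move=> x; rewrite mule_ge0.
- by apply: coord_measurable_emul; [exact: coord_measurable_cst|exact: mr].
rewrite lebint_sum// lebintZ// EFinD ge0_muleDl ?lee_fin//; last first.
  by apply: sumr_ge0 => *; exact: expR_ge0.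
apply: leeD => //; rewrite -sumEFin ge0_sume_distrl; last first.
  by move=> i _; rewrite lee_fin expR_ge0.
by apply: lee_sum => i _; exact: (lebint_large QCR CR_sym CR_psd (CR_gt0 i)).
Qed.

End truncation.

End network.

End finite_network.

(** * Bounds on the quadratic form of the precision matrix, for its mass to be positive and
    finite *)

Section total_mass.
Variables (R : realType) (I : finType).
Implicit Types (Q C : I -> I -> R) (x : I -> R).

Lemma sqr_le_dot x i : x i ^+ 2 <= dot x x.
Proof.
rewrite /dot (bigD1 i)//= -expr2 lerDl; apply: sumr_ge0 => j _.
by rewrite -expr2 sqr_ge0.
Qed.

Lemma dot_mv_upper Q : exists2 a : R, 0 < a & forall x, dot x (mv Q x) <= a * dot x x.
Proof.
exists (1 + \sum_i \sum_j `|Q i j|).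
  by rewrite ltr_pwDl// !sumr_ge0// => i _; exact: sumr_ge0.
move=> x; rewrite mulrDl mul1r.
have : dot x (mv Q x) <= (\sum_i \sum_j `|Q i j|) * dot x x.
  rewrite mulr_suml; apply: ler_sum => i _; rewrite /mv mulr_sumr mulr_suml.
  apply: ler_sum => j _; have := sqr_le_dot x i; have := sqr_le_dot x j => hj hi.
  apply: le_trans (ler_norm _) _; rewrite !normrM mulrCA; apply: ler_wpM2l => //.
  rewrite -normrM; have := sqr_ge0 (x i - x j); have := sqr_ge0 (x i + x j).
  by move=> h1 h2; rewrite ler_norml; apply/andP; split; nra.
have : 0 <= dot x x by apply: sumr_ge0 => i _; rewrite -expr2 sqr_ge0.
lra.
Qed.

(** A Cauchy-Schwarz argument for the form of [Q], between [x] and column [i] of the inverse, bounds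
    [x i ^+ 2] by [C i i + 1] times the form. The [+ 1] avoids dividing by [C i i], so far only
    known to be nonnegative. *)
Lemma dot_mv_lower Q C : mutual_inverse Q C -> symmetric_kernel Q -> psd Q ->
  exists2 a : R, 0 < a & forall x, a * dot x x <= dot x (mv Q x).
Proof.
move=> [QC _] sQ pQ.
have c0 i : 0 <= C i i.
  have := pQ (mv C (unit_vector R i)).
  by rewrite QC dotC mv_unit dotC dot_unit.
have h x i : x i ^+ 2 <= (C i i + 1) * dot x (mv Q x).
  have := pQ (fun j => x j + (- (x i / (C i i + 1))) * mv C (unit_vector R i) j).
  rewrite dot_mv_sub// QC dot_unit.
  have -> : dot (mv C (unit_vector R i)) (unit_vector R i) = C i i.
    by rewrite dot_unit mv_unit.
  have := c0 i; set c := C i i; set D := dot x _ => c1.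
  have nz : c + 1 != 0 by rewrite gt_eqF//; lra.
  have -> : D + 2 * - (x i / (c + 1)) * x i + (- (x i / (c + 1))) ^+ 2 * c =
    D - x i ^+ 2 * ((c + 2) / (c + 1) ^+ 2) by field.
  rewrite subr_ge0 mulrA ler_pdivrMr ?exprn_gt0//; last by lra.
  move=> hD; rewrite -(@ler_pM2r _ (c + 1)); last by lra.
  by have := sqr_ge0 (x i); nra.
pose T := \sum_i (C i i + 1).
have T0 : 0 <= T by apply: sumr_ge0 => i _; have := c0 i; lra.
exists (1 + T)^-1; first by rewrite invr_gt0; lra.
move=> x; rewrite ler_pdivrMl; last by lra.
have : dot x x <= T * dot x (mv Q x).
  rewrite mulr_suml; apply: ler_sum => i _; rewrite -expr2; exact: h.
by have := pQ x; rewrite mulrDl mul1r; lra.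
Qed.

End total_mass.

Section finite_percolation.
Variables (R : realType) (D : nat) (C2 r : R).
Hypothesis C2_gt0 : 0 < C2.
Hypothesis r_gt0 : 0 < r.
Hypothesis r_lt : r < 2^-1.
Variables (I E : finType) (src : E -> I) (tgt : E -> option I).
Hypothesis grounded :
  forall i, connect (links src tgt [set: E]%SET) (Some i) None.
Hypothesis degD : forall x, (#|[set e | touches src tgt e x]%SET| <= D)%N.
Local Notation heatk := (@heatk R I E src tgt).
Local Notation lap := (@laplacian R I E src tgt).
Hypothesis heat_bound : forall (k N : nat) x,
  \sum_(m < N | (2 ^ k <= m.+1 < 2 ^ k.+1)%N)
   (heatk (m + m) x x + heatk (m + m).+1 x x) <= C2 * r ^+ k.
Variables (S : {set I}) (C : I -> I -> R).
Hypothesis QC : mutual_inverse lap C.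
Local Notation reach_ind := (@reach_ind R I E src tgt S).
Local Notation remk := (@remk R I E src tgt C).

Lemma remk_le i m m' : (m <= m')%N -> remk m' i i <= remk m i i.
Proof.
move=> /subnKC <-; elim: (m' - m)%N => [|k ih]; first by rewrite addn0.
by rewrite addnS; apply: le_trans ih; rewrite [leRHS](remkS grounded QC) lerDr heatk_ge0.
Qed.

(** The retained fraction [1 - th] is taken small against the diagonal of [C], and still makes the
    variance positive; the truncation time exceeds all the times at which the remainders become
    small. *)
Lemma residual_small (a : R) : 0 < a -> exists th n, 0 <= th < 1 /\ forall i,
  0 < (1 - th) * C i i + th * remk ((2 ^ n).-1 + (2 ^ n).-1) i i <= a.
Proof.
move=> a0.
have Cpos i : 0 < C i i.
  have e : C i i = dot (unit_vector R i) (mv C (unit_vector R i)).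
    by rewrite dotC dot_unit mv_unit.
  rewrite e lt_neqAle (green_psd QC) andbT eq_sym.
  apply/eqP => /(green_eq0 grounded QC) /(congr1 (@^~ i)).
  by rewrite /unit_vector eqxx => /eqP; rewrite oner_eq0.
have C0 i : 0 <= C i i by exact: (green_ge0 grounded QC).
have a2 : 0 < a / 2 by rewrite divr_gt0.
have /choice[m mP] i : exists m, remk (m + m) i i <= a / 2.
  exact: (remk_small grounded QC i a2).
pose T := 1 + \sum_i C i i; have T1 : 1 <= T by rewrite lerDl sumr_ge0.
have TC i : C i i <= T.
  by rewrite /T (bigD1 i)//= addrCA lerDl addr_ge0// sumr_ge0.
pose s := a / (2 * (T + a)).
have s0 : 0 < s by rewrite divr_gt0//; lra.
have s1 : s <= 1 by rewrite ler_pdivrMr; lra.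
exists (1 - s), (\max_i m i)%N; split; first by apply/andP; split; lra.
move=> i; have sC := mulr_gt0 s0 (Cpos i); rewrite (_ : 1 - (1 - s) = s); last by ring.
have h1 : s * C i i <= a / 2.
  apply: (@le_trans _ _ (s * (T + a))).
    by apply: ler_wpM2l; [exact: ltW|have := TC i; lra].
  by rewrite /s le_eqVlt; apply/orP; left; apply/eqP; field; rewrite gt_eqF//; lra.
set N := (_.-1 + _)%N; have h2 : remk N i i <= a / 2.
  apply: le_trans (mP i); apply: remk_le; rewrite /N.
  have h : (m i <= (2 ^ (\max_i m i)).-1)%N.
    rewrite -ltnS prednK ?expn_gt0//; apply: leq_ltn_trans (ltn_expl _ _) => //.
    exact: leq_bigmax.
  exact: leq_add.
have h3 : 0 <= remk N i i by exact: (remk_ge0 grounded QC).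
have : (1 - s) * remk N i i <= remk N i i by rewrite ler_piMl//; lra.
have : 0 <= (1 - s) * remk N i i by rewrite mulr_ge0//; lra.
by move=> ? ?; apply/andP; split; lra.
Qed.

(** The total mass splits into a disconnected part, bounded by [lebint_disconnected], and a
    connected part, bounded by the Bernoulli probability plus the residual error [s]. Dividing by
    the mass and letting [s] be arbitrarily small gives the bound. *)
Lemma finite_percolation_bound (h : I -> R) : (forall i, i \notin S -> h i = 0) ->
  dot h (mv C h) <= \sum_i h i ->
  1 - pmean (fun=> sup_param D C2 r) reach_ind <= expR (- ((\sum_i h i) / 2)).
Proof.
move=> hS hC.
have lsym : symmetric_kernel lap by exact: laplacian_sym.
have lpsd : psd lap by move=> x; rewrite dirichlet; apply: sumr_ge0 => e _; exact: sqr_ge0.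
have [a1 a10 Q1] := dot_mv_upper lap.
have [a2 a20 Q2] := dot_mv_lower QC lsym lpsd.
pose P x := pmean (pos_param src tgt (fun i => x i + 1)) reach_ind.
have P01 x : 0 <= P x <= 1.
  by apply: pmean_bounds => w; [exact: pos_param_01|exact: reach_ind_01].
have mP : coord_measurable P.
  apply: coord_measurable_pmean => e d T g mg.
  apply: (@coord_measurable_pos_param R I E src tgt e _ _ (fun t i => g t i + 1)) => i.
  by apply: measurable_funD => //; exact: mg.
have mr : coord_measurable (fun x : I -> R => (rho lap x)%:E).
  by apply: coord_measurable_EFin; exact: coord_measurable_rho.
have L0 := lebint_rho_gt0 a10 Q1; have Loo := lebint_rho_fin a20 Q2.
have dis := lebint_disconnected QC hS hC.
have split_mass : lebint (fun x => (rho lap x)%:E) =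
    (lebint (fun x => (rho lap x)%:E * (1 - P x)%:E) +
     lebint (fun x => (rho lap x)%:E * (P x)%:E))%E.
  rewrite -lebintD.
  - congr lebint; apply/funext => x.
    by rewrite -!EFinM -EFinD -mulrDr subrK mulr1.
  - move=> x; rewrite mule_ge0 ?lee_fin ?expR_ge0//.
    by have /andP[_ h1] := P01 x; rewrite subr_ge0.
  - apply: coord_measurable_emul; first exact: mr.
    apply: coord_measurable_EFin; apply: coord_measurableD; first exact: coord_measurable_cst.
    exact: coord_measurableN.
  - move=> x; rewrite mule_ge0 ?lee_fin ?expR_ge0//.
    by have /andP[] := P01 x.
  - apply: coord_measurable_emul; first exact: mr.
    exact: coord_measurable_EFin.
set L := lebint _ in L0 Loo dis split_mass.
have Lfin : L \is a fin_num by rewrite ge0_fin_numE// ltW.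
set e := expR _; apply/ler_addgt0Pr => d d0.
pose N : R := 1 + #|I|%:R; have N1 : 1 <= N by rewrite lerDl.
have d2 : 0 < d / (2 * N) by rewrite divr_gt0//; lra.
have [th [n [th01 small]]] := residual_small d2.
have := lebint_field_ind C2_gt0 r_gt0 r_lt grounded degD heat_bound S QC n th01.
rewrite -/P -/L /=; set s := \sum_(i <- _) _ => con.
have sd : s <= d.
  apply: (@le_trans _ _ (\sum_(i <- enum I) d / N)); last first.
    rewrite big_enum/= sumr_const -[leLHS]mulr_natl mulrCA ler_piMr ?(ltW d0)//.
    by rewrite ler_pdivrMr ?mul1r /N ?lerDr//; lra.
  apply: ler_sum => i _; have := small i; set c := _ + _ => /andP[c0 ci].
  (* [expR (- (2 * c)^-1) <= 2 * c] turns the variance [c <= d / (2 * N)] into an error of at most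
     [d / N] per vertex. *)
  rewrite expRN; apply: (@le_trans _ _ (2 * c)).
    rewrite -[leRHS]invrK lef_pV2 ?posrE ?expR_gt0 ?invr_gt0 ?mulr_gt0//.
    by apply: le_trans (expR_ge1Dx _); rewrite lerDr.
  by move: ci; rewrite invfM mulrCA; lra.
have : (L <= (e%:E + (s + pmean (fun=> sup_param D C2 r) reach_ind)%:E) * L)%E.
  rewrite {1}split_mass ge0_muleDl; last 2 first.
  - by rewrite lee_fin expR_ge0.
  - rewrite lee_fin addr_ge0//; first by apply: sumr_ge0 => *; exact: expR_ge0.
    have p01 : prob_param (fun _ : E => sup_param D C2 r).
      by move=> u; have /andP[-> /ltW] := sup_param_lt1 D C2_gt0 r_gt0 r_lt.
    by have /andP[] := @pmean_bounds R E _ reach_ind 0 1 p01 (@reach_ind_01 R I E src tgt S).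
  exact: leeD.
rewrite -[L]fineK// -EFinD -EFinM lee_fin => LL.
have l0 : 0 < fine L by rewrite fine_gt0// L0.
have : 1 <= e + (s + pmean (fun=> sup_param D C2 r) reach_ind).
  by rewrite -(@ler_pM2r _ (fine L))// mul1r.
lra.
Qed.

End finite_percolation.

(** * The simple random walk *)

Lemma measure_fibers d (T : measurableType d) (R : realType)
    (mu : {measure set T -> \bar R}) (U : eqType) (f : T -> U) (A : set T) (s : seq U) :
  uniq s -> (forall y, measurable (A `&` [set w | f w = y])) ->
  measurable (A `&` [set w | f w \in s]) /\
  mu (A `&` [set w | f w \in s]) = (\sum_(y <- s) mu (A `&` [set w | f w = y]))%E.
Proof.
move=> us mA; elim: s us => [_|y s ih /= /andP[ys us]].
  rewrite big_nil (_ : _ `&` _ = set0); first by rewrite measure0.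
  by apply/seteqP; split=> w // [].
have [ms es] := ih us.
have -> : A `&` [set w | f w \in y :: s] =
    (A `&` [set w | f w = y]) `|` (A `&` [set w | f w \in s]).
  apply/seteqP; split=> w /=.
    by move=> [Aw]; rewrite inE => /orP[/eqP ->|fs]; [left|right].
  by move=> [[Aw ->]|[Aw fs]]; split => //; rewrite inE ?eqxx ?fs ?orbT.
split; first exact: measurableU.
rewrite big_cons measureU//; first by apply: (congr1 (fun z => _ + z)%E).
by apply/seteqP; split=> w //= [[_ ->] [_ ys']]; rewrite ys' in ys.
Qed.

Lemma measurable_depends_on (I : choiceType) (T : pointedType) (A : set (I -> T))
    (J : {fset I}) :
  depends_on [set` J] A -> measurable (A : set (product_space I T)).
Proof. by move=> AJ; apply: sub_sigma_algebra; exists J. Qed.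

Section simple_random_walk_law.
Variables (R : realType) (V : pointedType) (G : graph V).
Hypothesis nbrs_fin : forall x, finite_set (neighbors G x).
Local Notation step := (@step R V G).
Local Notation walk := (@walk R V G).
Implicit Types (x y z : V) (B : nat -> V -> bool).

Definition nexts x : {fset V} :=
  if deg G x == 0%N then [fset x]%fset else fset_set (neighbors G x).

Lemma mem_neighbors x y : (y \in fset_set (neighbors G x)) = adj G x y.
Proof. by rewrite in_fset_set//; apply/idP/idP; rewrite inE. Qed.

Lemma step_ge0 x y : 0 <= step x y.
Proof. by rewrite /Defs.step; case: ifP => // _; rewrite divr_ge0. Qed.

Lemma step_notin x y : y \notin nexts x -> step x y = 0.
Proof.
rewrite /nexts /Defs.step; case: ifPn => [_|dy]; first by rewrite inE eq_sym => /negbTE ->.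
by rewrite mem_neighbors => /negbTE ->; rewrite mul0r.
Qed.

Lemma deg_step x y : (0 < deg G x)%N -> (deg G x)%:R * step x y = (adj G x y)%:R.
Proof.
by move=> dx; rewrite /Defs.step gtn_eqF// mulrC divfK// pnatr_eq0 gtn_eqF.
Qed.

Lemma sum_step x : \sum_(y <- nexts x) step x y = 1.
Proof.
rewrite /nexts /Defs.step; case: ifPn => [_|dy]; first by rewrite big_seq_fset1 eqxx.
rewrite -mulr_suml big_seq (eq_bigr (fun=> 1)).
  rewrite -big_seq big_const_seq count_predT iter_addr_0.
  by rewrite divff// pnatr_eq0.
by move=> z; rewrite mem_neighbors// => ->.
Qed.

(** The probability that the walk from [x] satisfies [B i] at every time [i <= n], computed from the
    first step. A time-dependent [B] covers both transition and escape probabilities. *)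
Fixpoint stay (n : nat) x B : R := (B 0%N x)%:R *
  (if n is m.+1 then \sum_(y <- nexts x) step x y * stay m y (fun i => B i.+1) else 1).

Lemma stay_ge0 n x B : 0 <= stay n x B.
Proof.
elim: n x B => [|n ih] x B /=; rewrite mulr_ge0//.
by apply: sumr_ge0 => y _; rewrite mulr_ge0 ?step_ge0.
Qed.

Lemma measurable_until n (A : set (nat -> V)) : depends_on `I_n A ->
  measurable (A : set (product_space nat V)).
Proof.
move=> An; apply: (@measurable_depends_on _ _ _ [fset i in iota 0 n]%fset).
apply: depends_onW An => i /= ni.
by rewrite in_fset /= mem_iota.
Qed.

(** The Markov property, derived from the law of finite trajectories: the induction on [n] moves the
    first constrained step into the prescribed prefix. *)
Lemma walk_prefix x n m (v : nat -> V) B :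
  walk x [set w | (forall i, (i <= m)%N -> w i = v i) /\
                  (forall i, (i <= n)%N -> B i (w (m + i)%N))] =
  ((x == v 0%N)%:R * \prod_(i < m) step (v i) (v i.+1) * stay n (v m) B)%:E.
Proof.
elim: n m v B => [|n ih] m v B.
  have [b|b] := boolP (B 0%N (v m)); last first.
    rewrite /= (negbTE b) mul0r mulr0 (_ : [set w | _] = set0) ?measure0//.
    apply/seteqP; split=> w //= [wv /(_ 0%N (leqnn _))]; rewrite addn0 wv//.
    by rewrite (negbTE b).
  rewrite /= b !mulr1 -walkP; congr (walk x _).
  apply/seteqP; split=> w //=; first by case.
  by move=> wv; split=> // i; rewrite leqn0 => /eqP ->; rewrite addn0 wv.
have [b|b] := boolP (B 0%N (v m)); last first.
  rewrite /= (negbTE b) mul0r mulr0 (_ : [set w | _] = set0) ?measure0//.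
  apply/seteqP; split=> w //= [wv /(_ 0%N isT)]; rewrite addn0 wv//.
  by rewrite (negbTE b).
rewrite /= b mul1r.
pose P : set (product_space nat V) := [set w | forall i, (i <= m)%N -> w i = v i].
set C : set (product_space nat V) := [set w | _].
pose N : set (product_space nat V) := [set w | w m.+1 \in nexts (v m)].
have dep (A : set (product_space nat V)) k : depends_on `I_k A -> measurable A.
  exact: measurable_until.
have Pdep : depends_on `I_m.+1 P.
  move=> w w' ww'; apply/propext; rewrite /P /=.
  by split=> h i im; [rewrite -ww'|rewrite ww']; rewrite ?h.
have Cdep : depends_on `I_(m + n.+2) C.
  move=> w w' ww'; apply/propext; rewrite /C /=.
  have le1 i : (i <= m)%N -> (i < m + n.+2)%N by lia.
  have le2 i : (i <= n.+1)%N -> (m + i < m + n.+2)%N by rewrite ltn_add2l ltnS.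
  split=> -[h1 h2]; split=> i im.
  - by rewrite -ww' ?h1//; exact: le1.
  - by rewrite -ww' ?h2//; exact: le2.
  - by rewrite ww' ?h1//; exact: le1.
  - by rewrite ww' ?h2//; exact: le2.
have Ndep y : depends_on `I_m.+2 [set w : nat -> V | w m.+1 = y].
  by move=> w w' ww'; rewrite /mkset ww' /=.
have mN : measurable N.
  by apply: (dep _ m.+2) => w w' ww'; rewrite /N /mkset ww' /=.
have mP : measurable P by exact: dep Pdep.
have mC : measurable C by exact: dep Cdep.
have mf y : measurable [set w : product_space nat V | w m.+1 = y] by exact: dep (Ndep y).
have [mPN PN] := measure_fibers (walk x) (f := fun w => w m.+1) (A := P)
  (fset_uniq (nexts (v m))) (fun y => measurableI _ _ mP (mf y)).
have [mCN CN] := measure_fibers (walk x) (f := fun w => w m.+1) (A := C)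
  (fset_uniq (nexts (v m))) (fun y => measurableI _ _ mC (mf y)).
set q := (_ * \prod_(i < m) _).
have PE : walk x P = q%:E by rewrite walkP.
have ext y : (x == update v m.+1 y 0%N)%:R *
    \prod_(i < m.+1) step (update v m.+1 y i) (update v m.+1 y i.+1) = q * step (v m) y.
  rewrite big_ord_recr/= /update/= eqxx ltn_eqF// mulrA; congr (_ * _ * _).
  apply: eq_bigr => i _; rewrite !ltn_eqF// ?ltnS; first exact: ltn_ord.
  by rewrite ltnW// ltnS.
have PNq : walk x (P `&` N) = q%:E.
  rewrite PN -[q in RHS]mulr1 -(sum_step (v m)) mulr_sumr -sumEFin; apply: eq_bigr => y _.
  rewrite -ext -walkP; congr (walk x _); apply/seteqP; split=> w /=.
    move=> [wv wy] i; rewrite leq_eqVlt ltnS /update.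
    by case: eqVneq => [->//|_ /=]; exact: wv.
  move=> wv; split; last by rewrite wv// /update eqxx.
  by move=> i im; rewrite wv /update ?ltn_eqF// ltnW.
(* The prefixes continued inside [nexts (v m)] already carry the whole mass [q], so the next
   position lies there almost surely. *)
have null : walk x (P `\` N) = 0%E.
  have Poo : (walk x P < +oo)%E by rewrite PE ltry.
  rewrite measureD//.
  by apply: etrans (congr2 (fun a b => a - b)%E PE PNq) _; rewrite subee.
have CN0 : walk x (C `\` N) = 0%E.
  apply: subset_measure0 null; [exact: measurableD|exact: measurableD|].
  by move=> w [[wv _] wN].
rewrite (measureDI (walk x) mC mN); apply: etrans (congr2 (fun a b => a + b)%E CN0 CN) _.
rewrite add0e mulr_sumr -sumEFin; apply: eq_bigr => y _.
rewrite mulrA -ext (_ : stay n y _ = stay n (update v m.+1 y m.+1) (fun i => B i.+1)); last first.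
  by rewrite /update eqxx.
rewrite -ih; congr (walk x _); apply/seteqP; split=> w /=.
  move=> [[wv wB] wy]; split=> [i|i im]; last by rewrite addSnnS; exact: wB.
  by rewrite leq_eqVlt ltnS /update; case: eqVneq => [->//|_ /=]; exact: wv.
move=> [wv wB].
have wm i : (i <= m)%N -> w i = v i.
  by move=> im; rewrite wv /update ?ltn_eqF// ltnW.
split; last by rewrite wv// /update eqxx.
split=> // -[|i] im; first by rewrite addn0 wm.
by rewrite -addSnnS; exact: wB.
Qed.

Lemma walk_stay x n B : walk x [set w | forall i, (i <= n)%N -> B i (w i)] = (stay n x B)%:E.
Proof.
set A : set (product_space nat V) := [set w | _].
pose Z : set (product_space nat V) := [set w | w 0%N = x].
have Z1 : walk x Z = 1%E.
  have := @walkP R V G x 0 (fun=> x); rewrite big_ord0 eqxx mulr1 => <-.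
  congr (walk x _); apply/seteqP; split=> w /=; last by move=> h; exact: h.
  by move=> wx i; rewrite leqn0 => /eqP ->.
have mZ : measurable Z.
  by apply: (@measurable_until 1) => w w' ww'; rewrite /Z /mkset ww' /=.
have mA : measurable A.
  apply: (@measurable_until n.+1) => w w' ww'; apply/propext; rewrite /A /=.
  by split=> h i im; [rewrite -ww'|rewrite ww']; rewrite ?h.
have AZ : walk x (A `\` Z) = 0%E.
  apply: (subset_measure0 _ (measurableC mZ)); first exact: measurableD.
    by move=> w [].
  by apply: etrans (probability_setC (walk x) mZ) _; rewrite Z1 subee.
apply: etrans (measureDI (walk x) mA mZ) _.
rewrite [X in (X + _)%E](_ : _ = 0%E) ?add0e; last exact: AZ.
have := walk_prefix x n 0 (fun=> x) B; rewrite eqxx big_ord0 !mul1r => <-.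
congr (walk x _); apply/seteqP; split=> w /=.
  by move=> [wB wx]; split=> // i; rewrite leqn0 => /eqP ->.
by move=> [wx wB]; split=> //; exact: wx.
Qed.

Local Notation transition := (@transition R V G).

Lemma transitionE n x y : transition n x y = stay n x (fun i z => (i == n) ==> (z == y)).
Proof.
rewrite /Defs.transition -[RHS]/(fine (stay n x _)%:E) -walk_stay; congr (fine (walk x _)).
apply/seteqP; split=> w /=.
  by move=> wy i _; apply/implyP => /eqP ->; rewrite wy.
by move=> /(_ n (leqnn _)); rewrite eqxx /= => /eqP.
Qed.

Lemma transition0 x y : transition 0 x y = (x == y)%:R.
Proof. by rewrite transitionE /= mulr1. Qed.

Lemma transitionS n x y :
  transition n.+1 x y = \sum_(z <- nexts x) step x z * transition n z y.
Proof. by rewrite transitionE /= mul1r; apply: eq_bigr => z _; rewrite transitionE. Qed.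

Lemma transition_ge0 n x y : 0 <= transition n x y.
Proof. by rewrite transitionE stay_ge0. Qed.

Lemma transition_le1 n x y : transition n x y <= 1.
Proof.
elim: n x => [|n ih] x; first by rewrite transition0 lern1 leq_b1.
rewrite transitionS -(sum_step x); apply: ler_sum => z _.
by rewrite ler_piMr ?step_ge0.
Qed.

Section escape.
Variable S : {fset V}.

Definition escape_until (n : nat) x : R := stay n x (fun i z => (0 < i)%N ==> (z \notin S)).

Definition escape x : R := fine (walk x [set w | forall k, (1 <= k)%N -> w k \notin S]).

Lemma escape_until0 x : escape_until 0 x = 1.
Proof. by rewrite /escape_until /= mulr1. Qed.

Lemma escape_untilS n x : escape_until n.+1 x =
  \sum_(y <- nexts x) step x y * ((y \notin S)%:R * escape_until n y).
Proof.
rewrite /escape_until /= mul1r; apply: eq_bigr => y _; congr (_ * _).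
by case: n => [|n] /=; rewrite ?mul1r.
Qed.

Lemma escape_until_01 n x : 0 <= escape_until n x <= 1.
Proof.
elim: n x => [|n ih] x; first by rewrite escape_until0 ler01 lexx.
rewrite escape_untilS; apply/andP; split.
  apply: sumr_ge0 => y _; have /andP[h _] := ih y.
  by rewrite !mulr_ge0 ?step_ge0.
rewrite -[leRHS](sum_step x); apply: ler_sum => y _; have /andP[h0 h1] := ih y.
rewrite ler_piMr ?step_ge0//; case: (y \notin S); rewrite ?mul1r ?mul0r//.
Qed.

Lemma walk_escape_until n x :
  walk x [set w | forall i, (1 <= i <= n)%N -> w i \notin S] = (escape_until n x)%:E.
Proof.
rewrite /escape_until -walk_stay; congr (walk x _); apply/seteqP; split=> w /=.
  by move=> wS i im; apply/implyP => i0; apply: wS; rewrite i0.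
by move=> wS i /andP[i0 im]; have := wS i im; rewrite i0.
Qed.

Lemma escape_until_cvg x : escape_until n x @[n --> \oo] --> escape x.
Proof.
pose F n : set (product_space nat V) := [set w | forall i, (1 <= i <= n)%N -> w i \notin S].
have mF n : measurable (F n).
  apply: (@measurable_until n.+1) => w w' ww'; apply/propext; rewrite /F /=.
  by split=> h i /andP[i0 im]; [rewrite -ww'|rewrite ww']; rewrite ?h ?i0//= ltnS.
have capF : \bigcap_n F n = [set w | forall k, (1 <= k)%N -> w k \notin S].
  apply/seteqP; split=> w /=; first by move=> h k k0; apply: (h k) => //; rewrite k0 leqnn.
  by move=> h n _ i /andP[i0 _]; exact: h.
have mcap : measurable (\bigcap_n F n) by exact: bigcap_measurable.
have := @nonincreasing_cvg_mu _ _ _ (walk x) F _ mF mcap.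
rewrite capF => cF.
have fin : walk x [set w | forall k, (1 <= k)%N -> w k \notin S] \is a fin_num.
  by rewrite -capF fin_num_measure.
have {}cF : ((walk x \o F) n @[n --> \oo] --> (escape x)%:E)%E.
  rewrite /escape fineK//; apply: cF; first by rewrite ltey_eq fin_num_measure.
  by move=> m n mn; apply/subsetPset => w h i /andP[i0 im]; apply: h; rewrite i0 (leq_trans im).
rewrite (_ : escape_until ^~ x = fine \o (walk x \o F)); first exact: fine_cvg cF.
by apply/funext => n; rewrite /= walk_escape_until.
Qed.

Lemma escapeE x : escape x = \sum_(y <- nexts x) step x y * ((y \notin S)%:R * escape y).
Proof.
apply: (@cvg_unique _ (@norm_hausdorff _ _) (escape_until n.+1 x @[n --> \oo])).
  by have := @escape_until_cvg x; rewrite -cvg_shiftS.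
rewrite (_ : (fun n => _) = fun n => \sum_(y <- nexts x)
  step x y * ((y \notin S)%:R * escape_until n y)); last first.
  by apply/funext => n; rewrite escape_untilS.
apply: cvg_big => [|y _]; first exact: add_continuous.
by do 2 apply: cvgMr; exact: escape_until_cvg.
Qed.

Lemma escape_01 x : 0 <= escape x <= 1.
Proof.
have cv := @escape_until_cvg x.
rewrite -(cvg_lim _ cv)//; apply/andP; split.
  by apply: limr_ge => //; [exact: cvgP cv|apply: nearW => n; have /andP[] := escape_until_01 n x].
by apply: limr_le => //; [exact: cvgP cv|apply: nearW => n; have /andP[] := escape_until_01 n x].
Qed.

End escape.

(* Decomposition of the walk up to time [N] at its last visit to [x]. *)
Lemma last_visit x N y :
  \sum_(k < N.+1) transition k y x * escape_until [fset x]%fset (N - k) x +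
    (y != x)%:R * escape_until [fset x]%fset N y = 1.
Proof.
elim: N y => [|N ih] y.
  rewrite big_ord_recl big_ord0 addr0 transition0 !escape_until0 !mulr1.
  by case: eqP => _; rewrite ?addr0 ?add0r.
rewrite big_ord_recl /= subn0 transition0.
transitivity (escape_until [fset x]%fset N.+1 y +
  \sum_(k < N.+1) transition k.+1 y x * escape_until [fset x]%fset (N - k) x).
  rewrite addrAC; congr (_ + _).
  by case: eqVneq => [->|_]; rewrite ?mul1r ?mul0r ?addr0 ?add0r.
rewrite escape_untilS (eq_bigr (fun k : 'I_N.+1 => \sum_(z <- nexts y)
  step y z * (transition k z x * escape_until [fset x]%fset (N - k) x))); last first.
  by move=> k _; rewrite transitionS mulr_suml; apply: eq_bigr => z _; rewrite mulrA.
rewrite exchange_big -big_split /= -[RHS](sum_step y); apply: eq_bigr => z _.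
by rewrite -mulr_sumr -mulrDr inE addrC ih mulr1.
Qed.

End simple_random_walk_law.

(** * Transience, and its consequences for the graph *)

Section transience.
Variables (R : realType) (V : pointedType) (G : graph V).
Hypothesis nbrs_fin : forall x, finite_set (neighbors G x).
Variables (d c : R).
Hypothesis d_gt4 : 4 < d.
Hypothesis c_gt0 : 0 < c.
Hypothesis heat_kernel : forall (x : V) (n : nat), (1 <= n)%N ->
  transition R G n x x <= c / n%:R `^ (d / 2).
Local Notation step := (@step R V G).
Local Notation transition := (@transition R V G).
Local Notation escape := (@escape R V G).
Local Notation escape_until := (@escape_until R V G).
Implicit Types x y z : V.

(** As [d / 2 >= 2], the return probability at time [m + 1], with [m = M + k], is at most [c / (m +
    1) ^ 2 <= c * (1 / m - 1 / (m + 1))], which telescopes. *)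
Lemma transition_tail M n x : (0 < M)%N ->
  \sum_(k < n) transition (M + k).+1 x x <= c * (M%:R^-1 - (M + n)%:R^-1).
Proof.
move=> M0; elim: n => [|n ih]; first by rewrite big_ord0 addn0 subrr mulr0.
rewrite big_ord_recr/=.
suff h : transition (M + n).+1 x x <= c * ((M + n)%:R^-1 - (M + n.+1)%:R^-1).
  by apply: le_trans (lerD ih h) _; rewrite -mulrDr subrKA.
apply: le_trans (heat_kernel _ _) _ => //; apply: ler_wpM2l; first exact: ltW.
have m0 : 0 < (M + n)%:R :> R by rewrite ltr0n addn_gt0 M0.
rewrite addnS; set m := (M + n)%N in m0 *.
apply: (@le_trans _ _ ((m.+1%:R ^+ 2)^-1)).
  rewrite lef_pV2 ?posrE ?exprn_gt0 ?powR_gt0// -powR_mulrn//.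
  by apply: ler_powR; [rewrite ler1n|rewrite ler_pdivlMr// -natrM ltW].
have -> : m%:R^-1 - m.+1%:R^-1 = (m%:R * m.+1%:R)^-1 :> R.
  by rewrite -natr1; field; rewrite natr1 pnatr_eq0 /= gt_eqF.
rewrite lef_pV2 ?posrE ?exprn_gt0 ?mulr_gt0//.
by rewrite expr2; apply: ler_wpM2r => //; rewrite ler_nat.
Qed.

(** Otherwise the decomposition at the last visit could not sum to [1]: last visits after time [M]
    contribute at most [c / M <= 4^-1], and those up to time [M] carry the probability of avoiding
    [x] over a long remaining time, which would tend to [0]. *)
Lemma escape_gt0 x : 0 < escape [fset x]%fset x.
Proof.
have /andP[e0 _] := escape_01 R nbrs_fin [fset x]%fset x.
rewrite lt_neqAle e0 andbT eq_sym; apply/eqP => ez.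
have cv := @escape_until_cvg R V G nbrs_fin [fset x]%fset x.
rewrite ez in cv.
have [M M0 cM] : exists2 M : nat, (0 < M)%N & c / M%:R <= 4^-1.
  have h : 4 * c < (Num.bound (4 * c))%:R by apply: archi_boundP; rewrite mulr_ge0// ltW.
  have h0 : 0 < (Num.bound (4 * c))%:R :> R by apply: le_lt_trans h; rewrite mulr_ge0// ltW.
  by exists (Num.bound (4 * c)); [rewrite -(ltr0n R)|rewrite ler_pdivrMr//; lra].
have : \forall n \near \oo, escape_until [fset x]%fset n x < (4 * M.+1%:R)^-1.
  have := cvgr_lt 0 cv; apply.
  by rewrite invr_gt0 mulr_gt0.
move=> [n0 _ small].
have := @last_visit R V G nbrs_fin x (M + n0) x; rewrite eqxx mul0r addr0.
rewrite -(big_mkord xpredT (fun k => transition k x x *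
  escape_until [fset x]%fset (M + n0 - k) x)).
rewrite (@big_cat_nat _ _ _ M.+1)/= ?ltnS ?leq_addr//.
suff : \sum_(0 <= k < M.+1) transition k x x * escape_until [fset x]%fset (M + n0 - k) x +
   \sum_(M.+1 <= k < (M + n0).+1) transition k x x * escape_until [fset x]%fset (M + n0 - k) x
   <= 4^-1 + 4^-1 by move=> h e; move: h; rewrite e; lra.
apply: lerD.
  apply: (@le_trans _ _ (\sum_(0 <= k < M.+1) (4 * M.+1%:R)^-1)).
    rewrite big_nat [leRHS]big_nat; apply: ler_sum => k /andP[_ kM].
    have /andP[h0 _] := escape_until_01 R nbrs_fin [fset x]%fset (M + n0 - k) x.
    apply: (@le_trans _ _ (escape_until [fset x]%fset (M + n0 - k) x)).
      by rewrite ler_piMl// transition_le1.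
    by apply/ltW/small; rewrite /= -ltnS in kM *; lia.
  rewrite sumr_const_nat subn0 -[leLHS]mulr_natl invfM mulrCA divff ?mulr1//.
apply: le_trans cM; apply: (@le_trans _ _ (\sum_(k < n0) transition (M + k).+1 x x)).
  rewrite -{1}[M.+1]add0n big_addn -addSn addKn big_mkord; apply: ler_sum => k _.
  have /andP[_ h1] := escape_until_01 R nbrs_fin [fset x]%fset (M + n0 - (k + M.+1)) x.
  have -> : (M + k).+1 = (k + M.+1)%N by lia.
  by rewrite ler_piMr// transition_ge0.
apply: le_trans (transition_tail _ _ M0) _; apply: ler_wpM2l; first exact: ltW.
by rewrite gerBl invr_ge0.
Qed.

(** At an isolated vertex the walk stays put and never escapes. *)
Lemma deg_gt0 x : (0 < deg G x)%N.
Proof.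
rewrite lt0n; apply/eqP => dx; have := escape_gt0 x; rewrite escapeE//.
rewrite /nexts dx eqxx big_seq_fset1 inE eqxx mul0r mulr0.
by rewrite ltxx.
Qed.

Lemma adjC x y : adj G x y = adj G y x.
Proof. by rewrite /adj /= fsetUC. Qed.

(** On a finite graph, summing the one-step equation for the escape probability from [{x}] with the
    degrees as weights would cancel all terms but [deg x * escape x], the degree being a reversible
    measure. *)
Lemma infinite_vertices : infinite_set [set: V].
Proof.
move=> finV; pose F := fset_set [set: V]; have FE y : y \in F by rewrite in_fset_set// inE.
have sumF x (f : V -> R) : \sum_(y <- nexts G x) step x y * f y = \sum_(y <- F) step x y * f y.
  apply: big_fset_incl; first by apply/fsubsetP => y _; exact: FE.
  by move=> y _ yN; rewrite (step_notin R nbrs_fin yN) mul0r.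
pose x : V := point; pose e := escape [fset x]%fset.
pose g y := (y \notin [fset x]%fset)%:R * e y.
have key : \sum_(y <- F) (deg G y)%:R * e y = \sum_(y <- F) (deg G y)%:R * g y.
  transitivity (\sum_(y <- F) \sum_(z <- F) (adj G y z)%:R * g z).
    apply: eq_bigr => y _; rewrite /e escapeE// sumF mulr_sumr.
    by apply: eq_bigr => z _; rewrite mulrA deg_step// deg_gt0.
  rewrite exchange_big; apply: eq_bigr => z _ /=; rewrite -mulr_suml; congr (_ * _).
  under eq_bigr do rewrite adjC -(deg_step R _ (deg_gt0 z)).
  rewrite -mulr_sumr -[RHS]mulr1; congr (_ * _).
  have := sumF z (fun=> 1); rewrite -!mulr_suml !mulr1 => <-.
  exact: sum_step.
move: key; rewrite (big_fsetD1 x (FE x)) [RHS](big_fsetD1 x (FE x))/=.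
rewrite {1}/g inE eqxx mul0r mulr0 add0r.
rewrite [X in _ + X = _](_ : _ = \sum_(y <- (F `\ x)%fset) (deg G y)%:R * g y); last first.
  rewrite big_seq [RHS]big_seq; apply: eq_bigr => y; rewrite !inE => /andP[yx _].
  by rewrite /g inE yx mul1r.
move=> /eqP; rewrite -subr_eq0 addrK mulf_eq0 pnatr_eq0 gtn_eqF ?deg_gt0//=.
by rewrite gt_eqF// escape_gt0.
Qed.

End transience.

(** * The network of a finite vertex set *)

Lemma fset2_eqr (K : choiceType) (a b y : K) :
  ([fset a; b]%fset == [fset a; y]%fset) = (b == y).
Proof.
apply/eqP/eqP => [e|-> //].
have : b \in [fset a; y]%fset by rewrite -e !inE eqxx orbT.
have : y \in [fset a; b]%fset by rewrite e !inE eqxx orbT.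
by rewrite !inE => /orP[/eqP ->|/eqP ->]// /orP[/eqP ->|/eqP ->].
Qed.

Lemma ler_sum_fset (R : numDomainType) (K : choiceType) (A B : {fset K}) (f : K -> R) :
  (forall y, 0 <= f y) -> (forall y, y \notin B -> f y = 0) ->
  \sum_(y <- A) f y <= \sum_(y <- B) f y.
Proof.
move=> f0 fB; rewrite (@big_fset_incl _ _ _ _ B (A `|` B)%fset); last 2 first.
- exact: fsubsetUr.
- by move=> y _ /fB.
rewrite (big_fsetID _ (mem A))/=.
have -> : [fset x in (A `|` B)%fset | x \in A]%fset = A.
  by apply/fsetP => y; rewrite !inE; case: (y \in A); rewrite ?andbF ?orbT.
by rewrite lerDl; apply: sumr_ge0.
Qed.

Section network_of_fset.
Variables (V : pointedType) (G : graph V).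
Hypothesis nbrs_fin : forall x, finite_set (neighbors G x).
Variable L : {fset V}.
Implicit Types (i j : L).

Lemma finite_touching : finite_set [set e : edges G | exists2 x, x \in L & x \in val e].
Proof.
pose P := (\bigcup_(x <- L) [fset [fset x; y]%fset | y in fset_set (neighbors G x)])%fset.
apply: (@sub_finite_set _ _ ((val : edges G -> {fset V}) @^-1` [set` P])).
  move=> e [x xL xe] /=; apply/bigfcupP; exists x; first by rewrite xL.
  have e2 := edges_card2 (set_valP e); rewrite (cardfsD1 x) xe add1n in e2.
  case: e2 => /eqP/cardfs1P[y ey].
  have eE : val e = [fset x; y]%fset by rewrite -(fsetD1K xe) ey.
  apply/imfsetP; exists y; last exact: eE.
  by rewrite /= mem_neighbors// /adj /= -eE; apply/asboolP; exact: set_valP.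
apply: finite_preimage; last exact: finite_fset.
by move=> e e' _ _; exact: val_inj.
Qed.

Definition touching : {fset edges G} :=
  fset_set [set e : edges G | exists2 x, x \in L & x \in val e].

Lemma mem_touching (e : edges G) : (e \in touching) <-> exists2 x, x \in L & x \in val e.
Proof.
rewrite /touching in_fset_set; last exact: finite_touching.
by split => [/set_mem|/mem_set].
Qed.

Lemma touching_ends (e : touching) : exists p : L * V,
  val (val e) = [fset val p.1; p.2]%fset /\ val p.1 != p.2.
Proof.
have /mem_touching[x xL xe] := valP e.
have e2 := edges_card2 (set_valP (val e)); rewrite (cardfsD1 x) xe add1n in e2.
case: e2 => /eqP/cardfs1P[y ey].
exists ([` xL]%fset, y); split => /=; first by rewrite -(fsetD1K xe) ey.
by have : y \in (val (val e) `\ x)%fset; [rewrite ey inE|rewrite !inE eq_sym => /andP[]].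
Qed.

(** The orientation is an arbitrary choice with the source in [L]; in [ntgt], [insub] sends an end
    outside [L] to [None]. *)
Definition nsrc (e : touching) : L := (projT1 (cid (touching_ends e))).1.
Definition nother (e : touching) : V := (projT1 (cid (touching_ends e))).2.
Definition ntgt (e : touching) : option L := insub (nother e).

Lemma nendsE e : val (val e) = [fset val (nsrc e); nother e]%fset.
Proof. by have [] := projT2 (cid (touching_ends e)). Qed.

Lemma nends_neq e : val (nsrc e) != nother e.
Proof. by have [] := projT2 (cid (touching_ends e)). Qed.

Lemma ntgtE e j : (ntgt e == Some j) = (nother e == val j).
Proof.
apply/eqP/eqP => [|h]; first by rewrite /ntgt; case: insubP => // u _ <- [->].
by rewrite /ntgt h valK.
Qed.

Lemma edge_adj (e : edges G) x y : val e = [fset x; y]%fset -> adj G x y.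
Proof. by move=> ee; rewrite /adj /= -ee; apply/asboolP; exact: set_valP. Qed.

Lemma touching_edge i y : adj G (val i) y ->
  exists e : touching, val (val e) = [fset val i; y]%fset.
Proof.
move=> iy; have h : [set` edges G] [fset val i; y]%fset by [].
have eE : (SigSub (mem_set (set_mem iy)) : edges G) \in touching.
  by apply/mem_touching; exists (val i); [exact: valP|rewrite !inE eqxx].
by exists [` eE]%fset.
Qed.

Lemma touching_joins e i y : val (val e) = [fset val i; y]%fset ->
  joins nsrc ntgt e (Some i) (insub y).
Proof.
rewrite nendsE /joins => h; have : val (nsrc e) \in [fset val i; y]%fset.
  by rewrite -h !inE eqxx.
rewrite !inE => /orP[/eqP si|/eqP sy].
  move/eqP: h; rewrite si fset2_eqr => /eqP <-.
  by rewrite -(val_inj si) !eqxx.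
apply/orP; right; rewrite -sy valK eqxx /= eq_sym ntgtE.
by move/eqP: h; rewrite -sy [X in _ == X]fsetUC fset2_eqr.
Qed.

Variable R : realType.
Local Notation atsrc := (@atsrc R L touching nsrc).
Local Notation attgt := (@attgt R L touching ntgt).
Local Notation asum := (@asum R L touching nsrc ntgt).
Local Notation adjk := (@adjk R L touching nsrc ntgt).
Local Notation degk := (@degk R L touching nsrc ntgt).

Lemma sum_edge i y :
  \sum_(e : touching) (val (val e) == [fset val i; y]%fset)%:R = (adj G (val i) y)%:R :> R.
Proof.
have [iy|iy] := boolP (adj G (val i) y); last first.
  rewrite big1// => e _; case: eqP => // /edge_adj h.
  by rewrite h in iy.
have [e0 e0E] := touching_edge iy.
rewrite (bigD1 e0)//= e0E eqxx big1 ?addr0// => e ee0.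
case: eqP => // eE; move/eqP: ee0; case; apply/val_inj/val_inj.
exact: (etrans eE (esym e0E)).
Qed.

Lemma network_adjk i j : adjk i j = (adj G (val i) (val j))%:R.
Proof.
rewrite -sum_edge; apply: eq_bigr => e _; rewrite /atsrc /attgt !ntgtE nendsE.
have [<-|si] := eqVneq (nsrc e) i.
  rewrite fset2_eqr mul1r [nother e == val (nsrc e)]eq_sym (negbTE (nends_neq e)).
  by rewrite mul0r addr0.
rewrite mul0r add0r; have [oi|oi] := eqVneq (nother e) (val i).
  by rewrite oi fsetUC fset2_eqr mul1r.
rewrite mul0r; case: eqP => // h; have : val i \in [fset val (nsrc e); nother e]%fset.
  by rewrite h !inE eqxx.
by rewrite !inE (inj_eq val_inj) eq_sym (negbTE si) eq_sym (negbTE oi).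
Qed.

Lemma network_asum e i : asum e i =
  \sum_(y <- fset_set (neighbors G (val i))) (val (val e) == [fset val i; y]%fset)%:R.
Proof.
have one (z : V) : adj G (val i) z -> \sum_(y <- fset_set (neighbors G (val i))) (z == y)%:R = 1 :> R.
  rewrite -mem_neighbors// => zi; rewrite (big_fsetD1 z zi)/= eqxx big_seq big1 ?addr0// => y.
  by rewrite !inE eq_sym => /andP[/negbTE ->].
rewrite /asum /atsrc /attgt ntgtE.
have [si|si] := eqVneq (nsrc e) i.
  rewrite -si [nother e == _]eq_sym (negbTE (nends_neq e)) addr0.
  under eq_bigr do rewrite nendsE fset2_eqr.
  by rewrite si one// -si; apply: (edge_adj (e := val e)); exact: nendsE.
rewrite add0r; have [oi|oi] := eqVneq (nother e) (val i).
  under eq_bigr do rewrite nendsE oi fsetUC fset2_eqr.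
  by rewrite one// -oi; apply: (edge_adj (e := val e)); rewrite nendsE fsetUC.
rewrite big1// => y _; case: eqP => // h.
have : val i \in val (val e) by rewrite h !inE eqxx.
by rewrite nendsE !inE (inj_eq val_inj) eq_sym (negbTE si) eq_sym (negbTE oi).
Qed.

Lemma network_degk i : degk i = (deg G (val i))%:R.
Proof.
rewrite /degk; under eq_bigr do rewrite network_asum.
rewrite exchange_big /=; under eq_bigr do rewrite sum_edge.
rewrite big_seq (eq_bigr (fun=> 1)); last by move=> y; rewrite mem_neighbors// => ->.
by rewrite -big_seq big_const_seq count_predT iter_addr_0.
Qed.

Lemma network_touches (D : nat) : (forall x, (deg G x <= D)%N) ->
  forall i, (#|[set e | touches nsrc ntgt e i]%SET| <= D)%N.
Proof.
move=> dD i; apply: leq_trans (dD (val i)); rewrite -(ler_nat R) -network_degk.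
rewrite cardsE -sum1_card natr_sum big_mkcond/=; apply: ler_sum => e _.
rewrite /touches /asum /atsrc /attgt unfold_in /=.
by case: (nsrc e == i); case: (ntgt e == Some i); rewrite /= ?addr0 ?add0r// lerDl.
Qed.

Lemma network_grounded : connected_graph G -> infinite_set [set: V] ->
  forall i, connect (links nsrc ntgt [set: touching]%SET) (Some i) None.
Proof.
move=> Gc Vinf i; have [y yL] : exists y, y \notin L.
  apply: contrapT => /forallNP h; apply: Vinf; apply: (@sub_finite_set _ _ [set` L]).
    by move=> y _ /=; have := h y => /negP; rewrite negbK.
  exact: finite_fset.
have [s + sy] := Gc (val i) y.
elim: s i sy => [|z s ih] i /= sy; first by rewrite -sy (valP i) in yL.
move=> /andP[iz zs]; have [e eE] := touching_edge iz.
have lk : links nsrc ntgt [set: touching]%SET (Some i) (insub z).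
  by apply/'exists_andP; exists e; rewrite inE; split => //; exact: touching_joins.
have [zL|zL] := boolP (z \in L); last first.
  by rewrite insubN// in lk; exact: connect1.
apply: (connect_trans (connect1 lk)); rewrite insubT; exact: ih.
Qed.

Local Notation powk := (@powk R L touching nsrc ntgt).
Local Notation heatk := (@heatk R L touching nsrc ntgt).
Local Notation transition := (@transition R V G).
Local Notation escape := (@escape R V G).
Local Notation step := (@step R V G).
Hypothesis deg_gt0 : forall x, (0 < deg G x)%N.

(** The network walk is the simple random walk killed on leaving [L]. *)
Lemma powk_le_transition m i j : powk m i j <= transition m (val i) (val j).
Proof.
elim: m i => [|m ih] i; first by rewrite transition0//= (inj_eq val_inj).
rewrite /= transitionS//.
apply: (@le_trans _ _ (\sum_(h : L) step (val i) (val h) * transition m (val h) (val j))).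
  apply: ler_sum => h _; rewrite /transk network_adjk network_degk -deg_step//.
  rewrite [(deg G _)%:R * _]mulrC mulfK ?pnatr_eq0 ?gtn_eqF//.
  by apply: ler_wpM2l => //; exact: step_ge0.
rewrite -(big_seq_fsetE _ L xpredT (fun y => step (val i) y * transition m y (val j))).
apply: ler_sum_fset => y; first by rewrite mulr_ge0 ?step_ge0 ?transition_ge0.
by move=> yN; rewrite (step_notin R nbrs_fin yN) mul0r.
Qed.

Lemma heatk_le_transition m i : heatk m i i <= transition m (val i) (val i).
Proof.
rewrite /heatk network_degk; apply: le_trans (powk_le_transition m i i).
have p0 : 0 <= powk m i i.
  elim: m {1}i => //= m ih h; apply: sumr_ge0 => k _; rewrite mulr_ge0//.
  by rewrite /transk network_adjk network_degk divr_ge0.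
by rewrite ler_pdivrMr ?ltr0n// ler_peMr// ler1n.
Qed.

Section capacity_flow.
Variables (S : {fset V}) (C : L -> L -> R).
Hypothesis SL : (S `<=` L)%fset.
Hypothesis grounded : forall i, connect (links nsrc ntgt [set: touching]%SET) (Some i) None.
Hypothesis QC : mutual_inverse (@laplacian R L touching nsrc ntgt) C.

(** The equilibrium measure of [S] in the infinite graph, although [C] belongs to the walk killed
    outside [L]; its total mass is therefore the capacity itself, for every [L]. *)
Definition escape_flow i : R :=
  if val i \in S then (deg G (val i))%:R * escape S (val i) else 0.

Lemma sum_escape_flow : \sum_i escape_flow i = capacity R G S.
Proof.
rewrite -(big_seq_fsetE _ L xpredT (fun x => if x \in S then (deg G x)%:R * escape S x else 0)).
transitivity (\sum_(x <- S) if x \in S then (deg G x)%:R * escape S x else 0).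
  by symmetry; apply: big_fset_incl => // x _ /negbTE ->.
by rewrite big_seq [RHS]big_seq; apply: eq_bigr => x ->.
Qed.

(* The hitting probability of [S] is superharmonic with Laplacian [escape_flow]. *)
Lemma green_escape_flow i : mv C escape_flow i <= 1.
Proof.
pose F x : R := 1 - (x \notin S)%:R * escape S x.
have F0 x : 0 <= F x.
  rewrite /F subr_ge0; have /andP[h0 h1] := escape_01 R nbrs_fin S x.
  by case: (x \notin S); rewrite ?mul1r ?mul0r.
have lapF j : escape_flow j <= mv (@laplacian R L touching nsrc ntgt) (fun k => F (val k)) j.
  rewrite mv_laplacianE network_degk.
  have h : \sum_(k : L) adjk j k * F (val k) <= (deg G (val j))%:R * (1 - escape S (val j)).
    under eq_bigr do rewrite network_adjk -deg_step// -mulrA.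
    rewrite -mulr_sumr; apply: ler_wpM2l => //.
    rewrite -(big_seq_fsetE _ L xpredT (fun y => step (val j) y * F y)).
    apply: (@le_trans _ _ (\sum_(y <- nexts G (val j)) step (val j) y * F y)).
      apply: ler_sum_fset => y; first by rewrite mulr_ge0 ?step_ge0.
      by move=> yN; rewrite (step_notin R nbrs_fin yN) mul0r.
    rewrite (escapeE R nbrs_fin S (val j)) -[X in X - _](sum_step R nbrs_fin (val j)) -sumrB.
    by apply: ler_sum => y _; rewrite mulrBr mulr1.
  apply: le_trans (lerB (lexx _) h); rewrite /escape_flow /F.
  by case: ifP => _; rewrite ?mul0r ?mul1r le_eqVlt; apply/orP; left; apply/eqP; ring.
have h : 0 <= F (val i) + -1 * mv C escape_flow i.
  have -> : F (val i) + -1 * mv C escape_flow i = mv C (fun j =>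
      mv (@laplacian R L touching nsrc ntgt) (fun k => F (val k)) j + -1 * escape_flow j) i.
    by rewrite mvD QC.2; congr (_ + _); rewrite (mvZ C (-1) escape_flow).
  by apply: (mv_green_ge0 grounded QC) => j; rewrite mulN1r subr_ge0.
suff : F (val i) <= 1 by move: h; lra.
rewrite /F gerBl; have /andP[h0 _] := escape_01 R nbrs_fin S (val i).
by rewrite mulr_ge0.
Qed.

Lemma escape_flow_energy : dot escape_flow (mv C escape_flow) <= \sum_i escape_flow i.
Proof.
apply: ler_sum => i _; rewrite ler_piMr ?green_escape_flow// /escape_flow.
case: ifP => // _; rewrite mulr_ge0//.
by have /andP[] := escape_01 R nbrs_fin S (val i).
Qed.

End capacity_flow.

End network_of_fset.

(** * Heat kernel bounds on dyadic scales *)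

Lemma card_scale (k N : nat) : (\sum_(m < N | 2 ^ k <= m.+1 < 2 ^ k.+1) 1 <= 2 ^ k)%N.
Proof.
rewrite -(big_mkord (fun m => 2 ^ k <= m.+1 < 2 ^ k.+1)%N (fun=> 1%N)) -big_filter.
rewrite sum1_size -[leqRHS](size_iota (2 ^ k).-1).
apply: uniq_leq_size; first by rewrite filter_uniq// iota_uniq.
move=> m; rewrite mem_filter mem_iota => /andP[/andP[h1 h2] _].
by move: h1 h2; rewrite expnS; have := expn_gt0 2 k; move: (2 ^ k)%N => t; lia.
Qed.

Section heat_kernel_scales.
Variables (R : realType) (V : pointedType) (G : graph V).
Hypothesis nbrs_fin : forall x, finite_set (neighbors G x).
Variables (d c : R).
Hypothesis d_gt4 : 4 < d.
Hypothesis c_gt0 : 0 < c.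
Hypothesis heat_kernel : forall (x : V) (n : nat), (1 <= n)%N ->
  transition R G n x x <= c / n%:R `^ (d / 2).
Local Notation transition := (@transition R V G).

(** Scale [k] has [2 ^ k] steps, with return probabilities of order [(2 ^ k) ^ (- d / 2)]: this is
    the ratio of the variance bounds of consecutive scales, and [d > 4] makes it smaller than
    [2^-1]. *)
Definition scale_ratio : R := 2 / 2 `^ (d / 2).

Let q_gt4 : 4 < 2 `^ (d / 2) :> R.
Proof.
rewrite [ltLHS](_ : _ = 2 `^ 2%:R); last by rewrite powR_mulrn// expr2 -natrM.
rewrite /powR pnatr_eq0/= ltr_expR ltr_pM2r; last by rewrite ln_gt0// ltr1n.
by rewrite ltr_pdivlMr// -natrM.
Qed.

Lemma scale_ratio_gt0 : 0 < scale_ratio.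
Proof. by rewrite divr_gt0// powR_gt0. Qed.

Lemma scale_ratio_lt : scale_ratio < 2^-1.
Proof. by rewrite ltr_pdivrMr ?powR_gt0// mulrC ltr_pdivlMr// -natrM. Qed.

Lemma transition_scale (k n : nat) x : (2 ^ k <= n)%N ->
  transition n x x <= c / (2 `^ (d / 2)) ^+ k.
Proof.
move=> kn; have n0 : (0 < n)%N by apply: leq_trans kn; rewrite expn_gt0.
apply: le_trans (heat_kernel x n0) _; apply: ler_wpM2l; first exact: ltW.
rewrite lef_pV2 ?posrE ?exprn_gt0 ?powR_gt0 ?ltr0n//.
have -> : (2 `^ (d / 2)) ^+ k = (2 ^ k)%N%:R `^ (d / 2).
  by rewrite natrX -[2 ^+ k]powR_mulrn// -[LHS]powR_mulrn ?powR_ge0// -!powRrM [d / 2 * _]mulrC.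
apply: ge0_ler_powR; rewrite ?nnegrE ?ler0n ?ler_nat//.
by rewrite divr_ge0// ltW// (lt_trans _ d_gt4).
Qed.

Lemma transition_block (k N : nat) x :
  \sum_(m < N | (2 ^ k <= m.+1 < 2 ^ k.+1)%N)
    (transition (m + m) x x + transition (m + m).+1 x x) <= (2 + 2 * c) * scale_ratio ^+ k.
Proof.
pose q : R := 2 `^ (d / 2); have q0 : 0 < q by exact: powR_gt0.
have b m : (2 ^ k <= m.+1 < 2 ^ k.+1)%N ->
    transition (m + m) x x + transition (m + m).+1 x x <= (2 + 2 * c) / q ^+ k.
  (* At scale [0] only [m = 0] occurs, and the heat kernel bound starts at time [1]; both
     probabilities are bounded by [1], whence the [2] in the constant. For [k > 0], [2 ^ k <= m.+1]
     implies [2 ^ k <= m + m]. *)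
  case: (posnP k) => [->|k0].
    move=> _; rewrite expr0 invr1 mulr1.
    have := transition_le1 R nbrs_fin (m + m) x x.
    by have := transition_le1 R nbrs_fin (m + m).+1 x x; have := c_gt0; lra.
  move=> /andP[km _]; have km2 : (2 ^ k <= m + m)%N.
    by case: k k0 km => // k _; rewrite expnS; have := expn_gt0 2 k; move: (2 ^ k)%N => t; lia.
  have h1 := transition_scale x km2; have h2 := transition_scale x (leqW km2).
  have h3 : 0 <= 2 / q ^+ k by rewrite divr_ge0// exprn_ge0// ltW.
  by rewrite mulrDl -mulrA; move: h1 h2; rewrite -/q; lra.
apply: (@le_trans _ _ (\sum_(m < N | (2 ^ k <= m.+1 < 2 ^ k.+1)%N) (2 + 2 * c) / q ^+ k)).
  by apply: ler_sum => m /b.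
have -> : \sum_(m < N | (2 ^ k <= m.+1 < 2 ^ k.+1)%N) (2 + 2 * c) / q ^+ k =
    (2 + 2 * c) / q ^+ k * (\sum_(m < N | 2 ^ k <= m.+1 < 2 ^ k.+1) 1)%N%:R.
  by rewrite natr_sum mulr_sumr; apply: eq_bigr => m _; rewrite mulr1.
rewrite -mulrA; apply: ler_wpM2l; first by rewrite addr_ge0// mulr_ge0// ltW.
rewrite /scale_ratio -/q expr_div_n -natrX mulrC.
apply: ler_wpM2r; first by rewrite invr_ge0 exprn_ge0// ltW.
by rewrite ler_nat card_scale.
Qed.

End heat_kernel_scales.

Definition exits (V : pointedType) (G : graph V)
    (nbrs_fin : forall x, finite_set (neighbors G x)) (S L : {fset V})
    (u : {set touching G L}) : bool :=
  reaches (@nsrc V G nbrs_fin L) (@ntgt V G nbrs_fin L) [set i : L | val i \in S]%SET u.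

Section finite_approximation.
Variables (R : realType) (V : pointedType) (G : graph V).
Hypothesis G_connected : connected_graph G.
Variable D : nat.
Hypothesis nbrs_fin : forall x, finite_set (neighbors G x).
Hypothesis degD : forall x, (deg G x <= D)%N.
Variables (d c : R).
Hypothesis d_gt4 : 4 < d.
Hypothesis c_gt0 : 0 < c.
Hypothesis heat_kernel : forall (x : V) (n : nat), (1 <= n)%N ->
  transition R G n x x <= c / n%:R `^ (d / 2).

(** Determined by the degree bound, [c] and [d], hence the same for all [L] and [S]. *)
Definition threshold : R := sup_param D (2 + 2 * c) (scale_ratio d).

Lemma threshold_lt1 : 0 <= threshold < 1.
Proof.
apply: sup_param_lt1; first by rewrite ltr_pwDr// mulr_gt0.
  exact: scale_ratio_gt0.
exact: scale_ratio_lt.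
Qed.

Lemma exits_bound (S L : {fset V}) : (S `<=` L)%fset ->
  1 - pmean (fun=> threshold) (fun u => (@exits V G nbrs_fin S L u)%:R : R) <=
  expR (- (2^-1 * capacity R G S)).
Proof.
move=> SL; have dg := deg_gt0 nbrs_fin d_gt4 c_gt0 heat_kernel.
have Vinf := infinite_vertices nbrs_fin d_gt4 c_gt0 heat_kernel.
have gr := network_grounded nbrs_fin (L := L) G_connected Vinf.
have [C QC] := green_exists R gr.
have C20 : 0 < 2 + 2 * c by rewrite ltr_pwDr// mulr_gt0.
have hb k N i : \sum_(m < N | (2 ^ k <= m.+1 < 2 ^ k.+1)%N)
    (heatk R (@nsrc V G nbrs_fin L) (@ntgt V G nbrs_fin L) (m + m) i i +
     heatk R (@nsrc V G nbrs_fin L) (@ntgt V G nbrs_fin L) (m + m).+1 i i) <=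
    (2 + 2 * c) * scale_ratio d ^+ k.
  apply: le_trans (transition_block nbrs_fin d_gt4 c_gt0 heat_kernel k N (val i)).
  by apply: ler_sum => m _; apply: lerD; exact: heatk_le_transition.
have := finite_percolation_bound C20 (scale_ratio_gt0 d) (scale_ratio_lt d_gt4) gr
  (network_touches nbrs_fin R degD) hb
  (S := [set i : L | val i \in S]%SET) QC (h := @escape_flow V G L R S).
rewrite [2^-1 * _]mulrC -(sum_escape_flow G R SL) => h; apply: h.
  by move=> i; rewrite inE /escape_flow => /negbTE ->.
exact: (escape_flow_energy dg S gr QC).
Qed.

End finite_approximation.

(** * Exhaustion *)

Section cluster_exhaustion.
Variables (R : realType) (V : pointedType) (G : graph V).
Hypothesis nbrs_fin : forall x, finite_set (neighbors G x).
Implicit Types (x y : V) (S L : {fset V}) (w : configuration G).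

Lemma linked_trans (r : rel V) x y z : linked r x y -> r y z -> linked r x z.
Proof.
by move=> [s xs <-] yz; exists (rcons s z); rewrite ?rcons_path ?xs ?last_rcons.
Qed.

Lemma linked0 (r : rel V) x : linked r x x.
Proof. by exists [::]. Qed.

Definition confined S L : set (configuration G) :=
  [set w | forall x, x \in S -> cluster_of w x `<=` [set` L]].

(** A path from [S] is followed edge by edge: as long as it has stayed in [L], its next edge touches
    [L], where the configurations agree. The event thus depends on finitely many edges. *)
Lemma confined_sub S L w w' : (forall e, e \in touching G L -> w e = w' e) ->
  confined S L w -> confined S L w'.
Proof.
move=> ww' wS x xS y [s + <-].
have : cluster_of w x x by exact: linked0.
elim: s {2 3 4}x => [|z s ih] u /= cu; first by move=> _; exact: wS cu.
move=> /andP[/asboolP[e [eE we]]]; apply: ih.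
apply: (linked_trans cu); apply/asboolP; exists e; split => //.
rewrite ww'//; apply/mem_touching => //; exists u; first exact: wS cu.
by rewrite eE !inE eqxx.
Qed.

Lemma measurable_confined S L : measurable (confined S L).
Proof.
apply: (@measurable_depends_on _ _ _ (touching G L)) => w w' ww'.
apply/propext; split; apply: confined_sub => e eL; first exact: ww'.
by rewrite ww'.
Qed.

(** A network path to [None] contains an edge to a vertex outside [L], which would belong to the
    cluster of a point of [S]. *)
Lemma exits_not_confined S L w : confined S L w ->
  ~~ exits nbrs_fin S [set e : touching G L | w (val e)]%SET.
Proof.
move=> wS; apply/negP => /'exists_andP[i [iS /connectP[p]]]; rewrite inE in iS.
have : cluster_of w (val i) (val i) by exact: linked0.
elim: p {2 3 4}i => [|a p ih] j //= cj /andP[/'exists_andP[e [we]] ja] pN lastN.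
rewrite inE in we.
have step_to z : val (val e) = [fset val j; z]%fset -> cluster_of w (val i) z.
  by move=> ez; apply: (linked_trans cj); apply/asboolP; exists (val e).
case: a ja pN lastN => [k|] ja pN lastN.
  apply: ih pN lastN; apply: step_to; rewrite nendsE.
  move: ja => /orP[|] /andP[/eqP[->]]; rewrite eq_sym ntgtE => /eqP -> //.
  by rewrite fsetUC.
move: ja => /orP[|] /andP[] //.
move=> /eqP[jE]; rewrite eq_sym => /eqP none.
have : nother nbrs_fin e \in L.
  by apply: (wS _ iS); apply: step_to; rewrite nendsE jE.
by move=> oL; move: none; rewrite /ntgt insubT.
Qed.

(** The seed [point] makes the hulls exhaust the graph even when [S] is empty. *)
Fixpoint hull S (n : nat) : {fset V} :=
  if n is m.+1 then (hull S m `|` \bigcup_(x <- hull S m) fset_set (neighbors G x))%fset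
  else (point |` S)%fset.

Lemma hull_leq S m n : (m <= n)%N -> (hull S m `<=` hull S n)%fset.
Proof.
move=> /subnKC <-; elim: (n - m)%N => [|k ih]; first by rewrite addn0.
by rewrite addnS /=; apply: (fsubset_trans ih); exact: fsubsetUl.
Qed.

Lemma sub_hull S n : (S `<=` hull S n)%fset.
Proof. by apply: fsubset_trans (hull_leq S (leq0n n)); exact: fsubsetU1. Qed.

Lemma hull_exhausts S y : connected_graph G -> exists n, y \in hull S n.
Proof.
move=> /(_ point y)[s + <-]; have : point \in hull S 0 by rewrite !inE eqxx.
elim: s 0%N (point : V) => [|z s ih] n x /= xn; first by move=> _; exists n.
move=> /andP[xz]; apply: (ih n.+1) => /=; rewrite inE; apply/orP; right.
by apply/bigfcupP; exists x; rewrite ?xn// mem_neighbors.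
Qed.

(** Finitely many finite clusters have a finite union, which lies in a single hull. *)
Lemma not_to_infinityE S : connected_graph G ->
  ~` to_infinity G S = \bigcup_n confined S (hull S n).
Proof.
move=> Gc; apply/seteqP; split=> w /=; last first.
  move=> [n _ wn] [x xS]; apply; apply: (sub_finite_set (wn x xS)); exact: finite_fset.
move=> wS; have fin x : x \in S -> finite_set (cluster_of w x).
  by move=> xS; apply: contrapT => inf; apply: wS; exists x.
pose U := \bigcup_(x in [set` S]) cluster_of w x.
have finU : finite_set U by apply: bigcup_finite => //; exact: finite_fset.
have /choice[t tP] y : exists n, y \in hull S n by exact: hull_exhausts.
exists (\max_(y <- fset_set U) t y)%N => // x xS y cy /=.
have yU : y \in fset_set U by rewrite in_fset_set// inE; exists x.
apply: (fsubsetP (hull_leq S _)) (tP y).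
exact: (@leq_bigmax_seq _ _ _ t).
Qed.

End cluster_exhaustion.

(** * Percolation on finitely many edges, and the limit *)

Section cylinder_probability.
Variables (R : realType) (V : pointedType) (G : graph V) (p : {i01 R}).
Implicit Types (J : {fset edges G}).

(** The event is cut according to the restriction of the configuration to [J]; each of the finitely
    many values has the product weight that characterizes percolation. *)
Lemma percolation_pmean J (A : {set J} -> bool) :
  let event := [set w : configuration G | A [set e : J | w (val e)]%SET] in
  measurable event /\
  percolation G p event = (pmean (fun=> p%:num) (fun u => (A u)%:R))%:E.
Proof.
move=> event; pose f (w : configuration G) := [set e : J | w (val e)]%SET.
have dep (T : Type) (h : {set J} -> T) : depends_on [set` J] (h \o f).
  move=> w w' ww'; rewrite /= /f; congr h; apply/finset.setP => e.
  by rewrite !inE ww'//=; exact: valP.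
have mev : measurable event.
  by apply: (@measurable_depends_on _ _ _ J); exact: (dep _ (fun u => is_true (A u))).
have mf u : measurable [set w | f w = u].
  by apply: (@measurable_depends_on _ _ _ J); exact: (dep _ (fun v => v = u)).
split => //.
have [_] := measure_fibers (percolation G p) (f := f) (A := event)
  (enum_uniq {set J}) (fun u => measurableI _ _ mev (mf u)).
rewrite (_ : _ `&` _ = event); last first.
  by apply/seteqP; split=> w /=; [case|split => //; rewrite mem_enum].
move=> ->; rewrite pmean_sumE -sumEFin big_enum/=; apply: eq_bigr => u _.
have [Au|Au] := boolP (A u); last first.
  rewrite mul0r (_ : _ `&` _ = set0) ?measure0//.
  by apply/seteqP; split=> w //= [Aw wu]; move: Au; rewrite -wu Aw.
pose t (e : edges G) := if insub e is Some e' then e' \in u else false.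
have tE (e : J) : t (val e) = (e \in u) by rewrite /t valK.
rewrite mul1r (_ : _ `&` _ = [set w | forall e, e \in J -> w e = t e]).
  rewrite percolationP; congr EFin; rewrite (big_seq_fsetE _ J xpredT)/=.
  by apply: eq_bigr => e _; rewrite tE /bernoulli_pmf.
apply/seteqP; split=> w /=.
  move=> [_ wu] e eJ; rewrite -[e]/(val [` eJ]%fset) tE -wu inE//.
move=> we; have wu : f w = u.
  by apply/finset.setP => e; rewrite inE we ?tE//; exact: valP.
by split => //; rewrite /event /= -/(f w) wu.
Qed.

End cylinder_probability.

Theorem theorem1p1 (R : realType) (V : pointedType) (G : graph V)
  (G_connected : connected_graph G) (G_bounded : bounded_degree G)
  (d c : R) (d_gt4 : 4 < d) (c_gt0 : 0 < c)
  (heat_kernel : forall (x : V) (n : nat), (1 <= n)%N ->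
    transition R G n x x <= c / n%:R `^ (d / 2)) :
  (exists p : {i01 R}, p%:num < 1 /\
    forall S : {fset V},
      (percolation G p (~` to_infinity G S) <=
        (expR (- (2^-1 * capacity R G S)))%:E)%E) /\
  (forall x : V, (critical_parameter R G x < 1)%E).
Proof.
have [D degD] := G_bounded.
have nbrs_fin x : finite_set (neighbors G x) by case: (degD x).
have deg_le x : (deg G x <= D)%N by case: (degD x).
have /andP[t0 t1] := threshold_lt1 D d_gt4 c_gt0.
pose p : {i01 R} := Itv01 t0 (ltW t1).
have mcompl S : measurable (~` to_infinity G S : set (configuration G)).
  rewrite (not_to_infinityE nbrs_fin)//; apply: bigcup_measurable => n _.
  exact: measurable_confined.
have bound S : (percolation G p (~` to_infinity G S) <=
    (expR (- (2^-1 * capacity R G S)))%:E)%E.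
  have := mcompl S; rewrite (not_to_infinityE nbrs_fin)// => mU.
  (* Continuity from below along an increasing sequence of events, each contained in a
     finite-network event to which the uniform bound applies. *)
  have cv : (percolation G p \o (fun n => confined S (hull G S n))) n @[n --> \oo] -->
      percolation G p (\bigcup_n confined S (hull G S n)).
    apply: nondecreasing_cvg_mu => //; first by move=> n; exact: measurable_confined.
    move=> m n mn; apply/subsetPset => w wm x xS y /(wm x xS).
    exact: (fsubsetP (hull_leq G S mn)).
  rewrite -(cvg_lim _ cv)//; apply: lime_le; first by apply/cvg_ex; eexists; exact: cv.
  apply: nearW => n /=.
  have [mE PE] := @percolation_pmean R V G p (touching G (hull G S n))
    (fun u => ~~ exits nbrs_fin S u).
  apply: (@le_trans _ _ (percolation G p [set w : configuration G |
      ~~ exits nbrs_fin S [set e : touching G (hull G S n) | w (val e)]%SET])).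
    apply: le_measure; rewrite ?inE//; first exact: measurable_confined.
    by move=> w; exact: exits_not_confined.
  rewrite PE lee_fin.
  apply: le_trans (exits_bound G_connected nbrs_fin deg_le d_gt4 c_gt0 heat_kernel (sub_hull G S n)).
  rewrite -[X in X - _](@pmean_cst R (touching G (hull G S n)) (fun=> threshold D d c)).
  rewrite -pmeanB le_eqVlt; apply/orP; left; apply/eqP; congr pmean; apply/funext => u.
  by case: exits; rewrite ?subrr ?subr0.
split; first by exists p.
move=> x; apply: le_lt_trans (_ : ((p%:num)%:E < 1)%E); last by rewrite lte_fin.
apply: ereal_inf_lbound; exists p => //=.
(* Transience and the absence of isolated vertices make the capacity of a point positive, so its
   disconnection has probability less than [1] at [p]. *)
have cap0 : 0 < capacity R G [fset x]%fset.
  rewrite /capacity big_seq_fset1 mulr_gt0//.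
    by rewrite ltr0n (deg_gt0 nbrs_fin d_gt4 c_gt0 heat_kernel).
  exact: (escape_gt0 nbrs_fin d_gt4 c_gt0 heat_kernel).
rewrite -[to_infinity _ _]setCK.
apply: (@lt_le_trans _ _ (1 - percolation G p (~` to_infinity G [fset x]%fset))%E); last first.
  by rewrite le_eqVlt; apply/orP; left; apply/eqP; symmetry; exact: probability_setC.
rewrite sube_gt0; apply: le_lt_trans (bound _) _.
by rewrite lte_fin -[ltRHS]expR0 ltr_expR oppr_lt0 mulr_gt0.
Qed.
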